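(* Let $m\ge 1$, let $\{u_i\}_{i=1}^m$ and $\{v_i\}_{i=1}^m$ be orthonormal sets of functions in $H^2$, and let $\mathcal{M} \subseteq H^2$ be a closed subspace. Suppose $\mathcal{M}$ is invariant under $T_z - \sum_{i=1}^{m} v_i \otimes u_i$. Define \[ \mathcal{L} := \operatorname{span}\{P_{\mathcal{M}^\perp} v_1, \ldots, P_{\mathcal{M}^\perp} v_m\}. \] Assume that $\{\varphi_i\}_{i=1}^p \subseteq H^\infty$ is an orthonormal basis for $\mathcal{L}$. Then there exists an inner function $\Psi \in H^\infty_{\mathcal{B}(\mathbb{C}^{p'}, \mathbb{C}^{p+1})}$ for some $p' \leq p+1$ such that \[ \mathcal{M} = \{g\in H^2 : (T_{\bar{\varphi}_1} g, \ldots, T_{\bar{\varphi}_p} g, g) \in \Psi H^2_{\mathbb{C}^{p'}}\}. \]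
   Context: $H^2$ is the Hardy space on the open unit disc $\mathbb{D}$, regarded also as a closed subspace of $L^2(\mathbb{T})$, where $\mathbb{T}$ is the unit circle; $H^\infty$ is the space of bounded analytic functions on $\mathbb{D}$. $T_zf=zf$ on $H^2$. For $\psi\in L^\infty(\mathbb{T})$ the Toeplitz operator is $T_\psi f=P_{H^2}(\psi f)$, $f\in H^2$, with $P_{H^2}$ the orthogonal projection of $L^2(\mathbb{T})$ onto $H^2$. For $u,v\in H^2$, $(u\otimes v)f=\langle f,v\rangle u$. $P_{\mathcal{S}}$ is the orthogonal projection onto a closed subspace $\mathcal{S}$. $H^2_{\mathbb{C}^{q}}$ is the $\mathbb{C}^q$-valued Hardy space on $\mathbb{D}$, identified with $q$ copies of $H^2$. $H^\infty_{\mathcal{B}(\mathbb{C}^{p'},\mathbb{C}^{p+1})}$ is the set of bounded analytic functions on $\mathbb{D}$ with values in the bounded operators from $\mathbb{C}^{p'}$ to $\mathbb{C}^{p+1}$; such $\Psi$ is inner if $\Psi(z)^*\Psi(z)=I_{\mathbb{C}^{p'}}$ for a.e. $z\in\mathbb{T}$. *)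

(* Defs.v *)
From HB Require Import structures.
From mathcomp Require Import all_boot all_order all_algebra.
From mathcomp Require Import complex.
From mathcomp Require Import all_classical all_reals all_analysis.

Set Implicit Arguments.
Unset Strict Implicit.
Unset Printing Implicit Defensive.

Import Order.TTheory GRing.Theory Num.Theory.
Import numFieldNormedType.Exports.

Local Open Scope classical_set_scope.
Local Open Scope ring_scope.
Local Open Scope complex_scope.

(* A function on the open unit disc is represented by a function R[i] -> R[i]
   vanishing outside the disc, so that Leibniz equality is equality on the
   disc. The copy R[i]^o of R[i] carries the normed topology of the modulus. *)
Definition offdisc0 (R : realType) (f : R[i] -> R[i]) : Prop :=
  forall z, 1 <= `|z| -> f z = 0.

(* A function on the unit circle is represented by a function of the angle
   t in [0, 2 pi], the point of the circle being cis t. *)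
Definition cis (R : realType) (t : R) : R[i] := cos t +i* sin t.

Definition angles (R : realType) : set R := `[0, 2 * pi].

Definition circle_int (R : realType) (h : R -> R[i]) : R[i] :=
  ((2 * pi)^-1)%:C *
  (Rintegral lebesgue_measure (@angles R) (fun t => complex.Re (h t)) +i*
   Rintegral lebesgue_measure (@angles R) (fun t => complex.Im (h t))).

Definition sqmod (R : realType) (z : R[i]) : R :=
  complex.Re z ^+ 2 + complex.Im z ^+ 2.

Definition L2circle (R : realType) : set (R -> R[i]) :=
  [set h : R -> R[i] |
   [/\ measurable_fun (@angles R)
         (fun t : measurableTypeR R => complex.Re (h t)),
       measurable_fun (@angles R)
         (fun t : measurableTypeR R => complex.Im (h t)) &
       (\int[lebesgue_measure]_(t in @angles R) (sqmod (h t))%:E < +oo)%E]].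

Definition L2ip (R : realType) (h k : R -> R[i]) : R[i] :=
  circle_int (fun t => h t * Num.conj (k t)).

Definition H2 (R : realType) : set (R[i] -> R[i]) :=
  [set f | offdisc0 f /\
     exists a : nat -> R[i],
       cvgn (series (fun n => sqmod (a n))) /\
       forall z : R[i], `|z| < 1 ->
         (series (fun n => a n * z ^+ n : R[i]^o) @ \oo --> (f z : R[i]^o))].

(* h is the boundary function of f: the dilations t |-> f (r e^{it}) converge
   to h in L^2 of the circle as r -> 1-. *)
Definition is_boundary (R : realType) (f : R[i] -> R[i]) (h : R -> R[i])
    : Prop :=
  L2circle h /\
  (\int[lebesgue_measure]_(t in @angles R)
     (sqmod (f (r%:C * cis t) - h t))%:E)%E @[r --> (1 : R)^'-] --> 0%E.

(* The embedding of H^2 into L^2 of the circle; the value is determined almost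
   everywhere. *)
Definition boundary (R : realType) (f : R[i] -> R[i]) : R -> R[i] :=
  xget (fun=> 0) [set h | is_boundary f h].

Definition H2ip (R : realType) (f g : R[i] -> R[i]) : R[i] :=
  L2ip (boundary f) (boundary g).

Definition H2norm (R : realType) (f : R[i] -> R[i]) : R :=
  Num.sqrt (complex.Re (H2ip f f)).

Definition orthonormal_family (R : realType) (n : nat)
    (e : 'I_n -> R[i] -> R[i]) : Prop :=
  (forall i, H2 (e i)) /\ (forall i j, H2ip (e i) (e j) = (i == j)%:R).

Definition span_family (R : realType) (n : nat) (e : 'I_n -> R[i] -> R[i])
    : set (R[i] -> R[i]) :=
  [set f | exists c : 'I_n -> R[i], f = \sum_(i < n) (c i \*o e i)].

Definition orthonormal_basis (R : realType) (n : nat)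
    (e : 'I_n -> R[i] -> R[i]) (L : set (R[i] -> R[i])) : Prop :=
  orthonormal_family e /\ span_family e = L.

Definition closed_subspace (R : realType) (M : set (R[i] -> R[i])) : Prop :=
  [/\ M `<=` @H2 R,
      M 0,
      forall (c : R[i]) f g, M f -> M g -> M (c \*o f + g) &
      forall g, H2 g ->
        (forall eps : R, 0 < eps ->
           exists2 f, M f & H2norm (g - f) < eps) ->
        M g].

Definition orthogonal_complement (R : realType) (M : set (R[i] -> R[i]))
    : set (R[i] -> R[i]) :=
  [set f | H2 f /\ forall g, M g -> H2ip f g = 0].

Definition orth_proj (R : realType) (S : set (R[i] -> R[i])) (f : R[i] -> R[i])
    : R[i] -> R[i] :=
  xget 0 [set g | S g /\ forall k, S k -> H2ip (f - g) k = 0].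

(* The orthogonal projection of L^2 of the circle onto H^2. *)
Definition projH2 (R : realType) (h : R -> R[i]) : R[i] -> R[i] :=
  xget 0 [set g | H2 g /\
    forall k, H2 k -> L2ip (h - boundary g) (boundary k) = 0].

Definition toeplitz (R : realType) (psi : R -> R[i]) (f : R[i] -> R[i])
    : R[i] -> R[i] :=
  projH2 (psi \* boundary f).

Definition Tz (R : realType) (f : R[i] -> R[i]) : R[i] -> R[i] :=
  fun z => z * f z.

Definition rank_one (R : realType) (u v f : R[i] -> R[i]) : R[i] -> R[i] :=
  H2ip f v \*o u.

Definition invariant_under (R : realType)
    (A : (R[i] -> R[i]) -> (R[i] -> R[i])) (M : set (R[i] -> R[i])) : Prop :=
  forall f, M f -> M (A f).

Definition Hinf (R : realType) : set (R[i] -> R[i]) :=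
  [set f | [/\ offdisc0 f,
     (forall z : R[i], `|z| < 1 ->
        derivable (f : R[i]^o -> R[i]^o) (z : R[i]^o) 1) &
     exists B : R, forall z : R[i], `|z| < 1 -> `|f z| <= B%:C]].

(* Boundedness and analyticity of a matrix-valued function are those of its
   entries, the spaces being finite-dimensional. *)
Definition Hinf_mx (R : realType) (k q : nat) : set (R[i] -> 'M[R[i]]_(k, q)) :=
  [set Psi | forall i j, Hinf (fun z => Psi z i j)].

Definition boundary_mx (R : realType) (k q : nat)
    (Psi : R[i] -> 'M[R[i]]_(k, q)) (t : R) : 'M[R[i]]_(k, q) :=
  \matrix_(i, j) boundary (fun z => Psi z i j) t.

Definition inner_mx (R : realType) (k q : nat) (Psi : R[i] -> 'M[R[i]]_(k, q))
    : Prop :=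
  Hinf_mx Psi /\
  {ae lebesgue_measure, forall t : R, angles t ->
     (map_mx Num.conj (boundary_mx Psi t))^T *m boundary_mx Psi t = 1%:M}.

Definition H2vec (R : realType) (q : nat) : set (R[i] -> 'cV[R[i]]_q) :=
  [set F | forall i, H2 (fun z => F z i 0)].

Definition mulH2vec (R : realType) (k q : nat) (Psi : R[i] -> 'M[R[i]]_(k, q))
    : set (R[i] -> 'cV[R[i]]_k) :=
  [set F | exists2 G, H2vec G & F = fun z => Psi z *m G z].

(* Main.v *)
Require Import Defs.
From HB Require Import structures.
From mathcomp Require Import all_boot all_order all_algebra.
From mathcomp Require Import complex.
From mathcomp Require Import all_classical all_reals all_analysis.
From mathcomp Require Import measurable_realfun ring lra zify.

Set Implicit Arguments.
Unset Strict Implicit.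
Unset Printing Implicit Defensive.

Import Order.TTheory GRing.Theory Num.Theory.
Import numFieldNormedType.Exports.

Local Open Scope classical_set_scope.
Local Open Scope ring_scope.
Local Open Scope complex_scope.

(** Let S be multiplication by z. Invariance of M under the perturbed shift says
that S g + sum_i c_i v_i lies in M for suitable scalars c_i whenever g does.
Replacing each v_i by its component orthogonal to M changes nothing modulo M,
and the correction is then forced to be the projection onto the span L: for g
in M,
  D g = S g - sum_j <S g, phi_j> phi_j   lies in M     [nearly_invariant].

Put W g = (T_1 g, ..., T_p g, g), where T_j is the Toeplitz operator with
symbol the conjugate of phi_j; its n-th Taylor coefficient is <g, S^n phi_j>
[toeplitz_taylor]. Let N be the closed span of the S^k W g for g in M and
k >= 0. It is invariant under S by construction, so by the Beurling-Lax theorem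
[beurling_lax] it is Psi H^2 for an inner Psi, and the theorem amounts to:
W g lies in N if and only if g lies in M [model_mem]. Only the forward
implication has content. It rests on the operator
  U (Y, G) = ((S Y_j + <S G, phi_j>)_j, S G - sum_j <S G, phi_j> phi_j),
which is an isometry because the phi_j are orthonormal [U_isometry], and on
the fact that the families S^k W g and U^k W g (k >= 0, g in H^2) have the same
Gram matrix [gram]: S^n W g and U^n W g differ by a vector orthogonal to the
range of W, and for two positive exponents one cancels the smaller by isometry.
Hence a finite sum of S^k W g_k close to W g yields a sum of U^k W g_k equally
close to W g. Comparing last entries, g is close to the sum of the D^k g_k,
an element of M; and M is closed.

For Beurling-Lax, an orthonormal family Psi_1, ..., Psi_r in N orthogonal to
S N has all its shifts orthonormal. This determines every Fourier coefficient
of the Gram matrix of the boundary values of Psi, which is therefore the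
identity almost everywhere by uniqueness of Fourier coefficients
[fourier_uniqueness, symbol_isometric]. In particular r <= p + 1
[isometric_few]; a maximal such family exists, and its shifts span N because
the intersection of the S^n N is zero. The entries of Psi are bounded by 1
because multiplication by them contracts polynomials [entry_bound].

All of this takes place on square-summable sequences of Taylor coefficients.
The dictionary with functions on the disc and on the circle consists of the
completeness of L^2 [L2_complete], the identification of the limit of the
dilations with the sum of the Fourier series [boundary_trace], and the
analyticity of the sum of a power series [taylor_derivable]. *)

(** * Real and imaginary parts, squared modulus *)
Section ComplexNumbers.
Variable R : realType.
Implicit Types (x y z w : R[i]) (r s : R).

Lemma conjE z : Num.conj z = (z^*)%C. Proof. by []. Qed.

Lemma cReD z w : complex.Re (z + w) = complex.Re z + complex.Re w.
Proof. by case: z; case: w. Qed.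
Lemma cImD z w : complex.Im (z + w) = complex.Im z + complex.Im w.
Proof. by case: z; case: w. Qed.
Lemma cReN z : complex.Re (- z) = - complex.Re z. Proof. by case: z. Qed.
Lemma cImN z : complex.Im (- z) = - complex.Im z. Proof. by case: z. Qed.
Lemma cReM z w : complex.Re (z * w) =
  complex.Re z * complex.Re w - complex.Im z * complex.Im w.
Proof. by case: z; case: w. Qed.
Lemma cImM z w : complex.Im (z * w) =
  complex.Re z * complex.Im w + complex.Im z * complex.Re w.
Proof. by case: z; case: w. Qed.
Lemma cReJ z : complex.Re (Num.conj z) = complex.Re z. Proof. by case: z. Qed.
Lemma cImJ z : complex.Im (Num.conj z) = - complex.Im z. Proof. by case: z. Qed.

Lemma complex_ext z w :
  complex.Re z = complex.Re w -> complex.Im z = complex.Im w -> z = w.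
Proof. by case: z; case: w => a b c d /= -> ->. Qed.

Lemma cRe_sum I (r : seq I) (P : pred I) (F : I -> R[i]) :
  complex.Re (\sum_(i <- r | P i) F i) = \sum_(i <- r | P i) complex.Re (F i).
Proof. by elim/big_rec2: _ => // i u v _ <-; rewrite cReD. Qed.
Lemma cIm_sum I (r : seq I) (P : pred I) (F : I -> R[i]) :
  complex.Im (\sum_(i <- r | P i) F i) = \sum_(i <- r | P i) complex.Im (F i).
Proof. by elim/big_rec2: _ => // i u v _ <-; rewrite cImD. Qed.

Lemma sqmod_ge0 z : 0 <= sqmod z.
Proof. by rewrite addr_ge0 // sqr_ge0. Qed.

Lemma sqmod0 : sqmod (0 : R[i]) = 0.
Proof. by rewrite /sqmod /= expr0n /= addr0. Qed.

Lemma sqmodN z : sqmod (- z) = sqmod z.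
Proof. by rewrite /sqmod cReN cImN !sqrrN. Qed.

Lemma sqmod_eq0 z : sqmod z = 0 -> z = 0.
Proof.
move/eqP; rewrite /sqmod paddr_eq0 ?sqr_ge0 // !sqrf_eq0 => /andP[/eqP a /eqP b].
exact: complex_ext.
Qed.

Lemma sqmodM z w : sqmod (z * w) = sqmod z * sqmod w.
Proof. by rewrite /sqmod cReM cImM; ring. Qed.

Lemma sqmodJ z : sqmod (Num.conj z) = sqmod z.
Proof. by rewrite /sqmod cReJ cImJ sqrrN. Qed.

Lemma sqmodX z n : sqmod (z ^+ n) = sqmod z ^+ n.
Proof.
elim: n => [|n IH]; last by rewrite !exprS sqmodM IH.
by rewrite !expr0 /sqmod /= expr0n expr1n addr0.
Qed.

Lemma sqmod_real r : sqmod (r%:C) = r ^+ 2.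
Proof. by rewrite /sqmod /= expr0n addr0. Qed.

Lemma mulCJ z : z * Num.conj z = (sqmod z)%:C.
Proof. by apply: complex_ext; rewrite ?cReM ?cImM cReJ cImJ /sqmod /=; ring. Qed.

Lemma normCE z : `|z| = (Num.sqrt (sqmod z))%:C.
Proof. by rewrite normc_def. Qed.

Lemma normC_lt1 z : (`|z| < 1) = (sqmod z < 1).
Proof.
rewrite normCE -[1]/((1 : R)%:C) ltcR -{1}(sqrtr1 R) ltr_sqrt //.
Qed.

Lemma Re_le_mod z : `|complex.Re z| <= Num.sqrt (sqmod z).
Proof. by rewrite -sqrtr_sqr ler_sqrt ?sqmod_ge0 // lerDl sqr_ge0. Qed.

Lemma Im_le_mod z : `|complex.Im z| <= Num.sqrt (sqmod z).
Proof. by rewrite -sqrtr_sqr ler_sqrt ?sqmod_ge0 // lerDr sqr_ge0. Qed.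

Lemma mod_le_ReIm z :
  Num.sqrt (sqmod z) <= `|complex.Re z| + `|complex.Im z|.
Proof.
rewrite -[leRHS]ger0_norm ?addr_ge0 // -sqrtr_sqr ler_sqrt ?sqr_ge0 //.
by rewrite sqrrD /sqmod !real_normK ?num_real // addrAC lerDl mulrn_wge0 ?mulr_ge0.
Qed.

Lemma sqmodD_le z w : sqmod (z + w) <= 2 * (sqmod z + sqmod w).
Proof.
rewrite /sqmod cReD cImD -subr_ge0.
suff -> : 2 * (complex.Re z ^+ 2 + complex.Im z ^+ 2
    + (complex.Re w ^+ 2 + complex.Im w ^+ 2)) -
  ((complex.Re z + complex.Re w) ^+ 2 + (complex.Im z + complex.Im w) ^+ 2)
  = (complex.Re z - complex.Re w) ^+ 2 + (complex.Im z - complex.Im w) ^+ 2.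
  by rewrite addr_ge0 // sqr_ge0.
by ring.
Qed.

Lemma sqrt_mul_le (a b : R) : 0 <= a -> 0 <= b -> Num.sqrt (a * b) <= a + b.
Proof.
move=> a0 b0; rewrite -(ger0_norm (addr_ge0 a0 b0)) -sqrtr_sqr ler_sqrt ?sqr_ge0 //.
by rewrite sqrrD; have := mulr_ge0 a0 b0; have := sqr_ge0 a; have := sqr_ge0 b; lra.
Qed.

Lemma complex_ge0 z : (0 <= z) = (complex.Im z == 0) && (0 <= complex.Re z).
Proof. by case: z => a b; rewrite lecE. Qed.

End ComplexNumbers.

(** * Semi-inner product spaces *)
Section SemiInnerProduct.
Variable R : realType.

(** Definiteness is not required: functions on the circle that agree almost
    everywhere are not identified. *)
Record semi_ip (V : lmodType R[i]) := SemiIp {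
  ipf :> V -> V -> R[i];
  ip_linl : forall c x y z, ipf (c *: x + y) z = c * ipf x z + ipf y z;
  ip_conj : forall x y, ipf y x = Num.conj (ipf x y);
  ip_pos : forall x, 0 <= ipf x x }.

Variables (V : lmodType R[i]) (ip : semi_ip V).
Implicit Types (x y z : V) (c : R[i]).

Lemma ip0l z : ip 0 z = 0.
Proof.
have := ip_linl ip 1 0 0 z; rewrite scaler0 addr0 mul1r => /eqP.
by rewrite -subr_eq0 opprD addNKr oppr_eq0 => /eqP.
Qed.
Lemma ipDl x y z : ip (x + y) z = ip x z + ip y z.
Proof. by have := ip_linl ip 1 x y z; rewrite scale1r mul1r. Qed.
Lemma ipZl c x z : ip (c *: x) z = c * ip x z.
Proof. by have := ip_linl ip c x 0 z; rewrite addr0 ip0l addr0. Qed.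
Lemma ipNl x z : ip (- x) z = - ip x z.
Proof. by rewrite -scaleN1r ipZl mulN1r. Qed.
Lemma ipBl x y z : ip (x - y) z = ip x z - ip y z.
Proof. by rewrite ipDl ipNl. Qed.
Lemma ip_suml I (r : seq I) (P : pred I) (F : I -> V) z :
  ip (\sum_(i <- r | P i) F i) z = \sum_(i <- r | P i) ip (F i) z.
Proof. by elim/big_rec2: _ => [|i u v _ <-]; rewrite ?ip0l ?ipDl. Qed.
Lemma ip0r z : ip z 0 = 0. Proof. by rewrite ip_conj ip0l conjE conjc0. Qed.
Lemma ipDr x y z : ip z (x + y) = ip z x + ip z y.
Proof. by rewrite ip_conj ipDl rmorphD /= -!ip_conj. Qed.
Lemma ipZr c x z : ip z (c *: x) = Num.conj c * ip z x.
Proof. by rewrite ip_conj ipZl rmorphM /= -!ip_conj. Qed.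
Lemma ipNr x z : ip z (- x) = - ip z x.
Proof. by rewrite ip_conj ipNl rmorphN /= -!ip_conj. Qed.
Lemma ipBr x y z : ip z (x - y) = ip z x - ip z y.
Proof. by rewrite ipDr ipNr. Qed.
Lemma ip_sumr I (r : seq I) (P : pred I) (F : I -> V) z :
  ip z (\sum_(i <- r | P i) F i) = \sum_(i <- r | P i) ip z (F i).
Proof. by elim/big_rec2: _ => [|i u v _ <-]; rewrite ?ip0r ?ipDr. Qed.

Definition nsq x : R := complex.Re (ip x x).
Definition nrm x : R := Num.sqrt (nsq x).

Lemma ip_nsq x : ip x x = (nsq x)%:C.
Proof.
have := ip_pos ip x; rewrite complex_ge0 => /andP[/eqP h _].
by apply: complex_ext.
Qed.
Lemma nsq_ge0 x : 0 <= nsq x.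
Proof. by have := ip_pos ip x; rewrite complex_ge0 => /andP[]. Qed.
Lemma nrm_ge0 x : 0 <= nrm x. Proof. exact: sqrtr_ge0. Qed.
Lemma sqr_nrm x : nrm x ^+ 2 = nsq x.
Proof. by rewrite sqr_sqrtr // nsq_ge0. Qed.
Lemma nsq0 : nsq 0 = 0. Proof. by rewrite /nsq ip0l. Qed.
Lemma nrm0 : nrm 0 = 0. Proof. by rewrite /nrm nsq0 sqrtr0. Qed.
Lemma nsqN x : nsq (- x) = nsq x.
Proof. by rewrite /nsq ipNl ipNr opprK. Qed.
Lemma nrmN x : nrm (- x) = nrm x. Proof. by rewrite /nrm nsqN. Qed.
Lemma nrmC x y : nrm (x - y) = nrm (y - x).
Proof. by rewrite -nrmN opprB. Qed.
Lemma nsqD x y : nsq (x + y) = nsq x + nsq y + 2 * complex.Re (ip x y).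
Proof.
rewrite /nsq ipDl !ipDr !cReD (ip_conj _ x y) cReJ; ring.
Qed.
Lemma nsqZ c x : nsq (c *: x) = sqmod c * nsq x.
Proof.
by rewrite /nsq ipZl ipZr mulrA mulCJ cReM /= mul0r subr0.
Qed.
Lemma nsqB x y : nsq (x - y) = nsq x + nsq y - 2 * complex.Re (ip x y).
Proof. by rewrite nsqD nsqN ipNr cReN mulrN. Qed.

Lemma parallelogram x y : nsq (x + y) + nsq (x - y) = 2 * (nsq x + nsq y).
Proof. by rewrite nsqD nsqB; ring. Qed.

(** The vector [x - (t * <x, y>) y], for real [t], has a nonnegative squared
    norm, which is a quadratic polynomial in [t]. *)
Lemma cauchy_schwarz x y : sqmod (ip x y) <= nsq x * nsq y.
Proof.
set s := sqmod (ip x y).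
have s0 : 0 <= s by exact: sqmod_ge0.
have key (t : R) : 0 <= nsq x - 2 * t * s + t ^+ 2 * s * nsq y.
  have := nsq_ge0 (x - (t%:C * ip x y) *: y).
  rewrite nsqB nsqZ sqmodM sqmod_real ipZr rmorphM /=.
  rewrite -/s !cReM !cImM !conjE /= => h; apply: le_trans h _.
  rewrite le_eqVlt; apply/orP; left; apply/eqP.
  by rewrite /s /sqmod; case: (ip x y) => a b /=; ring.
have [y0|y0] := ltrP 0 (nsq y).
  (* The minimizer of the polynomial. *)
  have := key (nsq y)^-1.
  rewrite -(pmulr_rge0 _ y0) => h; rewrite -subr_ge0; apply: le_trans h _.
  rewrite le_eqVlt; apply/orP; left; apply/eqP.
  by field; rewrite gt_eqF.
have yz : nsq y = 0 by apply/eqP; rewrite eq_le y0 nsq_ge0.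
have [sp|] := ltrP 0 s; last by rewrite yz mulr0.
(* If [y] is null the polynomial is affine in [t]; this [t] makes it equal to -1. *)
have := key ((nsq x + 1) / (2 * s)); rewrite yz mulr0 addr0.
have -> : 2 * ((nsq x + 1) / (2 * s)) * s = nsq x + 1.
  by field; rewrite gt_eqF.
by lra.
Qed.

Lemma Re_ip_le x y : complex.Re (ip x y) <= nrm x * nrm y.
Proof.
rewrite /nrm -sqrtrM ?nsq_ge0 //; apply: le_trans (ler_norm _) _.
rewrite -sqrtr_sqr ler_sqrt; last by rewrite mulr_ge0 // nsq_ge0.
by apply: le_trans (cauchy_schwarz x y); rewrite lerDl sqr_ge0.
Qed.

Lemma nrmD x y : nrm (x + y) <= nrm x + nrm y.
Proof.
rewrite -(@ler_pXn2r _ 2) ?nnegrE ?addr_ge0 ?nrm_ge0 //.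
rewrite sqr_nrm nsqD sqrrD !sqr_nrm.
have := Re_ip_le x y; by lra.
Qed.

Lemma nrmB x y z : nrm (x - z) <= nrm (x - y) + nrm (y - z).
Proof. by apply: le_trans (nrmD _ _); rewrite addrA subrK. Qed.

Lemma nrmZ c x : nrm (c *: x) = Num.sqrt (sqmod c) * nrm x.
Proof. by rewrite /nrm nsqZ sqrtrM // sqmod_ge0. Qed.

Lemma nrm_lt x (e : R) : 0 < e -> (nrm x < e) = (nsq x < e ^+ 2).
Proof.
by move=> e0; rewrite -sqr_nrm ltr_pXn2r // ?nnegrE ?nrm_ge0 // ltW.
Qed.
Lemma nrm_le x (e : R) : 0 <= e -> (nrm x <= e) = (nsq x <= e ^+ 2).
Proof.
by move=> e0; rewrite -sqr_nrm ler_pXn2r // ?nnegrE ?nrm_ge0.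
Qed.

Definition tends (u : nat -> V) (l : V) :=
  forall e : R, 0 < e -> exists N, forall n, (N <= n)%N -> nrm (u n - l) < e.

Definition ip_complete := forall u : nat -> V,
  (forall e : R, 0 < e -> exists N, forall m n, (N <= m)%N -> (N <= n)%N ->
     nrm (u m - u n) < e) -> exists l, tends u l.

Definition linsub (K : set V) :=
  K 0 /\ forall c x y, K x -> K y -> K (c *: x + y).

Definition adherent (K : set V) x :=
  forall e : R, 0 < e -> exists2 y, K y & nrm (x - y) < e.

Definition closed_in (K : set V) := forall x, adherent K x -> K x.

Section Subspace.
Variable K : set V.
Hypothesis subK : linsub K.

Lemma linsubD x y : K x -> K y -> K (x + y).
Proof. by move=> kx ky; rewrite -[x]scale1r; apply: subK.2. Qed.
Lemma linsubZ c x : K x -> K (c *: x).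
Proof. by move=> kx; rewrite -[_ *: _]addr0; apply: subK.2 => //; exact: subK.1. Qed.
Lemma linsubN x : K x -> K (- x).
Proof. by move=> kx; rewrite -scaleN1r; exact: linsubZ. Qed.
Lemma linsubB x y : K x -> K y -> K (x - y).
Proof. by move=> kx ky; apply: linsubD => //; exact: linsubN. Qed.
Lemma linsub_sum I (r : seq I) (P : pred I) (F : I -> V) :
  (forall i, P i -> K (F i)) -> K (\sum_(i <- r | P i) F i).
Proof.
move=> h; elim/big_ind: _ => //; first exact: subK.1.
exact: linsubD.
Qed.
End Subspace.

Lemma tends_closed K u l : closed_in K -> (forall n, K (u n)) -> tends u l -> K l.
Proof.
move=> cK Ku ul; apply: cK => e /ul[N h]; exists (u N) => //.
by rewrite nrmC; exact: h.
Qed.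

Lemma tends_cauchy u l : tends u l -> forall e : R, 0 < e ->
  exists N, forall m n, (N <= m)%N -> (N <= n)%N -> nrm (u m - u n) < e.
Proof.
move=> ul e e0; have [N hN] := ul (e / 2) ltac:(by rewrite divr_gt0).
exists N => m n Nm Nn; apply: le_lt_trans (nrmB _ l _) _.
rewrite [ltRHS](splitr e) [nrm (l - _)]nrmC.
by apply: ltrD; exact: hN.
Qed.

Lemma nrm_eq0_ip x y : nrm x = 0 -> ip x y = 0.
Proof.
move=> x0; apply: sqmod_eq0; apply/eqP; rewrite eq_le sqmod_ge0 andbT.
by apply: le_trans (cauchy_schwarz _ _) _; rewrite -sqr_nrm x0 expr0n mul0r.
Qed.

(** The form in which orthogonality relations are passed to limits. *)
Lemma small_nrm_ip x y :
  (forall e : R, 0 < e -> exists2 x', ip x y = ip x' y & nrm x' < e) ->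
  ip x y = 0.
Proof.
move=> h; apply: sqmod_eq0; apply/eqP; rewrite eq_le sqmod_ge0 andbT.
apply/ler_addgt0Pr => e e0; rewrite add0r.
have d0 : 0 < e / (nsq y + 1) by rewrite divr_gt0 // ltr_wpDl // nsq_ge0.
have [x' -> xe] := h (Num.sqrt (e / (nsq y + 1))) ltac:(by rewrite sqrtr_gt0).
apply: le_trans (cauchy_schwarz _ _) _.
move: xe; rewrite nrm_lt ?sqrtr_gt0 // sqr_sqrtr ?(ltW d0) // => xe.
have y0 := nsq_ge0 y.
apply: le_trans (ler_wpM2r y0 (ltW xe)) _.
rewrite mulrAC ler_pdivrMr ?ltr_wpDl // ler_pM2l //; lra.
Qed.

(** A minimizing sequence for the distance from [x] to [K] is Cauchy by the
    parallelogram law. At its limit [y], moving by a small multiple of [k] in the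
    direction of [<x - y, k>] would decrease the distance unless that number is 0. *)
Theorem projection K x : ip_complete -> linsub K -> closed_in K ->
  exists2 y, K y & forall k, K k -> ip (x - y) k = 0.
Proof.
move=> cV sK cK.
pose A := [set nsq (x - k) | k in K].
have infA : has_inf A.
  split; first by exists (nsq (x - 0)), 0 => //; exact: sK.1.
  by exists 0 => _ [k _ <-]; exact: nsq_ge0.
pose d := inf A.
have dle k : K k -> d <= nsq (x - k).
  by move=> Kk; apply: ge_inf; [exact: infA.2|exists k].
have ex n : exists k, K k /\ nsq (x - k) < d + n.+1%:R^-1.
  have [_ [k Kk <-] h] := @inf_adherent _ A n.+1%:R^-1 ltac:(by rewrite invr_gt0) infA.
  by exists k.
have [u hu] := choice ex.
(* The midpoint of [u m] and [u n] is in [K], hence at distance at least [d]. *)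
have mid m n : nsq (u m - u n) <= 2 * (m.+1%:R^-1 + n.+1%:R^-1).
  have := parallelogram (x - u m) (x - u n).
  have -> : x - u m + (x - u n) = 2 *: (x - 2^-1 *: (u m + u n)).
    rewrite scalerBr scalerA divff ?pnatr_eq0 // scale1r.
    by rewrite [2 *: x]scaler_nat mulr2n opprD addrACA.
  have -> : x - u m - (x - u n) = - (u m - u n).
    by rewrite !opprB addrC addrA subrK.
  have := dle (2^-1 *: (u m + u n))
    (linsubZ sK _ (linsubD sK (hu m).1 (hu n).1)).
  rewrite nsqN nsqZ.
  have -> : sqmod (2 : R[i]) = 4 by rewrite /sqmod /=; ring.
  move: (hu m).2 (hu n).2; move: m.+1%:R^-1 n.+1%:R^-1 => a b; lra.
have [|y uy] := cV u.
  move=> e e0; have e20 : 0 < e ^+ 2 / 4 by rewrite divr_gt0 ?exprn_gt0.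
  have [N hN] := ltr_add_invr (e20 : 0 < e ^+ 2 / 4).
  exists N => m n Nm Nn; rewrite nrm_lt //; apply: le_lt_trans (mid m n) _.
  have inv k : (N <= k)%N -> k.+1%:R^-1 <= N.+1%:R^-1 :> R.
    by move=> Nk; rewrite lef_pV2 ?posrE // ler_nat.
  move: (inv m Nm) (inv n Nn) hN; rewrite add0r.
  by move: m.+1%:R^-1 n.+1%:R^-1 N.+1%:R^-1 => a b c; lra.
have Ky : K y := tends_closed cK (fun n => (hu n).1) uy.
exists y => // k Kk.
have yd : nsq (x - y) <= d.
  have d0 : 0 <= d by apply: lb_le_inf; [exact: infA.1|move=> _ [z _ <-]; exact: nsq_ge0].
  rewrite -(sqr_sqrtr d0) -nrm_le ?sqrtr_ge0 //.
  apply/ler_addgt0Pr => e e0.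
  have e20 : 0 < e / 2 by rewrite divr_gt0.
  have [N1 h1] := uy _ e20.
  have e40 : 0 < (e / 2) ^+ 2 by rewrite exprn_gt0.
  have [N2 h2] := ltr_add_invr e40.
  pose n := maxn N1 N2.
  have a1 : nrm (x - u n) < Num.sqrt d + e / 2.
    rewrite nrm_lt; last by rewrite ltr_wpDl // sqrtr_ge0.
    apply: lt_le_trans (hu n).2 _; rewrite sqrrD sqr_sqrtr // -addrA lerD2l.
    apply: (@le_trans _ _ ((e / 2) ^+ 2)).
      apply: le_trans (ltW h2); rewrite add0r lef_pV2 ?posrE // ler_nat ltnS.
      exact: leq_maxr.
    by rewrite lerDr mulrn_wge0 // mulr_ge0 ?sqrtr_ge0 // ltW.
  have a2 := h1 n (leq_maxl _ _).
  have := nrmB x (u n) y; lra.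
have kz (c : R[i]) :
    0 <= sqmod c * nsq k - 2 * complex.Re (Num.conj c * ip (x - y) k).
  have := dle (y + c *: k) (linsubD sK Ky (linsubZ sK c Kk)).
  rewrite opprD addrA nsqB nsqZ ipZr; lra.
set a := ip (x - y) k in kz *.
apply: sqmod_eq0; apply/eqP; rewrite eq_le sqmod_ge0 andbT leNgt.
apply/negP => a0.
have b0 := nsq_ge0 k.
(* Dividing by [nsq k + 1] rather than [nsq k] covers null vectors [k]. *)
have := kz ((nsq k + 1)^-1%:C * a).
rewrite sqmodM sqmod_real.
have -> : complex.Re (Num.conj ((nsq k + 1)^-1%:C * a) * a)
    = (nsq k + 1)^-1 * sqmod a.
  by rewrite conjE /sqmod; case: a {kz a0} => r s /=; ring.
apply/negP; rewrite -ltNge.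
have -> : (nsq k + 1)^-1 ^+ 2 * sqmod a * nsq k
   - 2 * ((nsq k + 1)^-1 * sqmod a)
   = - ((nsq k + 1)^-1 ^+ 2 * sqmod a * (nsq k + 2)).
  by field; rewrite gt_eqF // ltr_wpDl.
rewrite oppr_lt0; apply: mulr_gt0; last by rewrite ltr_wpDl.
by apply: mulr_gt0 => //; rewrite exprn_gt0 // invr_gt0 ltr_wpDl.
Qed.

Definition definite := forall x, nsq x = 0 -> x = 0.

Lemma nsq_orthonormal (I : finType) (e : I -> V) (c : I -> R[i]) :
  (forall i j, ip (e i) (e j) = (i == j)%:R) ->
  nsq (\sum_i c i *: e i) = \sum_i sqmod (c i).
Proof.
move=> oe; rewrite /nsq ip_suml cRe_sum; apply: eq_bigr => i _.
rewrite ipZl ip_sumr (bigD1 i) //= big1 ?addr0; last first.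
  by move=> j ji; rewrite ipZr oe eq_sym (negPf ji) mulr0.
by rewrite ipZr oe eqxx mulr1 mulCJ.
Qed.

Lemma bessel (I : finType) (e : I -> V) x :
  (forall i j, ip (e i) (e j) = (i == j)%:R) ->
  \sum_i sqmod (ip x (e i)) <= nsq x.
Proof.
move=> oe; have := nsq_ge0 (x - \sum_i ip x (e i) *: e i).
rewrite nsqB (nsq_orthonormal _ oe) ip_sumr cRe_sum.
have -> : \sum_i complex.Re (ip x (ip x (e i) *: e i))
    = \sum_i sqmod (ip x (e i)).
  by apply: eq_bigr => i _; rewrite ipZr mulrC mulCJ.
lra.
Qed.
End SemiInnerProduct.

(** * Finite powers of a semi-inner product space *)
Section VectorInnerProduct.
Variables (R : realType) (V : lmodType R[i]) (ip : semi_ip V) (q : nat).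
Local Notation W := {ffun 'I_q -> V}.

Definition vec_ip_fun (x y : W) : R[i] := \sum_i ip (x i) (y i).

Lemma vec_ip_linl c x y z :
  vec_ip_fun (c *: x + y) z = c * vec_ip_fun x z + vec_ip_fun y z.
Proof.
rewrite /vec_ip_fun mulr_sumr -big_split; apply: eq_bigr => i _ /=.
by rewrite !ffunE ip_linl.
Qed.

Lemma vec_ip_conj x y : vec_ip_fun y x = Num.conj (vec_ip_fun x y).
Proof. by rewrite /vec_ip_fun rmorph_sum; apply: eq_bigr => i _; exact: ip_conj. Qed.

Lemma vec_ip_pos x : 0 <= vec_ip_fun x x.
Proof. by apply: sumr_ge0 => i _; exact: ip_pos. Qed.

Definition vec_ip := SemiIp vec_ip_linl vec_ip_conj vec_ip_pos.

Lemma vec_nsq (x : W) : nsq vec_ip x = \sum_i nsq ip (x i).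
Proof. by rewrite /nsq cRe_sum. Qed.

Lemma vec_nsq_ge (x : W) i : nsq ip (x i) <= nsq vec_ip x.
Proof. by rewrite vec_nsq (bigD1 i) //= lerDl sumr_ge0 // => j _; exact: nsq_ge0. Qed.

Lemma vec_nrm_ge (x : W) i : nrm ip (x i) <= nrm vec_ip x.
Proof. by rewrite /nrm ler_sqrt ?nsq_ge0 // vec_nsq_ge. Qed.

Lemma vec_definite : definite ip -> definite vec_ip.
Proof.
move=> d x x0; apply/ffunP => i; rewrite ffunE; apply: d.
by apply/eqP; rewrite eq_le nsq_ge0 -x0 vec_nsq_ge.
Qed.

Lemma vec_tends (u : nat -> W) (l : W) :
  (forall i, tends ip (fun n => u n i) (l i)) -> tends vec_ip u l.
Proof.
move=> hl e e0.
have q0 : 0 < e ^+ 2 / q.+1%:R by rewrite divr_gt0 ?exprn_gt0.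
have d0 : 0 < Num.sqrt (e ^+ 2 / q.+1%:R) by rewrite sqrtr_gt0.
have [N hN] := choice (fun i => hl i _ d0).
exists (\max_i N i)%N => n nN.
rewrite nrm_lt // vec_nsq.
have b : \sum_(i < q) nsq ip ((u n - l) i) <= \sum_(i < q) e ^+ 2 / q.+1%:R.
  apply: ler_sum => i _; rewrite !ffunE.
  have := hN i n (leq_trans (leq_bigmax i) nN).
  by rewrite nrm_lt // sqr_sqrtr ?(ltW q0) // => /ltW.
apply: le_lt_trans b _; rewrite sumr_const card_ord -[X in X < _]mulr_natr -mulrA.
rewrite gtr_pMr ?exprn_gt0 // mulrC ltr_pdivrMr ?ltr0Sn // mul1r ltr_nat.
exact: ltnSn.
Qed.

Lemma vec_complete : ip_complete ip -> ip_complete vec_ip.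
Proof.
move=> cV u cu.
have ci i : exists l, tends ip (fun n => u n i) l.
  apply: cV => e e0; have [N hN] := cu e e0; exists N => m n Nm Nn.
  by apply: le_lt_trans (hN m n Nm Nn); have := vec_nrm_ge (u m - u n) i; rewrite !ffunE.
have [l hl] := choice ci.
exists [ffun i => l i]; apply: vec_tends => i.
by rewrite ffunE.
Qed.
End VectorInnerProduct.
Arguments vec_ip : simpl never.
Arguments ipf : simpl never.

(** * Limits of complex sequences *)
Section ComplexLimits.
Variable R : realType.

Lemma seq_lim_ge (u : nat -> R) (l b : R) N : u @ \oo --> l ->
  (forall n, (N <= n)%N -> b <= u n) -> b <= l.
Proof.
move=> ul h; apply: (@cvgr_to_ge _ _ _ _ u l b ul).
by exists N => // n /= Nn; exact: h.
Qed.

Lemma seq_lim_le (u : nat -> R) (l b : R) N : u @ \oo --> l ->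
  (forall n, (N <= n)%N -> u n <= b) -> l <= b.
Proof.
move=> ul h; apply: (@cvgr_to_le _ _ _ _ u l b ul).
by exists N => // n /= Nn; exact: h.
Qed.

Lemma seq_lim_unique (u : nat -> R) (l k : R) : u @ \oo --> l -> u @ \oo --> k -> l = k.
Proof. by move=> h1 h2; exact: cvg_unique h1 h2. Qed.

Implicit Types (u v : nat -> R[i]) (l k c : R[i]).

Lemma cvg_sum_ord (T : Type) (F : set_system T) {FF : Filter F} M
    (f : nat -> T -> R) (l : nat -> R) :
  (forall n, f n @ F --> l n) ->
  (fun j => \sum_(n < M) f n j) @ F --> \sum_(n < M) l n.
Proof.
move=> h; elim: M => [|M IH].
  by rewrite big_ord0; under eq_cvg do rewrite big_ord0; exact: cvg_cst.
rewrite big_ord_recr; under eq_cvg do rewrite big_ord_recr /=.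
by apply: cvgD.
Qed.

Definition ccvg u l :=
  ((fun n => complex.Re (u n)) @ \oo --> complex.Re l) /\
  ((fun n => complex.Im (u n)) @ \oo --> complex.Im l).

Lemma ccvg_cst c : ccvg (fun=> c) c.
Proof. by split; exact: cvg_cst. Qed.

Lemma ccvg_unique u l k : ccvg u l -> ccvg u k -> l = k.
Proof.
move=> [rl il] [rk ik]; apply: complex_ext.
  exact: cvg_unique rl rk.
exact: cvg_unique il ik.
Qed.

Lemma ccvgD u v l k : ccvg u l -> ccvg v k -> ccvg (fun n => u n + v n) (l + k).
Proof.
move=> [rl il] [rk ik]; split.
  rewrite cReD (_ : (fun n => _) =
    (fun n => complex.Re (u n)) \+ (fun n => complex.Re (v n))); first exact: cvgD.
  by apply/funext => n /=; rewrite cReD.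
rewrite cImD (_ : (fun n => _) =
  (fun n => complex.Im (u n)) \+ (fun n => complex.Im (v n))); first exact: cvgD.
by apply/funext => n /=; rewrite cImD.
Qed.

Lemma ccvgZ u l c : ccvg u l -> ccvg (fun n => c * u n) (c * l).
Proof.
move=> [rl il]; split.
  rewrite cReM; under eq_cvg do rewrite cReM.
  by apply: cvgB; exact: cvgMl_tmp.
rewrite cImM; under eq_cvg do rewrite cImM.
by apply: cvgD; exact: cvgMl_tmp.
Qed.

Lemma ccvgJ u l : ccvg u l -> ccvg (fun n => Num.conj (u n)) (Num.conj l).
Proof.
move=> [rl il]; split.
  by rewrite cReJ; under eq_cvg do rewrite cReJ.
by rewrite cImJ; under eq_cvg do rewrite cImJ; exact: cvgN.
Qed.

Lemma ccvgP u l :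
  (u : nat -> R[i]^o) @ \oo --> (l : R[i]^o) <-> ccvg u l.
Proof.
split.
  move=> /cvgrPdist_lt h; split; apply/cvgrPdist_lt => e e0.
    have := h e%:C; rewrite ltcR => /(_ e0); apply: filterS => n.
    rewrite normCE ltcR; apply: le_lt_trans.
    by rewrite -cReN -cReD; exact: Re_le_mod.
  have := h e%:C; rewrite ltcR => /(_ e0); apply: filterS => n.
  rewrite normCE ltcR; apply: le_lt_trans.
  by rewrite -cImN -cImD; exact: Im_le_mod.
move=> [/cvgrPdist_lt hr /cvgrPdist_lt hi]; apply/cvgrPdist_lt => -[e e'].
rewrite ltcE /= => /andP[/eqP -> e0] {e'}.
have e20 : 0 < e / 2 by rewrite divr_gt0.
near=> n; rewrite normCE -[X in _ < X]/(e%:C) ltcR.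
apply: le_lt_trans (mod_le_ReIm _) _; rewrite cReD cReN cImD cImN.
rewrite [X in _ < X](splitr e); apply: ltrD; near: n; [exact: hr|exact: hi].
Unshelve. all: by end_near.
Qed.

Lemma tends_ccvg (V : lmodType R[i]) (ip : semi_ip V) (w : nat -> V) x y :
  tends ip w x -> ccvg (fun n => ip (w n) y) (ip x y).
Proof.
move=> wx.
have key (F : R[i] -> R) : (forall z, `|F z| <= Num.sqrt (sqmod z)) ->
    (forall z z', F (z - z') = F z - F z') ->
    (fun n => F (ip (w n) y)) @ \oo --> F (ip x y).
  move=> hF FB; apply/cvgrPdist_lt => e e0.
  have y0 : 0 < nrm ip y + 1 by rewrite ltr_wpDl // nrm_ge0.
  have [N hN] := wx (e / (nrm ip y + 1)) ltac:(by rewrite divr_gt0).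
  exists N => // n /= Nn; rewrite -FB -ipBl; apply: le_lt_trans (hF _) _.
  apply: (@le_lt_trans _ _ (nrm ip (x - w n) * nrm ip y)).
    rewrite /nrm -sqrtrM ?nsq_ge0 // ler_sqrt ?mulr_ge0 ?nsq_ge0 //.
    exact: cauchy_schwarz.
  have := hN n Nn; rewrite nrmC ltr_pdivlMr //; apply: le_lt_trans.
  by rewrite ler_wpM2l ?nrm_ge0 // lerDl.
split.
  by apply: key (@Re_le_mod R) _ => z z'; rewrite cReD cReN.
by apply: key (@Im_le_mod R) _ => z z'; rewrite cImD cImN.
Qed.

Lemma ccvg_sum I (s : seq I) (f : I -> nat -> R[i]) (l : I -> R[i]) :
  (forall i, ccvg (f i) (l i)) ->
  ccvg (fun j => \sum_(i <- s) f i j) (\sum_(i <- s) l i).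
Proof.
move=> h; elim: s => [|i s IH].
  rewrite big_nil (_ : (fun j => _) = fun=> 0); first exact: ccvg_cst.
  by apply/funext => j; rewrite big_nil.
rewrite big_cons (_ : (fun j => _) = fun j => f i j + \sum_(i <- s) f i j).
  exact: ccvgD.
by apply/funext => j; rewrite big_cons.
Qed.
End ComplexLimits.

(** * Square-summable sequences and the shift *)
Section Ell2.
Variable R : realType.

Definition square_summable : {pred nat -> R[i]^o} :=
  fun a => `[< exists B, forall N, \sum_(n < N) sqmod (a n : R[i]) <= B >].

Lemma square_summable_submod : submod_closed square_summable.
Proof.
split; first by apply/asboolP; exists 0 => N; rewrite big1 // => i _; exact: sqmod0.
move=> c a b /asboolP[A hA] /asboolP[B hB]; apply/asboolP.
exists (2 * (sqmod c * A + B)) => N.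
apply: (@le_trans _ _ (\sum_(n < N) 2 * (sqmod c * sqmod (a n : R[i]) + sqmod (b n : R[i])))).
  by apply: ler_sum => i _; rewrite -sqmodM; exact: sqmodD_le.
rewrite -mulr_sumr big_split /= -mulr_sumr ler_pM2l //.
apply: lerD; last exact: hB.
by apply: ler_wpM2l; [exact: sqmod_ge0|exact: hA].
Qed.

HB.instance Definition _ := GRing.isSubmodClosed.Build _ _ square_summable
  square_summable_submod.

(** Sequences of Taylor coefficients of the functions of the Hardy space. *)
Record ell2 := Ell2 { coef :> nat -> R[i]^o; ell2P : coef \in square_summable }.
Arguments coef : simpl never.
HB.instance Definition _ := [isSub for coef].
HB.instance Definition _ := [Choice of ell2 by <:].
HB.instance Definition _ := [SubChoice_isSubLmodule of ell2 by <:].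

Implicit Types (a b c : ell2).

Lemma ell2D a b n : (a + b) n = (a n : R[i]) + (b n : R[i]) :> R[i]. Proof. by []. Qed.
Lemma ell2Z k a n : (k *: a) n = k * (a n : R[i]) :> R[i]. Proof. by []. Qed.
Lemma ell2N a n : (- a) n = - (a n : R[i]) :> R[i]. Proof. by []. Qed.
Lemma ell2B a b n : (a - b) n = (a n : R[i]) - (b n : R[i]) :> R[i]. Proof. by []. Qed.
Lemma ell2_sum I (r : seq I) (P : pred I) (F : I -> ell2) n :
  (\sum_(i <- r | P i) F i) n = \sum_(i <- r | P i) (F i n : R[i]) :> R[i].
Proof. by elim/big_rec2: _ => // i u v _ <-. Qed.

Lemma ell2_ext a b : (forall n, a n = b n) -> a = b.
Proof. by move=> h; apply: val_inj; apply/funext. Qed.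

Lemma ell2_bounded a : exists B, forall N, \sum_(n < N) sqmod (a n : R[i]) <= B.
Proof. exact/asboolP/ell2P. Qed.

Lemma ell2_summable a : cvgn (series (fun n => sqmod (a n : R[i]))).
Proof.
apply: nondecreasing_is_cvgn.
  by apply: nondecreasing_series => n _ _; exact: sqmod_ge0.
have [B hB] := ell2_bounded a; exists B => _ [N _ <-].
by rewrite /series /= big_mkord.
Qed.

Lemma ell2_prod_summable a b (F : R[i] -> R) :
  (forall z, `|F z| <= Num.sqrt (sqmod z)) ->
  cvgn (series (fun n => F ((a n : R[i]) * Num.conj (b n : R[i])))).
Proof.
move=> hF; apply: normed_cvg.
apply: (@series_le_cvg _ _ (fun n => sqmod (a n : R[i]) + sqmod (b n : R[i]))).
- by move=> n; exact: normr_ge0.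
- by move=> n; rewrite addr_ge0 // sqmod_ge0.
- move=> n; apply: le_trans (hF _) _; rewrite sqmodM sqmodJ.
  by apply: sqrt_mul_le; exact: sqmod_ge0.
- rewrite [X in cvgn X](_ : _ =
      series (fun n => sqmod (a n : R[i])) \+ series (fun n => sqmod (b n : R[i]))); last first.
    by apply/funext => n; rewrite /series /= big_split.
  by apply: is_cvgD; exact: ell2_summable.
Qed.

Definition ell2_ip_fun a b : R[i] :=
  limn (series (fun n => complex.Re ((a n : R[i]) * Num.conj (b n : R[i])))) +i*
  limn (series (fun n => complex.Im ((a n : R[i]) * Num.conj (b n : R[i])))).

Lemma ell2_ip_cvg a b :
  ccvg (fun N => \sum_(n < N) (a n : R[i]) * Num.conj (b n : R[i]))
    (ell2_ip_fun a b).
Proof.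
split => /=.
  have := @ell2_prod_summable a b _ (@Re_le_mod R).
  apply: cvg_trans; apply: near_eq_cvg.
  by apply: nearW => n; rewrite /series /= big_mkord cRe_sum.
have := @ell2_prod_summable a b _ (@Im_le_mod R).
apply: cvg_trans; apply: near_eq_cvg.
by apply: nearW => n; rewrite /series /= big_mkord cIm_sum.
Qed.

Lemma ell2_ip_linl k a b c :
  ell2_ip_fun (k *: a + b) c = k * ell2_ip_fun a c + ell2_ip_fun b c.
Proof.
apply: ccvg_unique (ell2_ip_cvg _ _) _.
have := ccvgD (ccvgZ k (ell2_ip_cvg a c)) (ell2_ip_cvg b c).
congr ccvg; apply/funext => N; rewrite mulr_sumr -big_split /=.
by apply: eq_bigr => i _; rewrite ell2D ell2Z mulrDl mulrA.
Qed.

Lemma ell2_ip_conj a b : ell2_ip_fun b a = Num.conj (ell2_ip_fun a b).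
Proof.
apply: ccvg_unique (ell2_ip_cvg _ _) _.
have := ccvgJ (ell2_ip_cvg a b); congr ccvg; apply/funext => N.
rewrite rmorph_sum; apply: eq_bigr => i _ /=.
by rewrite rmorphM /= mulrC !conjE conjcK.
Qed.

Lemma ell2_ip_self_cvg a :
  ccvg (fun N => (\sum_(n < N) sqmod (a n : R[i]))%:C) (ell2_ip_fun a a).
Proof.
have := ell2_ip_cvg a a; congr ccvg; apply/funext => N.
by rewrite rmorph_sum; apply: eq_bigr => i _; rewrite mulCJ.
Qed.

Lemma ell2_ip_pos a : 0 <= ell2_ip_fun a a.
Proof.
have [hr hi] := ell2_ip_self_cvg a.
rewrite complex_ge0; apply/andP; split.
  by apply/eqP; apply: seq_lim_unique hi _; exact: cvg_cst.
apply: (seq_lim_ge (N := 0) hr) => n _.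
by apply: sumr_ge0 => i _; exact: sqmod_ge0.
Qed.

Definition ell2_ip : semi_ip ell2 := SemiIp ell2_ip_linl ell2_ip_conj ell2_ip_pos.
Local Notation ip := ell2_ip.

Lemma ell2_nsq_cvg a :
  (fun N => \sum_(n < N) sqmod (a n : R[i]) : R) @ \oo --> (nsq ip a : R).
Proof. exact: (ell2_ip_self_cvg a).1. Qed.

Lemma ell2_partial_le a N : \sum_(n < N) sqmod (a n : R[i]) <= nsq ip a.
Proof.
have := @seq_lim_ge _ _ _ (\sum_(n < N) sqmod (a n : R[i])) N (@ell2_nsq_cvg a).
apply => n Nn.
rewrite -!(big_mkord xpredT (fun n => sqmod (a n : R[i]))).
rewrite [leRHS](big_cat_nat (n := N)) //= lerDl sumr_ge0 // => i _; exact: sqmod_ge0.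
Qed.

Lemma ell2_nsq_le a B : (forall N, \sum_(n < N) sqmod (a n : R[i]) <= B) ->
  nsq ip a <= B.
Proof.
by move=> h; apply: (@seq_lim_le _ _ _ B 0 (@ell2_nsq_cvg a)) => n _; exact: h.
Qed.

Lemma ell2_coef_le a n : sqmod (a n : R[i]) <= nsq ip a.
Proof.
apply: le_trans (ell2_partial_le a n.+1); rewrite big_ord_recr /= lerDr.
by apply: sumr_ge0 => i _; exact: sqmod_ge0.
Qed.

Lemma ell2_definite : definite ip.
Proof.
move=> a a0; apply: ell2_ext => n; apply: sqmod_eq0; apply/eqP.
by rewrite eq_le sqmod_ge0 andbT -a0 ell2_coef_le.
Qed.

Lemma mk_ell2 (u : nat -> R[i]) B :
  (forall N, \sum_(n < N) sqmod (u n) <= B) ->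
  {a : ell2 | forall n, a n = u n}.
Proof.
move=> h; have hu : (u : nat -> R[i]^o) \in square_summable by apply/asboolP; exists B.
by exists (Ell2 hu).
Qed.

(** The coefficients converge separately; the Cauchy estimate holds for each
    finite section of the limit, hence for the limit. *)
Lemma ell2_complete : ip_complete ip.
Proof.
move=> u cu.
have mod_lt (e : R) (a : ell2) n : nrm ip a < e -> Num.sqrt (sqmod (a n : R[i])) < e.
  by apply: le_lt_trans; rewrite /nrm ler_sqrt ?nsq_ge0 //; exact: ell2_coef_le.
have co n : exists l : R[i], ccvg (fun k => u k n) l.
  have cF (F : R[i] -> R) : (forall z, `|F z| <= Num.sqrt (sqmod z)) ->
      (forall z w, F (z - w) = F z - F w) ->
      exists l : R, (fun k => F (u k n)) @ \oo --> l.
    move=> hF FB; suff : cvgn (fun k => F (u k n)) by move=> h; eexists; exact: h.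
    apply: cauchy_cvg; apply/cauchy_exP => e e0; have [N hN] := cu e e0.
    exists (F (u N n)); exists N => // k /= Nk.
    rewrite /ball /= -FB; apply: le_lt_trans (hF _) _.
    by rewrite -ell2B; apply: mod_lt; exact: hN.
  have [r hr] := cF _ (@Re_le_mod R) (fun z w => etrans (cReD _ _) (congr1 _ (cReN w))).
  have [s hs] := cF _ (@Im_le_mod R) (fun z w => etrans (cImD _ _) (congr1 _ (cImN w))).
  by exists (r +i* s).
have [l hl] := choice co.
have key (e : R) : 0 < e -> exists N, forall k, (N <= k)%N -> forall M,
    \sum_(n < M) sqmod ((u k n : R[i]) - l n) <= e ^+ 2.
  move=> e0; have [N hN] := cu e e0; exists N => k Nk M.
  have cv : (fun j => \sum_(n < M) sqmod ((u k n : R[i]) - (u j n : R[i]))) @ \oo -->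
     \sum_(n < M) sqmod ((u k n : R[i]) - l n).
    apply: (@cvg_sum_ord _ nat _ _ M (fun n j => sqmod ((u k n : R[i]) - (u j n : R[i])))
      (fun n => sqmod ((u k n : R[i]) - l n))) => n.
    rewrite /sqmod; apply: cvgD; apply: cvgM.
      + rewrite cReD cReN; under eq_cvg do rewrite cReD cReN.
        by apply: cvgB; [exact: cvg_cst|exact: (hl n).1].
      + rewrite cReD cReN; under eq_cvg do rewrite cReD cReN.
        by apply: cvgB; [exact: cvg_cst|exact: (hl n).1].
      + rewrite cImD cImN; under eq_cvg do rewrite cImD cImN.
        by apply: cvgB; [exact: cvg_cst|exact: (hl n).2].
      + rewrite cImD cImN; under eq_cvg do rewrite cImD cImN.
        by apply: cvgB; [exact: cvg_cst|exact: (hl n).2].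
  apply: (seq_lim_le (N := N) cv) => j Nj.
  have := hN k j Nk Nj; rewrite nrm_lt // => /ltW; apply: le_trans.
  apply: le_trans (ell2_partial_le _ M).
  by under [leRHS]eq_bigr do rewrite ell2B.
have [N1 h1] := key 1 ltr01.
have [a ha] := @mk_ell2 (fun n => (u N1 n : R[i]) - l n) _ (h1 _ (leqnn _)).
exists (u N1 - a) => e e0.
have e20 : 0 < e / 2 by rewrite divr_gt0.
have [N hN] := key _ e20; exists N => n Nn.
apply: (@le_lt_trans _ _ (e / 2)); last by rewrite gtr_pMr // invf_lt1 // ltr1n.
rewrite nrm_le; last exact: ltW.
apply: ell2_nsq_le => M.
apply: le_trans (hN n Nn M); apply: ler_sum => i _.
by rewrite !ell2B ha subKr.
Qed.

Definition delta_fun (k : nat) : nat -> R[i]^o := fun n => (n == k)%:R.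

Lemma delta_summable k : delta_fun k \in square_summable.
Proof.
apply/asboolP; exists 1 => N.
have [kN|kN] := ltnP k N.
  rewrite (bigD1 (Ordinal kN)) //= big1 ?addr0.
    by rewrite /delta_fun eqxx /sqmod /= expr1n expr0n addr0.
  move=> i /eqP ik; rewrite /delta_fun (_ : (i : nat) == k = false) ?sqmod0 //.
  by apply/eqP => h; apply: ik; apply: val_inj.
rewrite big1 // => i _; rewrite /delta_fun (_ : (i : nat) == k = false) ?sqmod0 //.
by apply/eqP => h; move: (ltn_ord i); rewrite h ltnNge kN.
Qed.

Definition delta k : ell2 := Ell2 (delta_summable k).
Arguments delta : simpl never.

Lemma coef_delta k n : delta k n = (n == k)%:R :> R[i].
Proof. by []. Qed.

Lemma ccvg_near u v (l : R[i]) N : (forall n, (N <= n)%N -> u n = v n) ->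
  ccvg u l -> ccvg v l.
Proof.
move=> uv [hr hi]; split.
  by apply: cvg_trans hr; apply: near_eq_cvg; exists N => // n /= Nn; rewrite uv.
by apply: cvg_trans hi; apply: near_eq_cvg; exists N => // n /= Nn; rewrite uv.
Qed.

Lemma ip_delta a k : ip a (delta k) = a k.
Proof.
apply: ccvg_unique (ell2_ip_cvg _ _) _.
apply: (@ccvg_near (fun=> a k) _ _ k.+1); last exact: ccvg_cst.
move=> n kn; rewrite (bigD1 (Ordinal kn)) //= big1 ?addr0.
  by rewrite coef_delta eqxx conjE conjc1 mulr1.
move=> i /eqP ik; rewrite coef_delta (_ : (i : nat) == k = false).
  by rewrite conjE conjc0 mulr0.
by apply/eqP => h; apply: ik; apply: val_inj.
Qed.

Definition trunc N a : ell2 := \sum_(n < N) (a n : R[i]) *: delta n.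

Lemma coef_trunc N a k : trunc N a k = (if (k < N)%N then a k else 0) :> R[i].
Proof.
rewrite ell2_sum; case: ifP => kN.
  rewrite (bigD1 (Ordinal kN)) //= big1 ?addr0.
    by rewrite ell2Z coef_delta eqxx mulr1.
  move=> i /eqP ik; rewrite ell2Z coef_delta (_ : k == i = false) ?mulr0 //.
  by apply/eqP => h; apply: ik; apply: val_inj.
rewrite big1 // => i _; rewrite ell2Z coef_delta (_ : k == i = false) ?mulr0 //.
by apply/eqP => h; move: (ltn_ord i); rewrite -h kN.
Qed.

Lemma delta_orthonormal i j : ip (delta i) (delta j) = (i == j)%:R.
Proof. by rewrite ip_delta coef_delta eq_sym. Qed.

Lemma nsq_trunc N a : nsq ip (trunc N a) = \sum_(n < N) sqmod (a n : R[i]).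
Proof. by apply: nsq_orthonormal => i j; rewrite delta_orthonormal. Qed.

Lemma nsq_tail N a : nsq ip (a - trunc N a) = nsq ip a - \sum_(n < N) sqmod (a n : R[i]).
Proof.
rewrite nsqB nsq_trunc.
have -> : complex.Re (ip a (trunc N a)) = \sum_(n < N) sqmod (a n : R[i]).
  rewrite ip_sumr cRe_sum; apply: eq_bigr => n _.
  by rewrite ipZr ip_delta mulrC mulCJ.
ring.
Qed.

Lemma trunc_tends a : tends ip (fun N => trunc N a) a.
Proof.
move=> e e0; have /cvgrPdist_lt h := @ell2_nsq_cvg a.
have [N _ hN] := h (e ^+ 2) ltac:(by rewrite exprn_gt0).
exists N => n Nn; rewrite nrmC nrm_lt // nsq_tail.
by apply: le_lt_trans (hN n Nn); exact: ler_norm.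
Qed.

Definition delay_fun k a : nat -> R[i]^o :=
  fun n => if (n < k)%N then 0 else a (n - k)%N.

Lemma delay_sum k a N (F : R[i] -> R) : F 0 = 0 ->
  \sum_(n < k + N) F (delay_fun k a n) = \sum_(n < N) F (a n).
Proof.
move=> F0; rewrite big_split_ord /= big1 ?add0r; last first.
  by move=> i _; rewrite /delay_fun ltn_ord.
by apply: eq_bigr => i _; rewrite /delay_fun ltnNge leq_addr /= addKn.
Qed.

Lemma delay_summable k a : delay_fun k a \in square_summable.
Proof.
apply/asboolP; have [B hB] := ell2_bounded a; exists B => N.
apply: le_trans (hB N); rewrite -(delay_sum k a N (sqmod0 R)).
rewrite -!(big_mkord xpredT (fun n => sqmod (delay_fun k a n : R[i]))).
rewrite [leRHS](big_cat_nat (n := N)) ?leq_addl //= lerDl sumr_ge0 // => i _.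
exact: sqmod_ge0.
Qed.

(** On Taylor coefficients, multiplication by [z ^+ k]. *)
Definition delay k a : ell2 := Ell2 (delay_summable k a).
Arguments delay : simpl never.

Lemma coef_delay k a n :
  delay k a n = (if (n < k)%N then 0 else a (n - k)%N) :> R[i].
Proof. by []. Qed.

Lemma delay_is_linear k : linear (delay k).
Proof.
move=> c a b; apply: ell2_ext => n.
rewrite ell2D ell2Z !coef_delay; case: ifP => // _.
by rewrite mulr0 addr0.
Qed.
HB.instance Definition _ k := GRing.isLinear.Build _ _ _ _ (delay k) (delay_is_linear k).

Lemma delay_isometry k a b : ip (delay k a) (delay k b) = ip a b.
Proof.
apply: ccvg_unique (ell2_ip_cvg _ _) _.
have [hr hi] := ell2_ip_cvg a b.
have e N : \sum_(n < k + N) (delay k a n : R[i]) * Num.conj (delay k b n : R[i])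
    = \sum_(n < N) (a n : R[i]) * Num.conj (b n : R[i]).
  rewrite big_split_ord /= big1 ?add0r; last first.
    by move=> i _; rewrite coef_delay ltn_ord mul0r.
  by apply: eq_bigr => i _; rewrite !coef_delay ltnNge leq_addr /= addKn.
split.
  rewrite -(cvg_shiftn k); move: hr; apply: cvg_trans; apply: near_eq_cvg.
  by apply: nearW => N; rewrite -e addnC.
rewrite -(cvg_shiftn k); move: hi; apply: cvg_trans; apply: near_eq_cvg.
by apply: nearW => N; rewrite -e addnC.
Qed.

Lemma delay_nsq k a : nsq ip (delay k a) = nsq ip a.
Proof. by rewrite /nsq delay_isometry. Qed.

Lemma delay_add j k a : delay j (delay k a) = delay (j + k) a.
Proof.
apply: ell2_ext => n; rewrite !coef_delay.
have [nj|nj] := ltnP n j; first by rewrite (ltn_addr _ nj).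
by rewrite subnDA -ltn_subLR // ; congr (if _ then _ else _); lia.
Qed.
End Ell2.
Arguments coef : simpl never.
Arguments delta : simpl never.
Arguments delay : simpl never.
Arguments ell2_ip : simpl never.

(** * Backward shift and point evaluation *)
Section MoreEll2.
Variable R : realType.
Local Notation ell2 := (ell2 R).
Local Notation ip := (ell2_ip R).
Implicit Types (a b : ell2).

Definition back_fun a : nat -> R[i]^o := fun n => a n.+1.

Lemma back_summable a : back_fun a \in @square_summable R.
Proof.
apply/asboolP; have [B hB] := ell2_bounded a; exists B => N.
apply: le_trans (hB N.+1); rewrite [leRHS]big_ord_recl lerDr.
exact: sqmod_ge0.
Qed.

(** The adjoint of [delay 1], see [ip_delay_back]. *)
Definition back a : ell2 := Ell2 (back_summable a).
Arguments back : simpl never.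

Lemma coef_back a n : back a n = a n.+1 :> R[i]. Proof. by []. Qed.

Lemma back_delta0 a : a = delay 1 (back a) + (a 0%N : R[i]) *: delta R 0.
Proof.
apply: ell2_ext => n; rewrite ell2D ell2Z coef_delay coef_back coef_delta.
by case: n => [|n]; rewrite ?mulr1 ?mulr0 ?add0r ?addr0 ?subn1.
Qed.

Lemma ip_delay_delta0 a : ip (delay 1 a) (delta R 0) = 0.
Proof. by rewrite ip_delta coef_delay. Qed.

Lemma ip_delay_back a b : ip (delay 1 a) b = ip a (back b).
Proof.
by rewrite {1}(back_delta0 b) ipDr ipZr ip_delay_delta0 mulr0 addr0 delay_isometry.
Qed.

Lemma delay0 a : delay 0 a = a.
Proof. by apply: ell2_ext => n; rewrite coef_delay subn0. Qed.
Definition szego_fun (z : R[i]) : nat -> R[i]^o := fun n => Num.conj z ^+ n.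

Lemma geo_bounded (x : R) : 0 <= x -> x < 1 ->
  forall N, \sum_(n < N) x ^+ n <= (1 - x)^-1.
Proof.
move=> x0 x1 N; have h : 0 < 1 - x by rewrite subr_gt0.
rewrite -[leRHS]mul1r ler_pdivlMr // mulrC.
have -> : (1 - x) * \sum_(n < N) x ^+ n = 1 - x ^+ N.
  elim: N => [|N IH]; first by rewrite big_ord0 mulr0 expr0 subrr.
  by rewrite big_ord_recr /= mulrDr IH exprS; ring.
by rewrite lerBlDr lerDl exprn_ge0.
Qed.

Lemma szego_summable z : sqmod z < 1 -> szego_fun z \in @square_summable R.
Proof.
move=> z1; apply/asboolP; exists (1 - sqmod z)^-1 => N.
under eq_bigr do rewrite /szego_fun sqmodX sqmodJ.
exact: geo_bounded (sqmod_ge0 z) z1 N.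
Qed.

(** The Szego kernel: pairing a sequence with it sums the power series at [z]. *)
Definition szego z (z1 : sqmod z < 1) : ell2 := Ell2 (szego_summable z1).
Arguments szego : simpl never.

Lemma ip_szego z (z1 : sqmod z < 1) a :
  ccvg (fun N => \sum_(n < N) (a n : R[i]) * z ^+ n) (ip a (szego z1)).
Proof.
have := ell2_ip_cvg a (szego z1); congr ccvg; apply/funext => N.
by apply: eq_bigr => n _; rewrite /= /szego /coef /szego_fun rmorphXn /= !conjE conjcK.
Qed.

Lemma ip_szego_delay z (z1 : sqmod z < 1) a k :
  ip (delay k a) (szego z1) = z ^+ k * ip a (szego z1).
Proof.
have h := ip_szego z1 (delay k a).
have h2 := ccvgZ (z ^+ k) (ip_szego z1 a).
have e N : \sum_(n < k + N) (delay k a n : R[i]) * z ^+ n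
     = z ^+ k * \sum_(n < N) (a n : R[i]) * z ^+ n.
  rewrite big_split_ord /= big1 ?add0r; last first.
    by move=> i _; rewrite coef_delay ltn_ord mul0r.
  rewrite mulr_sumr; apply: eq_bigr => i _.
  by rewrite coef_delay ltnNge leq_addr /= addKn exprD mulrCA.
apply: ccvg_unique h2.
case: h => hr hi; split.
  move: hr; rewrite -(cvg_shiftn k); apply: cvg_trans; apply: near_eq_cvg.
  by apply: nearW => N /=; rewrite addnC e.
move: hi; rewrite -(cvg_shiftn k); apply: cvg_trans; apply: near_eq_cvg.
by apply: nearW => N /=; rewrite addnC e.
Qed.

Lemma szego_nsq_cvg z (z1 : sqmod z < 1) :
  (fun N => \sum_(n < N) sqmod z ^+ n) @ \oo --> (nsq ip (szego z1) : R).
Proof.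
have := @ell2_nsq_cvg _ (szego z1); apply: cvg_trans; apply: near_eq_cvg.
apply: nearW => N; apply: eq_bigr => n _.
by rewrite /szego /coef /szego_fun sqmodX sqmodJ.
Qed.
(** Let [s] be the squared norm of the Szego kernel and [t] that of its truncation
    at [N]. Multiplying the truncation by [a] and pairing with the kernel gives
    [t * a(z)], so Cauchy-Schwarz bounds [t ^+ 2 * |a(z)| ^+ 2] by [t * s]; and
    [t] tends to [s]. *)
Lemma multiplier_bound a z (z1 : sqmod z < 1) :
  (forall N (c : nat -> R[i]), nsq ip (\sum_(n < N) c n *: delay n a)
      <= \sum_(n < N) sqmod (c n)) ->
  sqmod (ip a (szego z1)) <= 1.
Proof.
move=> h; set w := ip a (szego z1); set s := nsq ip (szego z1).
have s0 : 0 < s.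
  apply: lt_le_trans (ell2_coef_le _ 0).
  by rewrite /szego /coef /szego_fun expr0 /sqmod /= expr1n expr0n addr0.
have key N : (\sum_(n < N) sqmod z ^+ n) * sqmod w <= s.
  set t := \sum_(n < N) _.
  have [->|t0] := eqVneq t 0; first by rewrite mul0r ltW.
  have tp : 0 < t by rewrite lt_neqAle eq_sym t0 sumr_ge0 // => i _; rewrite exprn_ge0 // sqmod_ge0.
  have e : ip (\sum_(n < N) Num.conj z ^+ n *: delay n a) (szego z1) = t%:C * w.
    rewrite ip_suml rmorph_sum mulr_suml; apply: eq_bigr => n _.
    by rewrite ipZl ip_szego_delay mulrA -exprMn mulrC -[_^* * _]mulrC mulCJ rmorphXn /= mulrC.
  have := cauchy_schwarz ip (\sum_(n < N) Num.conj z ^+ n *: delay n a) (szego z1).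
  rewrite e sqmodM sqmod_real -/s => h1.
  have h2 : nsq ip (\sum_(n < N) Num.conj z ^+ n *: delay n a) <= t.
    by apply: le_trans (h N (fun n => Num.conj z ^+ n)) _; apply: ler_sum => n _; rewrite sqmodX sqmodJ.
  have := le_trans h1 (ler_wpM2r (ltW s0) h2).
  by rewrite expr2 -mulrA ler_pM2l.
have h1 : (fun N => (\sum_(n < N) sqmod z ^+ n) * sqmod w) @ \oo --> s * sqmod w.
  by apply: cvgMr_tmp; exact: szego_nsq_cvg.
have := @seq_lim_le _ _ _ s 0 h1 (fun n _ => key n).
by rewrite -/s -{2}[s]mulr1 ler_pM2l.
Qed.
End MoreEll2.
Arguments back : simpl never.
Arguments szego : simpl never.

(** * Closure of a subspace *)
Section Adherence.
Variables (R : realType) (V : lmodType R[i]) (ip : semi_ip V).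

Lemma adherent_closed (K : set V) : closed_in ip (adherent ip K).
Proof.
move=> x h e e0; have e20 : 0 < e / 2 by rewrite divr_gt0.
have [y hy xy] := h _ e20; have [k Kk yk] := hy _ e20.
exists k => //; apply: le_lt_trans (nrmB ip x y k) _.
by rewrite [X in _ < X](splitr e); exact: ltrD.
Qed.

Lemma adherent_linsub (K : set V) : linsub K -> linsub (adherent ip K).
Proof.
move=> sK; split.
  by move=> e e0; exists 0; [exact: sK.1|rewrite subr0 nrm0].
move=> c x y hx hy e e0.
have e20 : 0 < e / 2 by rewrite divr_gt0.
have r0 : 0 < Num.sqrt (sqmod c) + 1 by rewrite ltr_wpDl // sqrtr_ge0.
have [k Kk xk] := hx (e / 2 / (Num.sqrt (sqmod c) + 1)) ltac:(by rewrite divr_gt0).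
have [l Kl yl] := hy _ e20.
exists (c *: k + l); first exact: sK.2.
have -> : c *: x + y - (c *: k + l) = c *: (x - k) + (y - l).
  by rewrite scalerBr opprD addrACA.
apply: le_lt_trans (nrmD _ _ _) _; rewrite [X in _ < X](splitr e).
apply: ler_ltD yl; rewrite nrmZ.
move: (ltW xk); rewrite ler_pdivlMr // => h; apply: le_trans h.
by rewrite mulrC ler_wpM2l ?nrm_ge0 // lerDl.
Qed.

Lemma adherent_sub (K : set V) : K `<=` adherent ip K.
Proof. by move=> x Kx e e0; exists x => //; rewrite subrr nrm0. Qed.
End Adherence.

(** * Shift-invariant subspaces: the Beurling-Lax theorem *)
Section BeurlingLax.
Variables (R : realType) (q : nat).
Local Notation ell2 := (ell2 R).
Local Notation W := {ffun 'I_q -> ell2}.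
Local Notation vip := (vec_ip (ell2_ip R) q).
Implicit Types (X Y Z : W).

Definition vdelay k X : W := [ffun i => delay k (X i)].

Lemma vdelay_is_linear k : linear (vdelay k).
Proof. by move=> c X Y; apply/ffunP => i; rewrite !ffunE linearP. Qed.
HB.instance Definition _ k :=
  GRing.isLinear.Build _ _ _ _ (vdelay k) (vdelay_is_linear k).

Lemma vdelay_isometry k X Y : vip (vdelay k X) (vdelay k Y) = vip X Y.
Proof. by apply: eq_bigr => i _; rewrite !ffunE delay_isometry. Qed.

Lemma vdelay_nrm k X : nrm vip (vdelay k X) = nrm vip X.
Proof. by rewrite /nrm /nsq vdelay_isometry. Qed.

Lemma vdelay_add j k X : vdelay j (vdelay k X) = vdelay (j + k) X.
Proof. by apply/ffunP => i; rewrite !ffunE delay_add. Qed.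

Lemma vdelay0 X : vdelay 0 X = X.
Proof. by apply/ffunP => i; rewrite !ffunE delay0. Qed.

(** On Taylor coefficients, innerness of the matrix whose columns are the
    [Psi j]. *)
Definition delay_orthonormal r (Psi : 'I_r -> W) := forall n m i j,
  vip (vdelay n (Psi i)) (vdelay m (Psi j)) = ((n == m) && (i == j))%:R.

(** The partial sums, in powers of [z], of the product of the matrix with columns
    [Psi j] by the vector function with coefficients [c], the matrix being left
    unexpanded. *)
Definition synth r (Psi : 'I_r -> W) (c : 'I_r -> ell2) N : W :=
  \sum_(k : 'I_N * 'I_r) (c k.2 k.1 : R[i]) *: vdelay k.1 (Psi k.2).

Section Synthesis.
Variables (r : nat) (Psi : 'I_r -> W).
Hypothesis oPsi : delay_orthonormal Psi.

Lemma block_orthonormal M (k l : 'I_M * 'I_r) :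
  vip (vdelay k.1 (Psi k.2)) (vdelay l.1 (Psi l.2)) = (k == l)%:R.
Proof. by rewrite oPsi; case: k => a b; case: l => c d; rewrite xpair_eqE. Qed.

Lemma synth_widen c M N : (N <= M)%N -> synth Psi c N =
  \sum_(k : 'I_M * 'I_r) (trunc N (c k.2) k.1 : R[i]) *: vdelay k.1 (Psi k.2).
Proof.
move=> NM; rewrite /synth.
rewrite -(pair_bigA _ (fun (a : 'I_N) b => (c b a : R[i]) *: vdelay a (Psi b))) /=.
rewrite -(pair_bigA _ (fun (a : 'I_M) b => (trunc N (c b) a : R[i]) *: vdelay a (Psi b))) /=.
rewrite (big_ord_widen _ (fun a : nat => \sum_j (c j a : R[i]) *: vdelay a (Psi j)) NM).
rewrite big_mkcond; apply: eq_bigr => a _.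
case: ifP => aN.
  by apply: eq_bigr => j _; rewrite coef_trunc aN.
by rewrite big1 // => j _; rewrite coef_trunc aN scale0r.
Qed.

Lemma synth_sub_nsq c M N : (N <= M)%N ->
  nsq vip (synth Psi c M - synth Psi c N)
  = nsq (vec_ip (ell2_ip R) r) ([ffun j => trunc M (c j)] - [ffun j => trunc N (c j)]).
Proof.
move=> NM; rewrite (synth_widen c NM) (synth_widen c (leqnn M)) -sumrB.
under eq_bigr do rewrite -scalerBl.
rewrite (nsq_orthonormal _ (@block_orthonormal M)) vec_nsq.
rewrite -(pair_bigA _ (fun (a : 'I_M) b => sqmod ((trunc M (c b) a : R[i]) - trunc N (c b) a))) /=.
rewrite exchange_big; apply: eq_bigr => j _ /=; rewrite !ffunE.
rewrite -(nsq_trunc M (trunc M (c j) - trunc N (c j))); congr nsq; apply: ell2_ext => n.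
rewrite coef_trunc ell2B !coef_trunc; case: (ltnP n M) => nM //.
by rewrite ifF ?subrr //; apply/negbTE; rewrite -leqNgt (leq_trans NM).
Qed.

(** By orthonormality [synth Psi] is isometric on truncated coefficients. *)
Lemma synth_cauchy c : exists X, tends vip (synth Psi c) X.
Proof.
apply: (vec_complete (@ell2_complete R)) => e e0.
have tc : tends (vec_ip (ell2_ip R) r)
    (fun N => [ffun j => trunc N (c j)]) [ffun j => c j].
  apply: vec_tends => j; rewrite ffunE.
  by under eq_fun do rewrite ffunE; exact: trunc_tends.
have [N hN] := tends_cauchy tc e0; exists N => m n Nm Nn.
have [mn|/ltnW nm] := leqP m n.
  by rewrite nrmC /nrm synth_sub_nsq //; exact: hN.
by rewrite /nrm synth_sub_nsq //; exact: hN.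
Qed.

Lemma synth_ip c N n j : (n < N)%N ->
  vip (synth Psi c N) (vdelay n (Psi j)) = c j n.
Proof.
move=> nN; rewrite ip_suml (bigD1 (Ordinal nN, j)) //= big1 ?addr0.
  by rewrite ipZl oPsi !eqxx mulr1.
move=> k /negbTE kn; rewrite ipZl -[vdelay n _]/(vdelay (Ordinal nN, j).1 (Psi (Ordinal nN, j).2)).
by rewrite block_orthonormal kn mulr0.
Qed.
Lemma synth_eval c X z (z1 : sqmod z < 1) i : tends vip (synth Psi c) X ->
  ell2_ip R (X i) (szego z1) =
  \sum_j ell2_ip R (Psi j i) (szego z1) * ell2_ip R (c j) (szego z1).
Proof.
move=> cX.
have ci : tends (ell2_ip R) (fun N => synth Psi c N i) (X i).
  move=> e /cX[N hN]; exists N => n Nn; apply: le_lt_trans (hN n Nn).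
  by have := vec_nrm_ge (ell2_ip R) (synth Psi c n - X) i; rewrite !ffunE.
apply: ccvg_unique (tends_ccvg (szego z1) ci) _.
have -> : (fun N => ell2_ip R (synth Psi c N i) (szego z1)) =
  (fun N => \sum_(j < r) ell2_ip R (Psi j i) (szego z1) *
     \sum_(n < N) (c j n : R[i]) * z ^+ n).
  apply/funext => N; rewrite /synth sum_ffunE ip_suml.
  rewrite -(pair_bigA _ (fun (a : 'I_N) b =>
    ell2_ip R (((c b a : R[i]) *: vdelay a (Psi b)) i) (szego z1))) /=.
  rewrite exchange_big; apply: eq_bigr => j _; rewrite mulr_sumr.
  apply: eq_bigr => n _; rewrite !ffunE ipZl ip_szego_delay.
  by rewrite mulrCA [RHS]mulrC -mulrA mulrCA; congr (_ * _); exact: mulrC.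
by apply: ccvg_sum => j; apply: ccvgZ; exact: ip_szego.
Qed.

(** Orthonormality of the delays of [Psi j] makes multiplication by [Psi j]
    isometric, hence multiplication by one of its entries contractive. *)
Lemma entry_bound z (z1 : sqmod z < 1) i j :
  sqmod (ell2_ip R (Psi j i) (szego z1)) <= 1.
Proof.
apply: multiplier_bound => N c.
have h (k l : 'I_N) : vip (vdelay k (Psi j)) (vdelay l (Psi j)) = (k == l)%:R.
  by rewrite oPsi eqxx andbT.
rewrite -(nsq_orthonormal (fun k : 'I_N => c k) h).
apply: le_trans (vec_nsq_ge _ _ i).
rewrite le_eqVlt; apply/orP; left; apply/eqP; congr nsq.
by rewrite sum_ffunE; apply: eq_bigr => k _; rewrite !ffunE.
Qed.
End Synthesis.

Section Wandering.
Variable N : set W.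
Hypotheses (subN : linsub N) (closedN : closed_in vip N).
Hypothesis delayN : forall X, N X -> N (vdelay 1 X).
Hypothesis few : forall r (Psi : 'I_r -> W), delay_orthonormal Psi -> (r <= q)%N.

Let cW : ip_complete vip := vec_complete (@ell2_complete R).
Let dW : definite vip := vec_definite (@ell2_definite R).

Definition wandering X := N X /\ forall Y, N Y -> vip X (vdelay 1 Y) = 0.

Lemma vdelay_in k X : N X -> N (vdelay k X).
Proof.
move=> NX; elim: k => [|k IH]; first by rewrite vdelay0.
by rewrite -[k.+1]add1n -vdelay_add; exact: delayN.
Qed.

(** Delays of different orders are orthogonal: after cancelling the smaller order,
    one vector is wandering and the other lies in [z N]. *)
Lemma wandering_delay_orthonormal r (Psi : 'I_r -> W) :
  (forall j, wandering (Psi j)) ->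
  (forall i j, vip (Psi i) (Psi j) = (i == j)%:R) -> delay_orthonormal Psi.
Proof.
move=> wP oP.
have lt n m i j : (n < m)%N -> vip (vdelay n (Psi i)) (vdelay m (Psi j)) = 0.
  move=> nm; rewrite -(subnKC (ltnW nm)) -vdelay_add vdelay_isometry.
  have /prednK <- : (0 < m - n)%N by rewrite subn_gt0.
  by rewrite -add1n -vdelay_add; apply: (wP i).2; apply: vdelay_in; exact: (wP j).1.
move=> n m i j; have [nm|mn|->] := ltngtP n m.
- exact: lt.
- by rewrite ip_conj lt // conjE conjc0.
- by rewrite vdelay_isometry oP.
Qed.

Lemma linsub_wandering : linsub wandering.
Proof.
split.
  by split; [exact: subN.1|move=> Y _; exact: ip0l].
move=> c X Y [NX wX] [NY wY]; split; first exact: subN.2.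
by move=> Z NZ; rewrite ip_linl wX // wY // mulr0 addr0.
Qed.

(** The bound [few] on the size of orthonormal families of wandering vectors
    provides one of maximal size; a nonzero wandering vector orthogonal to it could
    be normalized and added. *)
Lemma wandering_basis : exists r (Psi : 'I_r -> W),
  [/\ forall j, wandering (Psi j),
      forall i j, vip (Psi i) (Psi j) = (i == j)%:R &
      forall X, wandering X -> (forall j, vip X (Psi j) = 0) -> X = 0].
Proof.
pose P r := `[< exists Psi : 'I_r -> W, (forall j, wandering (Psi j)) /\
  forall i j, vip (Psi i) (Psi j) = (i == j)%:R >].
have P0 : exists r, P r.
  by exists 0%N; apply/asboolP; exists (fun=> 0); split; case.
have Pq r : P r -> (r <= q)%N.
  by move=> /asboolP[Psi [w o]]; apply: few; exact: wandering_delay_orthonormal w o.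
have [r /asboolP[Psi [w o]] rmax] := ex_maxnP P0 Pq.
exists r, Psi; split => // X wX Xo; apply: contrapT => X0.
suff /rmax : P r.+1 by rewrite ltnn.
have s0 : nsq vip X != 0 by apply/eqP => /dW.
have sp : 0 < nsq vip X by rewrite lt_neqAle eq_sym s0 nsq_ge0.
pose c : R[i] := (Num.sqrt (nsq vip X))^-1%:C.
apply/asboolP; exists (fun i => if unlift ord0 i is Some j then Psi j else c *: X).
have Xo' j : vip (Psi j) X = 0 by rewrite ip_conj Xo conjE conjc0.
split.
  by move=> i; case: unliftP => [j _|_] //; apply: linsubZ => //; exact: linsub_wandering.
move=> i k; case: unliftP => [j ->|->]; case: unliftP => [l ->|->].
- by rewrite o (inj_eq (@lift_inj _ ord0)).
- by rewrite ipZr Xo' mulr0.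
- by rewrite ipZl Xo mulr0.
- rewrite ipZl ipZr mulrA mulCJ sqmod_real ip_nsq -rmorphM /= exprVn sqr_sqrtr ?ltW //.
  by rewrite mulVf.
Qed.

(** A limit of multiples of [z] vanishes at 0, so it is itself a multiple of
    [z]; the quotient is in the closure of [N] because [vdelay 1] is isometric. *)
Lemma vdelay_image_closed : closed_in vip [set vdelay 1 X | X in N].
Proof.
move=> Z hZ.
have Z0 i : Z i 0%N = 0 :> R[i].
  apply: sqmod_eq0; apply/eqP; rewrite eq_le sqmod_ge0 andbT.
  apply/ler_addgt0Pr => e e0; rewrite add0r.
  have [_ [X _ <-]] := hZ (Num.sqrt e) ltac:(by rewrite sqrtr_gt0).
  rewrite nrm_lt ?sqrtr_gt0 // sqr_sqrtr; last exact: ltW.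
  move=> h; apply/ltW; apply: le_lt_trans h.
  apply: le_trans (vec_nsq_ge _ _ i); apply: le_trans (ell2_coef_le _ 0).
  by rewrite !ffunE ell2D ell2N coef_delay subr0.
pose Y : W := [ffun i => back (Z i)].
have ZY : Z = vdelay 1 Y.
  apply/ffunP => i; rewrite !ffunE {1}(back_delta0 (Z i)).
  by rewrite [Z i 0%N]Z0 scale0r addr0.
exists Y => //; apply: closedN => e e0.
have [_ [X NX <-]] := hZ e e0; exists X; first exact: NX.
by rewrite -(vdelay_nrm 1) linearB /= -ZY.
Qed.

(** Let [Z] in [N] be orthogonal to all [z^n Psi j]. Its component orthogonal to
    [z N] is wandering and orthogonal to the [Psi j], so it is 0 and [Z] is [z] times
    a vector of [N] with the same property. Thus [Z] is divisible by every power of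
    [z], that is, [Z = 0]. Applied to the difference between a vector of [N] and the
    sum of its Fourier expansion on the [z^n Psi j], this shows that the latter span
    [N]. *)
Theorem beurling_lax : exists r (Psi : 'I_r -> W),
  [/\ (r <= q)%N, delay_orthonormal Psi &
      forall X, N X <-> exists c, tends vip (synth Psi c) X].
Proof.
have [r [Psi [wP oP maxP]]] := wandering_basis.
have dP := wandering_delay_orthonormal wP oP.
exists r, Psi; split; [exact: few dP|exact: dP|].
have Nsynth c k : N (synth Psi c k).
  by apply: linsub_sum => // i _; apply: linsubZ => //; apply: vdelay_in; exact: (wP _).1.
have sD : linsub [set vdelay 1 X | X in N].
  split; first by exists 0; [exact: subN.1|exact: linear0].
  move=> c _ _ [X NX <-] [Y NY <-]; exists (c *: X + Y); first exact: subN.2.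
  exact: linearP.
have orth0 Z : N Z -> (forall n j, vip Z (vdelay n (Psi j)) = 0) -> Z = 0.
  move=> NZ Zo.
  have div k : exists2 Y, N Y & Z = vdelay k Y.
    elim: k => [|k [Y NY ZY]]; first by exists Z => //; rewrite vdelay0.
    have Yo n j : vip Y (vdelay n (Psi j)) = 0.
      by rewrite -(vdelay_isometry k) -ZY vdelay_add.
    have [_ [X NX <-] hX] := projection Y cW sD vdelay_image_closed.
    exists X => //; rewrite ZY -addn1 -vdelay_add; congr vdelay.
    apply/eqP; rewrite -subr_eq0; apply/eqP; apply: maxP.
      split; first by apply: linsubB => //; exact: delayN.
      by move=> T NT; apply: hX; exists T.
    move=> j; rewrite ipBl -{1}[Psi j]vdelay0 Yo sub0r.
    by rewrite ip_conj (wP j).2 // conjE conjc0 oppr0.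
  apply/ffunP => i; apply: ell2_ext => n.
  by have [Y _ ->] := div n.+1; rewrite !ffunE coef_delay ltnSn.
move=> X; split => [NX|[c cX]]; last exact: tends_closed closedN (Nsynth c) cX.
have bnd j : exists a : ell2, forall n, a n = vip X (vdelay n (Psi j)) :> R[i].
  have h M : \sum_(n < M) sqmod (vip X (vdelay n (Psi j))) <= nsq vip X.
    by apply: bessel => n m; rewrite dP eqxx andbT.
  by have [a ha] := @mk_ell2 _ (fun n => vip X (vdelay n (Psi j))) _ h; exists a.
have [c hc] := choice bnd; exists c.
have [X' cX'] := synth_cauchy dP c.
have NX' : N X' := tends_closed closedN (Nsynth c) cX'.
suff /eqP : X - X' = 0 by rewrite subr_eq0 => /eqP ->.
apply: orth0; first exact: linsubB.
move=> n j; apply: small_nrm_ip => e /cX'[M hM].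
pose K := maxn M n.+1.
exists (synth Psi c K - X'); last by apply: hM; exact: leq_maxl.
by rewrite !ipBl synth_ip // ?hc // leq_maxr.
Qed.
End Wandering.
End BeurlingLax.

(** * The shift-invariant subspace attached to a nearly invariant one *)
Section Model.
Variables (R : realType) (p : nat).
Local Notation ell2 := (ell2 R).
Local Notation ip := (ell2_ip R).
Local Notation W := {ffun 'I_(p + 1) -> ell2}.
Local Notation vip := (vec_ip (ell2_ip R) (p + 1)).

Definition stack (Y : 'I_p -> ell2) (G : ell2) : W :=
  [ffun i => match fintype.split i with inl j => Y j | inr _ => G end].

Lemma stack_l Y G j : stack Y G (lshift 1 j) = Y j.
Proof. by rewrite ffunE (unsplitK (inl j)). Qed.
Lemma stack_r Y G j : stack Y G (rshift p j) = G.
Proof. by rewrite ffunE (unsplitK (inr j)). Qed.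

Lemma stack_split (X : W) : X = stack (fun j => X (lshift 1 j)) (X (rshift p ord0)).
Proof.
apply/ffunP => i; rewrite ffunE; case: splitP => j ij; congr (X _); apply: val_inj => //=.
by rewrite ij ord1.
Qed.

Lemma stack_ip Y G Y' G' :
  vip (stack Y G) (stack Y' G') = \sum_j ip (Y j) (Y' j) + ip G G'.
Proof.
rewrite /= [LHS]big_split_ord /= big_ord1 !stack_r; congr (_ + _).
by apply: eq_bigr => j _; rewrite !stack_l.
Qed.

Lemma vdelay_stack k Y G :
  vdelay k (stack Y G) = stack (fun j => delay k (Y j)) (delay k G).
Proof. by apply/ffunP => i; rewrite !ffunE; case: (fintype.split i). Qed.

Lemma stackP c Y G Y' G' : c *: stack Y G + stack Y' G' =
  stack (fun j => c *: Y j + Y' j) (c *: G + G').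
Proof. by apply/ffunP => i; rewrite !ffunE; case: (fintype.split i). Qed.

Variables (phi : 'I_p -> ell2) (T : 'I_p -> ell2 -> ell2).
Hypothesis ophi : forall i j, ip (phi i) (phi j) = (i == j)%:R.
Hypothesis TE : forall j g k, T j g k = ip g (delay k (phi j)) :> R[i].

Lemma T_linear j : linear (T j).
Proof.
by move=> c a b; apply: ell2_ext => n; rewrite ell2D ell2Z !TE ip_linl.
Qed.
HB.instance Definition _ j := GRing.isLinear.Build _ _ _ _ (T j) (T_linear j).

Lemma T_back j g : T j (back g) = back (T j g).
Proof.
apply: ell2_ext => n; rewrite coef_back !TE.
rewrite -[n.+1]add1n -delay_add [RHS]ip_conj ip_delay_back.
by rewrite -ip_conj.
Qed.

Definition Wmap g : W := stack (fun j => T j g) g.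

Lemma Wmap_is_linear : linear Wmap.
Proof. move=> c a b; rewrite stackP; congr stack.
by apply/funext => j; exact: T_linear. Qed.
HB.instance Definition _ := GRing.isLinear.Build _ _ _ _ Wmap Wmap_is_linear.

Definition last_comp (X : W) : ell2 := X (rshift p ord0).
Definition Ucoef (X : W) j : R[i] := ip (delay 1 (last_comp X)) (phi j).
(** Multiplication by [z], except that the component of [z G] along each [phi j]
    is moved into the constant coefficient of [z Y j]. *)
Definition U (X : W) : W :=
  stack (fun j => delay 1 (X (lshift 1 j)) + Ucoef X j *: delta R 0)
        (delay 1 (last_comp X) - \sum_j Ucoef X j *: phi j).

(** The squared norm lost by the last entry is that of the projection of [z G]
    onto the orthonormal [phi j], the sum of the [|Ucoef X j| ^+ 2]; the other
    entries gain it, since [z Y j] has no constant coefficient. *)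
Lemma U_isometry X Y : vip (U X) (U Y) = vip X Y.
Proof.
rewrite [in RHS](stack_split X) [in RHS](stack_split Y) !stack_ip.
have -> : \sum_j ip (delay 1 (X (lshift 1 j)) + Ucoef X j *: delta R 0)
      (delay 1 (Y (lshift 1 j)) + Ucoef Y j *: delta R 0)
  = \sum_j ip (X (lshift 1 j)) (Y (lshift 1 j)) + \sum_j Ucoef X j * Num.conj (Ucoef Y j).
  rewrite -big_split; apply: eq_bigr => j _ /=.
  rewrite ipDl !ipDr !ipZl !ipZr delay_isometry ip_delay_delta0 delta_orthonormal.
  rewrite [ip (delta R 0) _]ip_conj ip_delay_delta0 rmorph0.
  by rewrite !mulr0 addr0 add0r mulr1.
rewrite -addrA; congr (_ + _).
rewrite -/(last_comp X) -/(last_comp Y) ipBl !ipBr delay_isometry.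
have h1 : ip (delay 1 (last_comp X)) (\sum_j Ucoef Y j *: phi j)
    = \sum_j Ucoef X j * Num.conj (Ucoef Y j).
  by rewrite ip_sumr; apply: eq_bigr => j _; rewrite ipZr mulrC.
have h2 : ip (\sum_j Ucoef X j *: phi j) (delay 1 (last_comp Y))
    = \sum_j Ucoef X j * Num.conj (Ucoef Y j).
  by rewrite ip_suml; apply: eq_bigr => j _; rewrite ipZl -ip_conj.
have h3 : ip (\sum_j Ucoef X j *: phi j) (\sum_j Ucoef Y j *: phi j)
    = \sum_j Ucoef X j * Num.conj (Ucoef Y j).
  rewrite ip_suml; apply: eq_bigr => j _; rewrite ipZl ip_sumr (bigD1 j) //= big1.
    by rewrite ipZr ophi eqxx mulr1 addr0.
  by move=> l lj; rewrite ipZr ophi eq_sym (negbTE lj) mulr0.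
rewrite h1 h2 h3; ring.
Qed.

Lemma iterU_isometry n X Y : vip (iter n U X) (iter n U Y) = vip X Y.
Proof. by elim: n => // n IH; rewrite !iterS U_isometry. Qed.

(** [z^n W g] and [U^n W g] differ by the column with entries [- b j] and [r]. By
    the relation between [r] and [b], that column is orthogonal to every [W g']. *)
Lemma orbit_split n g : exists (b : 'I_p -> ell2) (r : ell2),
  vdelay n (Wmap g) = stack (fun j => iter n U (Wmap g) (lshift 1 j) - b j)
                            (last_comp (iter n U (Wmap g)) + r)
  /\ forall g', ip r g' = \sum_j ip (b j) (T j g').
Proof.
elim: n => [|n [b [r [e h]]]].
  exists (fun=> 0), 0; split.
    rewrite vdelay0 /= [LHS]stack_split; congr stack; last by rewrite addr0.
    by apply/funext => j; rewrite subr0.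
  by move=> g'; rewrite ip0l big1 // => j _; rewrite ip0l.
pose c := Ucoef (iter n U (Wmap g)).
exists (fun j => delay 1 (b j) + c j *: delta R 0).
exists (delay 1 r + \sum_j c j *: phi j); split.
  rewrite -[n.+1]add1n -vdelay_add e vdelay_stack iterS /U; congr stack.
    apply/funext => j; rewrite stack_l linearB /= opprD addrACA.
    by rewrite subrr addr0.
  by rewrite /last_comp stack_r linearD /= addrACA addNr addr0.
move=> g'; rewrite ipDl ip_delay_back h ip_suml -big_split /=.
apply: eq_bigr => j _; rewrite ipDl ip_delay_back T_back !ipZl; congr (_ + _ * _).
by rewrite ip_conj [RHS]ip_conj ip_delta TE delay0.
Qed.

Lemma gram_step n g g' :
  vip (vdelay n (Wmap g)) (Wmap g') = vip (iter n U (Wmap g)) (Wmap g').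
Proof.
have [b [r [-> h]]] := orbit_split n g.
rewrite [in RHS](stack_split (iter n U (Wmap g))) !stack_ip ipDl h -/(last_comp _).
rewrite addrCA addrC; congr (_ + _).
by rewrite -big_split; apply: eq_bigr => j _ /=; rewrite ipBl subrK.
Qed.

(** The general case reduces to [m = 0] because both [vdelay] and [U] are
    isometric. *)
Lemma gram n m g g' : vip (vdelay n (Wmap g)) (vdelay m (Wmap g'))
  = vip (iter n U (Wmap g)) (iter m U (Wmap g')).
Proof.
have le k l a b : (l <= k)%N -> vip (vdelay k (Wmap a)) (vdelay l (Wmap b))
  = vip (iter k U (Wmap a)) (iter l U (Wmap b)).
  move=> lk; rewrite -(subnKC lk) -vdelay_add vdelay_isometry gram_step.
  by rewrite iterD iterU_isometry.
have [|/ltnW nm] := leqP m n; first exact: le.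
by rewrite ip_conj [RHS]ip_conj le.
Qed.

Lemma gram_nsq n (g : nat -> ell2) :
  nsq vip (\sum_(k < n) vdelay k (Wmap (g k))) =
  nsq vip (\sum_(k < n) iter k U (Wmap (g k))).
Proof.
rewrite /nsq !ip_suml; congr complex.Re; apply: eq_bigr => k _.
by rewrite !ip_sumr; apply: eq_bigr => l _; exact: gram.
Qed.

Variable M : set ell2.
Hypotheses (subM : linsub M) (closedM : closed_in ip M).
Hypothesis nearM : forall g, M g ->
  M (delay 1 g - \sum_j ip (delay 1 g) (phi j) *: phi j).

Definition orbit_span : set W := [set X | exists n (g : nat -> ell2),
  (forall k, M (g k)) /\ X = \sum_(k < n) vdelay k (Wmap (g k))].

Definition model_space := adherent vip orbit_span.

(** Two sums are added after padding them with zeros to the same length. *)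
Lemma linsub_orbit_span : linsub orbit_span.
Proof.
split.
  by exists 0%N, (fun=> 0); split; [move=> _; exact: subM.1|rewrite big_ord0].
move=> c _ _ [n [g [Mg ->]]] [m [h [Mh ->]]].
have pad k (f : nat -> ell2) N : (k <= N)%N ->
    \sum_(i < k) vdelay i (Wmap (f i)) =
    \sum_(i < N) vdelay i (Wmap (if (i < k)%N then f i else 0)).
  move=> kN; rewrite (big_ord_widen _ (fun i => vdelay i (Wmap (f i))) kN) big_mkcond.
  by apply: eq_bigr => i _; case: ifP => //; rewrite !linear0.
pose N := maxn n m.
exists N, (fun k => c *: (if (k < n)%N then g k else 0) + (if (k < m)%N then h k else 0)).
split.
  by move=> k; apply: subM.2; case: ifP => // _; exact: subM.1.
rewrite (pad _ _ N (leq_maxl _ _)) (pad _ _ N (leq_maxr _ _)) scaler_sumr -big_split.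
by apply: eq_bigr => i _; rewrite !linearP.
Qed.

(** The last entry of [U X] depends only on that of [X], through the map of the
    hypothesis [nearM]. *)
Lemma last_orbit k g : M g -> M (last_comp (iter k U (Wmap g))).
Proof.
move=> Mg; elim: k => [|k IH]; first by rewrite /= /last_comp stack_r.
by rewrite iterS /U /last_comp stack_r; exact: nearM.
Qed.

(** Suppose that [W g] is close to the sum of the [z^k W (f k)] with [f k] in
    [M]. The difference is a combination of vectors [z^k W _], so by [gram_nsq] it
    has the same norm when multiplication by [z] is replaced by [U]. The last entry
    of the new difference is [g] minus an element of [M]. *)
Lemma model_mem g : model_space (Wmap g) <-> M g.
Proof.
split; last first.
  move=> Mg; apply: adherent_sub; exists 1%N, (fun=> g); split => //.
  by rewrite big_ord1 vdelay0.
move=> h; apply: closedM => e /h[_ [n [f [Mf ->]] lt]].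
(* [- f'] are the coefficients of [W g] minus the sum, written as a single sum
   over [z^k W _]; one more term than [n] leaves room for [g] when [n = 0]. *)
pose f' k := (if (k < n)%N then f k else 0) - (if k is 0 then g else 0).
have Mif k : M (if (k < n)%N then f k else 0).
  by case: ifP => // _; exact: subM.1.
have sum_f' : Wmap g - \sum_(k < n) vdelay k (Wmap (f k)) =
    - \sum_(k < n.+1) vdelay k (Wmap (f' k)).
  have -> : \sum_(k < n.+1) vdelay k (Wmap (f' k)) =
      \sum_(k < n.+1) vdelay k (Wmap (if (k < n)%N then f k else 0))
      - \sum_(k < n.+1) vdelay k (Wmap (if (k : nat) is 0 then g else 0)).
    by rewrite -sumrB; apply: eq_bigr => k _; rewrite !linearB.
  rewrite [X in _ = - (X - _)]big_ord_recr /= ltnn !linear0 addr0.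
  rewrite [X in _ = - (_ - X)]big_ord_recl /= vdelay0.
  rewrite [X in _ = - (_ - (_ + X))]big1 ?addr0; last by move=> k _; rewrite !linear0.
  by rewrite opprB; congr (_ - _); apply: eq_bigr => k _; rewrite ltn_ord.
pose y := (if (0 < n)%N then f 0%N else 0)
  + \sum_(k < n) last_comp (iter k.+1 U (Wmap (f' k.+1))).
exists y.
  apply: linsubD => //; apply: linsub_sum => // k _; apply: last_orbit.
  by rewrite /f' subr0.
move: lt; rewrite sum_f' nrmN => lt.
have {lt} : nrm vip (\sum_(k < n.+1) iter k U (Wmap (f' k))) < e.
  by rewrite /nrm -gram_nsq.
apply: le_lt_trans.
apply: le_trans (vec_nrm_ge _ _ (rshift p ord0)).
rewrite nrmC le_eqVlt; apply/orP; left; apply/eqP; congr nrm.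
rewrite sum_ffunE big_ord_recl /= /Wmap stack_r /f' /y addrAC; congr (_ + _).
Qed.

Lemma model_delay X : model_space X -> model_space (vdelay 1 X).
Proof.
move=> h e /h[_ [n [g [Mg ->]] lt]].
exists (vdelay 1 (\sum_(k < n) vdelay k (Wmap (g k)))).
  exists n.+1, (fun k => if k is l.+1 then g l else 0); split.
    by case=> [|k] //; exact: subM.1.
  rewrite big_ord_recl !linear0 add0r linear_sum; apply: eq_bigr => k _ /=.
  by rewrite vdelay_add.
by rewrite -linearB vdelay_nrm.
Qed.
End Model.

(** * Square-integrable functions on the circle *)
Section CircleIntegral.
Variable R : realType.
Local Notation mu := (@lebesgue_measure R).
Local Notation D := (@angles R).
Implicit Types (f g : R -> R) (h k : R -> R[i]).

Lemma twopi_gt0 : 0 < 2 * pi :> R.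
Proof. by rewrite mulr_gt0 // pi_gt0. Qed.

Lemma measurable_angles : measurable (D : set (measurableTypeR R)).
Proof. exact: measurable_itv. Qed.
Local Notation mD := measurable_angles.

Lemma measure_angles : mu D = (2 * pi)%:E.
Proof.
rewrite /angles lebesgue_measure_itv /= lte_fin twopi_gt0.
by rewrite oppr0 adde0.
Qed.

Lemma ae_mono (P Q : R -> Prop) :
  {ae mu, forall t, P t} -> (forall t, P t -> Q t) -> {ae mu, forall t, Q t}.
Proof.
move=> [N [mN N0 sub]] h; exists N; split => //; apply: subset_trans sub.
by move=> t /= nQ Pt; apply: nQ; exact: h.
Qed.

Lemma ae_and (P Q : R -> Prop) : {ae mu, forall t, P t} -> {ae mu, forall t, Q t} ->
  {ae mu, forall t, P t /\ Q t}.
Proof.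
move=> [N [mN N0 sub]] [N' [mN' N0' sub']]; exists (N `|` N'); split.
- exact: measurableU.
- by rewrite null_set_setU.
move=> t /= nPQ; apply: contrapT => /not_orP[nN nN']; apply: nPQ; split; apply: contrapT.
  by move=> nP; apply: nN; exact: sub.
by move=> nQ; apply: nN'; exact: sub'.
Qed.

Lemma ae_neq (b : R) : {ae mu, forall t, t != b}.
Proof.
exists [set b]; split; [exact: measurable_set1|exact: lebesgue_measure_set1|].
by move=> t /= /negP; rewrite negbK => /eqP.
Qed.

(** The prefixes [r] and [c] stand for real-valued and complex-valued functions. *)
Definition rmeasurable f := measurable_fun (D : set (measurableTypeR R)) (f : measurableTypeR R -> R).
Definition rintegrable f := mu.-integrable D (EFin \o f).

Lemma rintegrable_rmeasurable f : rintegrable f -> rmeasurable f.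
Proof. by move=> /integrableP[/measurable_EFinP]. Qed.

Lemma rintegrable_le f g : rmeasurable f -> rintegrable g -> (forall t, D t -> `|f t| <= g t) -> rintegrable f.
Proof.
move=> mff igg h; apply: (le_integrable mD _ _ igg); first exact/measurable_EFinP.
by move=> t Dt /=; rewrite lee_fin (le_trans (h t Dt)) // ler_norm.
Qed.

Lemma rintegrableD f g : rintegrable f -> rintegrable g -> rintegrable (fun t => f t + g t).
Proof. by move=> h1 h2; have := integrableD mD h1 h2. Qed.
Lemma rintegrableB f g : rintegrable f -> rintegrable g -> rintegrable (fun t => f t - g t).
Proof. by move=> h1 h2; have := integrableB mD h1 h2. Qed.
Lemma rintegrableZ c f : rintegrable f -> rintegrable (fun t => c * f t).
Proof. by move=> h1; have := integrableZl mD c h1. Qed.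
Lemma rintegrable_cst c : rintegrable (fun=> c).
Proof.
apply/integrableP; split; first exact: measurable_cst.
rewrite integral_cst /= ?measure_angles; last exact: mD.
by rewrite -EFinM ltry.
Qed.

Local Notation rint f := (Rintegral mu D f).
Lemma rintD f g : rintegrable f -> rintegrable g -> rint (fun t => f t + g t) = rint f + rint g.
Proof. by move=> h1 h2; exact: RintegralD mD h1 h2. Qed.
Lemma rintB f g : rintegrable f -> rintegrable g -> rint (fun t => f t - g t) = rint f - rint g.
Proof. by move=> h1 h2; exact: RintegralB mD h1 h2. Qed.
Lemma rintZ c f : rintegrable f -> rint (fun t => c * f t) = c * rint f.
Proof. by move=> h1; exact: RintegralZl mD h1. Qed.
Lemma rint_cst c : rint (fun=> c) = c * (2 * pi).
Proof. rewrite Rintegral_cst; last exact: mD.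
by congr (_ * _); rewrite -[RHS]/(fine (2 * pi)%:E) -measure_angles. Qed.

Lemma eq_rint f g : (forall t, D t -> f t = g t) -> rint f = rint g.
Proof. by move=> h; apply: eq_Rintegral => t /set_mem; exact: h. Qed.

Lemma rint_ge0 f : (forall t, 0 <= f t) -> 0 <= rint f.
Proof. by move=> h; apply: Rintegral_ge0. Qed.

Lemma rint_le f g : rintegrable f -> rintegrable g -> (forall t, D t -> f t <= g t) -> rint f <= rint g.
Proof. by move=> h1 h2; exact: le_Rintegral mD h1 h2. Qed.

Lemma rint_EFin f : rintegrable f -> (\int[mu]_(t in D) (f t)%:E)%E = (rint f)%:E.
Proof. by move=> h; rewrite /Rintegral fineK //; exact: (integrable_fin_num mD h). Qed.

Definition cintegrable h :=
  rintegrable (fun t => complex.Re (h t)) /\ rintegrable (fun t => complex.Im (h t)).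

Lemma cintegrableD h k : cintegrable h -> cintegrable k -> cintegrable (fun t => h t + k t).
Proof.
move=> [h1 h2] [k1 k2]; split.
  by under [X in rintegrable X]eq_fun do rewrite cReD; exact: rintegrableD.
by under [X in rintegrable X]eq_fun do rewrite cImD; exact: rintegrableD.
Qed.

Lemma cintegrableZ c h : cintegrable h -> cintegrable (fun t => c * h t).
Proof.
move=> [h1 h2]; split.
  by under [X in rintegrable X]eq_fun do rewrite cReM; apply: rintegrableB; exact: rintegrableZ.
by under [X in rintegrable X]eq_fun do rewrite cImM; apply: rintegrableD; exact: rintegrableZ.
Qed.

Lemma cintegrableJ h : cintegrable h -> cintegrable (fun t => Num.conj (h t)).
Proof.
move=> [h1 h2]; split; first by under [X in rintegrable X]eq_fun do rewrite cReJ.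
under [X in rintegrable X]eq_fun do rewrite cImJ -mulN1r; exact: rintegrableZ.
Qed.

Lemma circle_intD h k : cintegrable h -> cintegrable k ->
  circle_int (fun t => h t + k t) = circle_int h + circle_int k.
Proof.
move=> [h1 h2] [k1 k2]; rewrite /circle_int -mulrDr; congr (_ * _).
apply: complex_ext => /=.
  by under eq_fun do rewrite cReD; exact: rintD.
by under eq_fun do rewrite cImD; exact: rintD.
Qed.

Lemma circle_intZ c h : cintegrable h -> circle_int (fun t => c * h t) = c * circle_int h.
Proof.
move=> [h1 h2]; rewrite /circle_int mulrCA; congr (_ * _).
apply: complex_ext; rewrite ?cReM ?cImM /=.
  by under eq_fun do rewrite cReM; rewrite rintB ?rintZ //; exact: rintegrableZ.
by under eq_fun do rewrite cImM; rewrite rintD ?rintZ //; exact: rintegrableZ.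
Qed.

Lemma circle_intJ h : cintegrable h ->
  circle_int (fun t => Num.conj (h t)) = Num.conj (circle_int h).
Proof.
move=> [h1 h2]; rewrite /circle_int [RHS]rmorphM /=; congr (_ * _).
  by rewrite conjE conjc_real.
apply: complex_ext => /=; first by under eq_fun do rewrite cReJ.
under eq_fun do rewrite cImJ -mulN1r.
by rewrite rintZ // mulN1r.
Qed.

Lemma eq_circle_int h k : (forall t, D t -> h t = k t) -> circle_int h = circle_int k.
Proof.
by move=> hk; rewrite /circle_int; congr (_ * (_ +i* _)); apply: eq_rint => t Dt; rewrite hk.
Qed.

Definition cmeasurable h :=
  rmeasurable (fun t => complex.Re (h t)) /\ rmeasurable (fun t => complex.Im (h t)).

Lemma cintegrable_le h g : cmeasurable h -> rintegrable g ->
  (forall t, D t -> Num.sqrt (sqmod (h t)) <= g t) -> cintegrable h.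
Proof.
move=> [m1 m2] igg le; split; apply: rintegrable_le igg _ => // t Dt; apply: le_trans (le t Dt).
  exact: Re_le_mod.
exact: Im_le_mod.
Qed.

Lemma cmeasurableD h k : cmeasurable h -> cmeasurable k -> cmeasurable (fun t => h t + k t).
Proof.
move=> [h1 h2] [k1 k2]; split.
  by under [X in rmeasurable X]eq_fun do rewrite cReD; exact: measurable_funD.
by under [X in rmeasurable X]eq_fun do rewrite cImD; exact: measurable_funD.
Qed.

Lemma cmeasurableM h k : cmeasurable h -> cmeasurable k -> cmeasurable (fun t => h t * k t).
Proof.
move=> [h1 h2] [k1 k2]; split.
  under [X in rmeasurable X]eq_fun do rewrite cReM.
  by apply: measurable_funB; exact: measurable_funM.
under [X in rmeasurable X]eq_fun do rewrite cImM.
by apply: measurable_funD; exact: measurable_funM.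
Qed.

Lemma cmeasurableJ h : cmeasurable h -> cmeasurable (fun t => Num.conj (h t)).
Proof.
move=> [h1 h2]; split; first by under [X in rmeasurable X]eq_fun do rewrite cReJ.
by under [X in rmeasurable X]eq_fun do rewrite cImJ; exact: measurableT_comp.
Qed.

Lemma cmeasurable_cst c : cmeasurable (fun=> c).
Proof. by split; exact: measurable_cst. Qed.

Lemma cmeasurable_cis : cmeasurable (@cis R).
Proof.
split; apply: measurable_funTS; apply: continuous_measurable_fun.
  exact: continuous_cos.
exact: continuous_sin.
Qed.

Lemma cmeasurable_sqmod h : cmeasurable h -> rmeasurable (fun t => sqmod (h t)).
Proof.
by move=> [h1 h2]; apply: measurable_funD; exact: measurable_funX.
Qed.

Lemma L2circleP h : L2circle h <-> cmeasurable h /\ rintegrable (fun t => sqmod (h t)).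
Proof.
split=> [[h1 h2 h3]|[[h1 h2] h3]].
  split=> //; apply/integrableP; split.
    by apply/measurable_EFinP; exact: cmeasurable_sqmod.
  by under eq_integral do rewrite /= ger0_norm ?sqmod_ge0 //.
split=> //; have := integrable_lty mD h3; by [].
Qed.

Definition L2pred : {pred R -> R[i]^o} := fun h => `[< L2circle (h : R -> R[i]) >].

Lemma L2pred_submod : submod_closed L2pred.
Proof.
split.
  apply/asboolP/L2circleP; split; first exact: cmeasurable_cst.
  by under [X in rintegrable X]eq_fun do rewrite sqmod0; exact: rintegrable_cst.
move=> c h k /asboolP/L2circleP[mh ih] /asboolP/L2circleP[mk ik].
have m : cmeasurable (fun t => c * (h t : R[i]) + (k t : R[i])).
  by apply: cmeasurableD => //; apply: cmeasurableM => //; exact: cmeasurable_cst.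
apply/asboolP/L2circleP; split; first exact: m.
apply: (rintegrable_le (cmeasurable_sqmod m) (rintegrableZ 2 (rintegrableD (rintegrableZ (sqmod c) ih) ik))) => t _.
rewrite ger0_norm ?sqmod_ge0 // -sqmodM; exact: sqmodD_le.
Qed.

HB.instance Definition _ := GRing.isSubmodClosed.Build _ _ L2pred L2pred_submod.
(** Functions and not almost-everywhere classes, so that values at points make
    sense. *)
Record L2c := MkL2c { L2fun :> R -> R[i]^o; L2funP : L2fun \in L2pred }.
Arguments L2fun : simpl never.
HB.instance Definition _ := [isSub for L2fun].
HB.instance Definition _ := [Choice of L2c by <:].
HB.instance Definition _ := [SubChoice_isSubLmodule of L2c by <:].

Implicit Types (x y z : L2c).
Lemma L2D x y t : (x + y) t = (x t : R[i]) + (y t : R[i]) :> R[i]. Proof. by []. Qed.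
Lemma L2Z c x t : (c *: x) t = c * (x t : R[i]) :> R[i]. Proof. by []. Qed.
Lemma L2N x t : (- x) t = - (x t : R[i]) :> R[i]. Proof. by []. Qed.
Lemma L2_sum I (r : seq I) (P : pred I) (F : I -> L2c) t :
  (\sum_(i <- r | P i) F i) t = \sum_(i <- r | P i) (F i t : R[i]) :> R[i].
Proof. by elim/big_rec2: _ => // i u v _ <-. Qed.

Lemma L2mem x : L2circle (x : R -> R[i]).
Proof. exact/asboolP/L2funP. Qed.
Lemma L2_cmeasurable x : cmeasurable (x : R -> R[i]). Proof. by have /L2circleP[] := L2mem x. Qed.
Lemma L2_rintegrable x : rintegrable (fun t => sqmod (x t : R[i])). Proof. by have /L2circleP[] := L2mem x. Qed.

Definition mkL2 h (H : L2circle h) : L2c := @MkL2c (h : R -> R[i]^o) (introT (asboolP _) H).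
Lemma mkL2E h (H : L2circle h) t : mkL2 H t = h t. Proof. by []. Qed.

Lemma L2_cintegrable x y : cintegrable (fun t => (x t : R[i]) * Num.conj (y t : R[i])).
Proof.
apply: (cintegrable_le _ (rintegrableD (L2_rintegrable x) (L2_rintegrable y))).
  by apply: cmeasurableM; [exact: L2_cmeasurable|apply: cmeasurableJ; exact: L2_cmeasurable].
move=> t _; by rewrite sqmodM sqmodJ; apply: sqrt_mul_le; exact: sqmod_ge0.
Qed.

Lemma L2ip_linl c x y z : L2ip (c *: x + y : L2c) z = c * L2ip x z + L2ip y z.
Proof.
rewrite /L2ip -circle_intZ; last exact: L2_cintegrable.
rewrite -circle_intD; [|apply: cintegrableZ; exact: L2_cintegrable|exact: L2_cintegrable].
by apply: eq_circle_int => t _; rewrite L2D L2Z mulrDl mulrA.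
Qed.

Lemma L2ip_conj x y : L2ip y x = Num.conj (L2ip x y).
Proof.
rewrite /L2ip -circle_intJ; last exact: L2_cintegrable.
by apply: eq_circle_int => t _; rewrite rmorphM /= !conjE conjcK mulrC.
Qed.

Lemma L2ip_self x : L2ip x x = ((2 * pi)^-1 * rint (fun t => sqmod (x t : R[i])))%:C.
Proof.
rewrite /L2ip /circle_int [RHS]rmorphM /=; congr (_ * _).
apply: complex_ext => /=; first by apply: eq_rint => t _; rewrite mulCJ.
rewrite -[RHS](mul0r (2 * pi)) -rint_cst.
by apply: eq_rint => t _; rewrite mulCJ.
Qed.

Lemma L2ip_pos x : 0 <= L2ip x x.
Proof.
rewrite L2ip_self -[0]/((0 : R)%:C) lecR mulr_ge0 ?invr_ge0 ?(ltW twopi_gt0) //.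
by apply: rint_ge0 => t; exact: sqmod_ge0.
Qed.

Definition L2sip : semi_ip L2c :=
  @SemiIp R L2c (fun x y => L2ip x y) L2ip_linl L2ip_conj L2ip_pos.
Arguments L2sip : simpl never.

Lemma L2sipE x y : L2sip x y = L2ip x y. Proof. by []. Qed.

Lemma L2_nsq x : rint (fun t => sqmod (x t : R[i])) = 2 * pi * nsq L2sip x.
Proof.
by rewrite /nsq L2sipE L2ip_self /= mulrA divff ?gt_eqF ?twopi_gt0 // mul1r.
Qed.

Lemma L2_nsq_EFin x :
  (\int[mu]_(t in D) (sqmod (x t : R[i]))%:E)%E = (2 * pi * nsq L2sip x)%:E.
Proof. by rewrite -L2_nsq rint_EFin //; exact: L2_rintegrable. Qed.
Lemma sqmod_cis t : sqmod (cis t : R[i]) = 1.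
Proof. by rewrite /sqmod /= cos2Dsin2. Qed.

Lemma cmeasurableX h n : cmeasurable h -> cmeasurable (fun t => h t ^+ n).
Proof.
move=> mh; elim: n => [|n IH].
  by under [X in cmeasurable X]eq_fun do rewrite expr0; exact: cmeasurable_cst.
by under [X in cmeasurable X]eq_fun do rewrite exprS; exact: cmeasurableM.
Qed.

Lemma L2_expo n : L2circle (fun t => cis t ^+ n : R[i]).
Proof.
apply/L2circleP; split; first by apply: cmeasurableX; exact: cmeasurable_cis.
by under [X in rintegrable X]eq_fun do rewrite sqmodX sqmod_cis expr1n; exact: rintegrable_cst.
Qed.

Definition expo n : L2c := mkL2 (L2_expo n).
Lemma expoE n t : expo n t = cis t ^+ n :> R[i]. Proof. by []. Qed.

Lemma cisX t n : cis t ^+ n = cis (n%:R * t) :> R[i].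
Proof.
elim: n => [|n IH].
  by rewrite expr0 mul0r /cis cos0 sin0.
rewrite exprS IH; apply: complex_ext; rewrite ?cReM ?cImM /=.
  by rewrite -cosD -natr1 mulrDl mul1r addrC.
by rewrite addrC -sinD -natr1 mulrDl mul1r addrC.
Qed.

Lemma cintegrable_expo n : cintegrable (fun t => cis t ^+ n : R[i]).
Proof.
apply: (cintegrable_le _ (rintegrable_cst 1)); first by apply: cmeasurableX; exact: cmeasurable_cis.
by move=> t _; rewrite sqmodX sqmod_cis expr1n sqrtr1.
Qed.

Lemma is_derive_sin_scale (c t : R) :
  is_derive t 1 (fun x : R => sin (c * x)) (c * cos (c * t)).
Proof.
have h : is_derive t 1 (fun x : R => c * x) c.
  by apply: is_derive_eq; rewrite /GRing.scale /= mulr1 ?mulr0 ?addr0.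
have := @is_derive1_comp _ sin (fun x : R => c * x) t _ _ (is_derive_sin (c * t)) h.
by rewrite mulrC.
Qed.

Lemma is_derive_cos_scale (c t : R) :
  is_derive t 1 (fun x : R => cos (c * x)) (- (c * sin (c * t))).
Proof.
have h : is_derive t 1 (fun x : R => c * x) c.
  by apply: is_derive_eq; rewrite /GRing.scale /= mulr1 ?mulr0 ?addr0.
have := @is_derive1_comp _ cos (fun x : R => c * x) t _ _ (is_derive_cos (c * t)) h.
by rewrite mulrC mulrN.
Qed.

Lemma cont_scale (F : R -> R) c : continuous F -> continuous (fun x : R => F (c * x)).
Proof.
move=> cF x; apply: continuous_comp; last exact: cF.
exact: mulrl_continuous.
Qed.

Lemma rint_FTC (F f : R -> R) : continuous F -> continuous f ->
  (forall t : R, is_derive t 1 F (f t)) -> rint f = F (2 * pi) - F 0.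
Proof.
move=> cF cf dF; rewrite /Rintegral /angles.
rewrite (@continuous_FTC2 _ _ F) ?twopi_gt0 //.
- exact: continuous_subspaceT.
- split; first by move=> x _; have [] := dF x.
    by apply: cvg_at_right_filter; exact: cF.
  by apply: cvg_at_left_filter; exact: cF.
- by move=> x _; rewrite derive1E; have [_ ->] := dF x.
Qed.

Lemma cis_2pi_nat n : cis (n%:R * (2 * pi)) = 1 :> R[i].
Proof.
rewrite -cisX (_ : cis (2 * pi) = 1) ?expr1n // /cis.
by rewrite mulr_natl cos2pi sin2pi.
Qed.

Lemma circle_int_expo n : circle_int (fun t => cis t ^+ n : R[i]) = (n == 0%N)%:R.
Proof.
case: n => [|n] /=.
  rewrite (@eq_circle_int _ (fun=> 1)); last by move=> t _; rewrite expr0.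
  rewrite /circle_int !rint_cst mul1r mul0r.
  rewrite -[_ +i* 0]/((2 * pi)%:C) -rmorphM /= mulVf ?gt_eqF ?twopi_gt0 //.
have c0 : (n.+1%:R : R) != 0 by rewrite pnatr_eq0.
have [hc hs] : cos (n.+1%:R * (2 * pi)) = 1 :> R /\ sin (n.+1%:R * (2 * pi)) = 0 :> R.
  by have := cis_2pi_nat n.+1; case.
rewrite /circle_int -[RHS](mulr0 ((2 * pi)^-1)%:C); congr (_ * _).
apply: complex_ext => /=; under eq_fun do rewrite cisX /=.
  have := @rint_FTC (fun t : R => sin (n.+1%:R * t)) (fun t : R => n.+1%:R * cos (n.+1%:R * t)).
  rewrite rintZ; last first.
    by have [] := cintegrable_expo n.+1; under eq_fun do rewrite cisX /=.
  rewrite hs mulr0 sin0 subr0 => h.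
  apply: (mulfI c0); rewrite mulr0; apply: h.
  - exact: (@cont_scale sin n.+1%:R (@continuous_sin R)).
  - move=> x; apply: cvgMl_tmp; exact: (@cont_scale cos n.+1%:R (@continuous_cos R)).
  - by move=> t; exact: is_derive_sin_scale.
have := @rint_FTC (fun t : R => cos (n.+1%:R * t)) (fun t : R => - n.+1%:R * sin (n.+1%:R * t)).
rewrite rintZ; last first.
  by have [_] := cintegrable_expo n.+1; under eq_fun do rewrite cisX /=.
rewrite hc mulr0 cos0 subrr => h.
have c1 : - n.+1%:R != 0 :> R by rewrite oppr_eq0.
apply: (mulfI c1); rewrite mulr0; apply: h.
- exact: (@cont_scale cos n.+1%:R (@continuous_cos R)).
- move=> x; apply: cvgMl_tmp; exact: (@cont_scale sin n.+1%:R (@continuous_sin R)).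
- by move=> t; rewrite mulNr; exact: is_derive_cos_scale.
Qed.

Lemma expo_orthonormal n m : L2sip (expo n) (expo m) = (n == m)%:R.
Proof.
have key a b : L2ip (expo (a + b)) (expo b) = (a == 0%N)%:R.
  rewrite -circle_int_expo; apply: eq_circle_int => t _.
  by rewrite !expoE exprD -mulrA rmorphXn /= -exprMn mulCJ sqmod_cis expr1n mulr1.
have [nm|mn] := leqP m n.
  rewrite -(subnK nm) L2sipE key; congr (_%:R); congr nat_of_bool.
  by apply/eqP/eqP; lia.
rewrite ip_conj -(subnK (ltnW mn)) L2sipE key.
rewrite (_ : (_ == _)%N = false) ?rmorph0; last by apply/eqP; lia.
by rewrite (_ : (_ == _)%N = false) //; apply/eqP; lia.
Qed.

Lemma ccvg_sqmod (u : nat -> R[i]) (l : R[i]) :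
  ccvg u l -> (fun n => sqmod (u n)) @ \oo --> sqmod l.
Proof. by move=> [hr hi]; apply: cvgD; apply: cvgM. Qed.

Lemma einf_ge (u : nat -> \bar R) b : (forall n, b <= u n)%E -> (b <= limn_einf u)%E.
Proof.
move=> h; rewrite limn_einf_lim; apply: lime_ge; first exact: is_cvg_einfs.
by apply: nearW => n; apply: le_ereal_inf_tmp => _ [k _ <-]; exact: h.
Qed.

Lemma einf_le (u : nat -> \bar R) b : (forall n, u n <= b)%E -> (limn_einf u <= b)%E.
Proof.
move=> h; rewrite limn_einf_lim; apply: lime_le; first exact: is_cvg_einfs.
apply: nearW => n; apply: le_trans (h n).
by apply: ereal_inf_lbound; exists n => /=.
Qed.

Lemma measurable_einf (f : nat -> R -> \bar R) :
  (forall n, measurable_fun (D : set (measurableTypeR R)) (f n)) ->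
  measurable_fun (D : set (measurableTypeR R)) (fun t => limn_einf (f ^~ t)).
Proof.
move=> mf0.
rewrite (_ : (fun t => _) = (fun t => - limn_esup (fun n => - f n t))%E).
  apply: measurableT_comp => //; apply: measurable_fun_limn_esup => n.
  exact: measurableT_comp.
apply/funext => t; rewrite -limn_einfN; congr limn_einf.
by apply/funext => n /=; rewrite oppeK.
Qed.
(** Fatou's lemma for the squared moduli; the almost everywhere limit [l] is
    square integrable as soon as the norms stay bounded. *)
Lemma L2_fatou (v : nat -> L2c) (l : R -> R[i]) B : cmeasurable l ->
  {ae mu, forall t, D t -> ccvg (fun n => v n t) (l t)} ->
  (forall n, nsq L2sip (v n) <= B) ->
  exists H : L2circle l, nsq L2sip (mkL2 H) <= B.
Proof.
move=> ml cv bd.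
have le : (\int[mu]_(t in D) (sqmod (l t))%:E <= (2 * pi * B)%:E)%E.
  apply: (@le_trans _ _ (\int[mu]_(t in D) limn_einf (fun n => (sqmod (v n t : R[i]))%:E))%E).
    apply: ae_ge0_le_integral.
    - exact: mD.
    - by move=> t _; rewrite lee_fin sqmod_ge0.
    - by apply/measurable_EFinP; exact: cmeasurable_sqmod.
    - by move=> t _; apply: einf_ge => n; rewrite lee_fin sqmod_ge0.
    - apply: measurable_einf => n.
      by apply/measurable_EFinP; apply: cmeasurable_sqmod; exact: L2_cmeasurable.
    apply: (ae_mono cv).
    move=> t h Dt; have h' := ccvg_sqmod (h Dt).
    have h2 : (fun n => (sqmod (v n t : R[i]))%:E) @ \oo --> (sqmod (l t))%:E.
      by apply: cvg_EFin => //; exact: nearW.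
    by have [-> _] := cvg_limn_einf_sup h2.
  apply: le_trans (fatou _ _ _ _) _.
  - exact: mD.
  - by move=> n; apply/measurable_EFinP; apply: cmeasurable_sqmod; exact: L2_cmeasurable.
  - by move=> n t _; rewrite lee_fin sqmod_ge0.
  apply: einf_le => n; rewrite L2_nsq_EFin lee_fin ler_pM2l ?twopi_gt0 //.
have H : L2circle l.
  have [m1 m2] := ml; split => //.
  by apply: le_lt_trans le _; rewrite ltry.
exists H; have := L2_nsq_EFin (mkL2 H).
rewrite (_ : (\int[mu]_(t in D) (sqmod (mkL2 H t : R[i]))%:E)%E =
  (\int[mu]_(t in D) (sqmod (l t))%:E)%E) // => e.
by move: le; rewrite e lee_fin ler_pM2l // twopi_gt0.
Qed.

End CircleIntegral.
Arguments L2fun : simpl never.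
Arguments L2sip : simpl never.

(** * The Riesz-Fischer theorem *)
Section RieszFischer.
Variable R : realType.
Local Notation mu := (@lebesgue_measure R).
Local Notation D := (@angles R).
Local Notation mD := (@measurable_angles R).
Local Notation rint f := (Rintegral mu D f).
Local Notation L2c := (L2c R).
Local Notation L2sip := (L2sip R).

Lemma cmeasurable_limit (h : nat -> R -> R[i]) (l : R -> R[i]) : (forall n, cmeasurable (h n)) ->
  (forall t, D t -> ccvg (fun n => h n t) (l t)) -> cmeasurable l.
Proof.
move=> mh hl; split.
  apply: (@measurable_fun_cvg _ _ _ _ (fun n t => complex.Re (h n t))).
    by move=> n; have [] := mh n.
  by move=> t Dt; have [] := hl t Dt.
apply: (@measurable_fun_cvg _ _ _ _ (fun n t => complex.Im (h n t))).
  by move=> n; have [] := mh n.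
by move=> t Dt; have [] := hl t Dt.
Qed.

(** The inequality [a <= a ^+ 2 / q + q] with [q = 2^-k] turns the geometric decay
    of the norms into geometric decay of the integrals of the increments. So the
    total variation of the sequence has a finite integral. *)
Lemma ae_bounded_variation (w : nat -> L2c) :
  (forall k : nat, nrm L2sip (w k.+1 - w k) <= 2^-1 ^+ k) ->
  {ae mu, forall t, D t -> exists B, forall n,
     \sum_(k < n) Num.sqrt (sqmod ((w k.+1 t : R[i]) - w k t)) <= B}.
Proof.
move=> hw; pose g (k : nat) t := Num.sqrt (sqmod ((w k.+1 t : R[i]) - w k t)).
have g0 k t : 0 <= g k t by exact: sqrtr_ge0.
have q0 (k : nat) : 0 < 2^-1 ^+ k :> R by rewrite exprn_gt0 // invr_gt0.
pose b (k : nat) t := (2^-1 ^+ k)^-1 * sqmod ((w k.+1 - w k) t : R[i]) + 2^-1 ^+ k.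
have gb k t : g k t <= b k t.
  have := sqr_ge0 (g k t / 2^-1 ^+ k - 1).
  rewrite /b; have -> : sqmod ((w k.+1 - w k) t : R[i]) = g k t ^+ 2.
    by rewrite sqr_sqrtr ?sqmod_ge0 // L2D L2N.
  move: (q0 k) (g0 k t); move: (g k t) (2^-1 ^+ k) => a q qp a0 h.
  have : 0 <= q * (a / q - 1) ^+ 2 + a by rewrite addr_ge0 // mulr_ge0 // ltW.
  suff -> : q * (a / q - 1) ^+ 2 + a = q^-1 * a ^+ 2 + q - a by rewrite subr_ge0.
  by field; rewrite gt_eqF.
have igb k : rintegrable (b k) by apply: rintegrableD; [apply: rintegrableZ; exact: L2_rintegrable|exact: rintegrable_cst].
have mg k : rmeasurable (g k).
  have := cmeasurable_sqmod (L2_cmeasurable (w k.+1 - w k)).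
  move=> h; have := measurableT_comp (continuous_measurable_fun (@sqrt_continuous R)) h.
  by under eq_fun do rewrite L2D L2N.
have igg k : rintegrable (g k).
  by apply: rintegrable_le (mg k) (igb k) _ => t _; rewrite ger0_norm.
have rint_bound k : rint (g k) <= 4 * pi * 2^-1 ^+ k.
  apply: le_trans (rint_le (igg k) (igb k) (fun t _ => gb k t)) _.
  rewrite rintD ?rintZ ?rint_cst ?L2_nsq; try exact: rintegrable_cst; try exact: L2_rintegrable; last first.
    by apply: rintegrableZ; exact: L2_rintegrable.
  have := hw k; rewrite nrm_le; last exact: ltW.
  move: (nsq _ _) (q0 k); move: (2^-1 ^+ k) => q s qp sq.
  have : q^-1 * s <= q by rewrite mulrC ler_pdivrMr // -expr2.
  have p0 := @twopi_gt0 R.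
  rewrite -(ler_pM2l p0) => h.
  have -> : 4 * pi * q = 2 * pi * q + q * (2 * pi) :> R by ring.
  by rewrite lerD2r mulrCA.
have fin : (\int[mu]_(t in D) \sum_(k <oo) (g k t)%:E < +oo)%E.
  rewrite integral_nneseries; first last.
  - by move=> n t _; rewrite lee_fin.
  - by move=> n; apply/measurable_EFinP; exact: mg.
  - exact: mD.
  apply: (@le_lt_trans _ _ (8 * pi)%:E); last by rewrite ltry.
  apply: lime_le; first by apply: is_cvg_nneseries => k _ _;
    apply: integral_ge0 => t _; rewrite lee_fin.
  apply: nearW => n; under eq_bigr do rewrite rint_EFin //.
  rewrite sumEFin lee_fin.
  apply: (@le_trans _ _ (\sum_(0 <= k < n) 4 * pi * 2^-1 ^+ k)).
    by apply: ler_sum => k _; exact: rint_bound.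
  rewrite -mulr_sumr big_mkord.
  have := @geo_bounded R 2^-1 ltac:(by rewrite invr_ge0) ltac:(by rewrite invf_lt1 // ltr1n) n.
  have p0 : 0 < 4 * pi :> R by rewrite mulr_gt0 // pi_gt0.
  have -> : (1 - 2^-1)^-1 = 2 :> R by field.
  by move=> /(ler_wpM2l (ltW p0)) h; apply: le_trans h _; lra.
have int : mu.-integrable D (fun t => \sum_(k <oo) (g k t)%:E)%E.
  apply/integrableP; split.
    apply: ge0_emeasurable_sum => [k t _ _|k _]; first by rewrite lee_fin.
    by apply/measurable_EFinP; exact: mg.
  apply: le_lt_trans fin; rewrite le_eqVlt; apply/orP; left; apply/eqP.
  apply: eq_integral => t _.
  by rewrite gee0_abs // nneseries_ge0 // => k _ _; rewrite lee_fin.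
apply: (ae_mono (integrable_ae mD int)).
move=> t h Dt; have := h Dt; move=> /fineK e; exists (fine (\sum_(k <oo) (g k t)%:E)) => n.
rewrite -lee_fin e -sumEFin -(big_mkord xpredT (fun k => (g k t)%:E)).
by apply: nneseries_lim_ge => k _; rewrite lee_fin.
Qed.

Lemma bounded_variation_cvg (u : nat -> R[i]) B :
  (forall n, \sum_(k < n) Num.sqrt (sqmod (u k.+1 - u k)) <= B) -> exists l, ccvg u l.
Proof.
move=> hB.
have key (F : R[i] -> R) : (forall z, `|F z| <= Num.sqrt (sqmod z)) ->
    (forall z w, F (z - w) = F z - F w) -> exists l : R, (fun n => F (u n)) @ \oo --> l.
  move=> hF FB.
  have c1 : cvgn (series (fun k => F (u k.+1) - F (u k))).
    apply: normed_cvg; apply: nondecreasing_is_cvgn.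
      by apply: nondecreasing_series => n _ _; exact: normr_ge0.
    exists B => _ [n _ <-]; rewrite /= seriesEord /=.
    apply: le_trans (hB n); apply: ler_sum => k _; rewrite -FB; exact: hF.
  have e : (fun n => F (u n)) = (fun n => F (u 0%N) + series (fun k => F (u k.+1) - F (u k)) n).
    by apply/funext => n; rewrite /series /= telescope_sumr // addrC subrK.
  exists (F (u 0%N) + limn (series (fun k => F (u k.+1) - F (u k)))); rewrite e.
  by apply: cvgD => //; exact: cvg_cst.
have [r hr] := key _ (@Re_le_mod R) (fun z w => etrans (cReD _ _) (congr1 _ (cReN w))).
have [s hs] := key _ (@Im_le_mod R) (fun z w => etrans (cImD _ _) (congr1 _ (cImN w))).
by exists (r +i* s).
Qed.

(** Upper limits of the real and imaginary parts provide a measurable limit. *)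
Lemma ae_limit (w : nat -> L2c) :
  {ae mu, forall t, D t -> exists l, ccvg (fun n => w n t) l} ->
  exists2 l : R -> R[i], cmeasurable l & {ae mu, forall t, D t -> ccvg (fun n => w n t) (l t)}.
Proof.
move=> h.
pose F (f : R[i] -> R) t := fine (limn_esup (fun n => (f (w n t))%:E)).
have mF f : (forall n, rmeasurable (fun t => f (w n t))) -> rmeasurable (F f).
  move=> m; apply: measurableT_comp; first exact: fine_measurable.
  by apply: measurable_fun_limn_esup => n; apply/measurable_EFinP; exact: m.
exists (fun t => F (@complex.Re R) t +i* F (@complex.Im R) t).
  by split; apply: mF => n; have [] := L2_cmeasurable (w n).
apply: (ae_mono h).
move=> t ht Dt; have [l [hr hi]] := ht Dt.
have FE (f : R[i] -> R) : (fun n => f (w n t)) @ \oo --> f l -> F f t = f l.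
  move=> hf; rewrite /F.
  have h2 : (fun n => (f (w n t))%:E) @ \oo --> (f l)%:E.
    by apply: cvg_EFin => //; exact: nearW.
  by have [_ ->] := cvg_limn_einf_sup h2.
by split; rewrite /= FE.
Qed.

(** Riesz-Fischer: a subsequence with geometrically small increments converges
    almost everywhere, and by Fatou's lemma the distance from its terms to the limit
    is what the Cauchy condition predicts. *)
Theorem L2_complete : ip_complete L2sip.
Proof.
move=> u cu.
have q0 (k : nat) : 0 < 2^-1 ^+ k :> R by rewrite exprn_gt0 // invr_gt0.
have [N hN] := choice (fun k => cu _ (q0 k)).
(* Ranks of the subsequence, made nondecreasing. *)
pose M k := (\max_(j < k.+1) N j)%N.
have NM k : (N k <= M k)%N by apply: (@leq_bigmax _ (fun j : 'I_k.+1 => N j) ord_max).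
have MM k l : (k <= l)%N -> (M k <= M l)%N.
  move=> kl; apply/bigmax_leqP => i _.
  by apply: (@leq_bigmax _ (fun j : 'I_l.+1 => N j) (widen_ord _ i)).
pose w k := u (M k).
have wc : {ae mu, forall t, D t -> exists l, ccvg (fun n => w n t) l}.
  have := @ae_bounded_variation w _.
  have hw k : nrm L2sip (w k.+1 - w k) <= 2^-1 ^+ k.
    by apply/ltW; apply: hN => //; apply: leq_trans (NM k) (MM _ _ _).
  move=> /(_ hw) /ae_mono; apply.
  by move=> t h Dt; have [B hB] := h Dt; exact: bounded_variation_cvg hB.
have [l ml wl] := ae_limit wc.
have key k n : (N k <= n)%N ->
    exists H : L2circle (fun t => l t - (u n t : R[i])), nrm L2sip (mkL2 H) <= 2^-1 ^+ k.
  move=> kn.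
  have ml' : cmeasurable (fun t => l t - (u n t : R[i])).
    by apply: cmeasurableD => //; exact: (L2_cmeasurable (- u n)).
  have [|j|H bH] := @L2_fatou _ (fun j => w (j + k)%N - u n) _ ((2^-1 ^+ k) ^+ 2) ml'.
  - apply: (ae_mono wl).
    move=> t h Dt; have [hr hi] := ccvgD (h Dt) (ccvg_cst (- (u n t : R[i]))).
    by split; [move: hr|move: hi]; rewrite -(cvg_shiftn k).
  - rewrite -nrm_le; last exact: ltW.
    apply/ltW; apply: hN => //; apply: leq_trans (NM k) _.
    by apply: MM; exact: leq_addl.
  by exists H; rewrite nrm_le // ltW.
have [H0 _] := key 0%N (N 0%N) (leqnn _).
exists (mkL2 H0 + u (N 0%N)) => e e0.
have [k hk] : exists k, 2^-1 ^+ k < e.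
  have : (fun k => 2^-1 ^+ k : R) @ \oo --> (0 : R).
    by apply: cvg_expr; rewrite ger0_norm ?invr_ge0 // invf_lt1 // ltr1n.
  move=> /cvgrPdist_lt /(_ e e0) [k _ /(_ k (leqnn k))].
  by rewrite /= sub0r normrN ger0_norm ?(ltW (q0 k)) // => h; exists k.
exists (N k) => n kn; have [H bH] := key k n kn.
apply: le_lt_trans hk; apply: le_trans bH.
rewrite nrmC le_eqVlt; apply/orP; left; apply/eqP; congr nrm.
by apply: val_inj; apply/funext => t; rewrite /= !L2D mkL2E subrK.
Qed.
End RieszFischer.

(** * Boundary values of power series *)
Section Trace.
Variable R : realType.
Local Notation mu := (@lebesgue_measure R).
Local Notation D := (@angles R).
Local Notation L2c := (L2c R).
Local Notation L2sip := (L2sip R).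
Local Notation ell2 := (ell2 R).
Local Notation ip := (ell2_ip R).
Implicit Types (a b : ell2) (x y : L2c).

(** The boundary values of the [N]-th partial sum of the power series [a]. *)
Definition fourier_sum N a : L2c := \sum_(n < N) (a n : R[i]) *: expo R n.

Lemma fourier_sum_nsq N a : nsq L2sip (fourier_sum N a) = \sum_(n < N) sqmod (a n : R[i]).
Proof. by apply: nsq_orthonormal => i j; rewrite expo_orthonormal. Qed.

Lemma fourier_sum_is_linear N : linear (fourier_sum N).
Proof.
move=> c a b; rewrite /fourier_sum scaler_sumr -big_split; apply: eq_bigr => n _.
by rewrite ell2D ell2Z scalerDl scalerA.
Qed.
HB.instance Definition _ N := GRing.isLinear.Build _ _ _ _ (fourier_sum N) (fourier_sum_is_linear N).

Lemma fourier_sum_trunc M N a : (N <= M)%N -> fourier_sum M (trunc N a) = fourier_sum N a.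
Proof.
move=> NM; rewrite /fourier_sum (big_ord_widen _ (fun n : nat => (a n : R[i]) *: expo R n) NM).
rewrite [RHS]big_mkcond; apply: eq_bigr => n _; rewrite coef_trunc.
by case: ifP => // _; rewrite scale0r.
Qed.

Lemma fourier_sum_nrm_le N a : nrm L2sip (fourier_sum N a) <= nrm ip a.
Proof. by rewrite /nrm ler_sqrt ?nsq_ge0 // fourier_sum_nsq; exact: ell2_partial_le. Qed.

Lemma fourier_sum_sub M N a : (N <= M)%N ->
  nrm L2sip (fourier_sum M a - fourier_sum N a) <= nrm ip (a - trunc N a).
Proof. by move=> NM; rewrite -(fourier_sum_trunc a NM) -linearB; exact: fourier_sum_nrm_le. Qed.

(** [x] is, up to almost everywhere equality, the sum of the Fourier series with
    coefficients [a]. *)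
Definition trace a x := tends L2sip (fun N => fourier_sum N a) x.

(** [fourier_sum] is isometric on truncated sequences, and [L2_complete]
    applies. *)
Lemma trace_exists a : exists x, trace a x.
Proof.
apply: (@L2_complete R) => e e0.
have [N hN] := @trunc_tends _ a (e / 2) ltac:(by rewrite divr_gt0).
have key m : (N <= m)%N -> nrm L2sip (fourier_sum m a - fourier_sum N a) < e / 2.
  move=> Nm; apply: le_lt_trans (fourier_sum_sub _ Nm) _.
  by rewrite nrmC; exact: hN.
exists N => m n Nm Nn; apply: le_lt_trans (nrmB _ _ (fourier_sum N a) _) _.
by rewrite [ltRHS](splitr e) [nrm _ (fourier_sum N a - _)]nrmC; apply: ltrD; exact: key.
Qed.

Lemma trace_coef a x n : trace a x -> L2sip x (expo R n) = a n.
Proof.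
move=> ax; apply: ccvg_unique (tends_ccvg (expo R n) ax) _.
apply: (@ccvg_near _ (fun=> a n) _ _ n.+1); last exact: ccvg_cst.
move=> N nN; rewrite ip_suml (bigD1 (Ordinal nN)) //= big1 ?addr0.
  by rewrite ipZl expo_orthonormal eqxx mulr1.
move=> i /eqP ik; rewrite ipZl expo_orthonormal (_ : (i : nat) == n = false) ?mulr0 //.
by apply/eqP => h; apply: ik; apply: val_inj.
Qed.

Lemma trace_ip a b x y : trace a x -> trace b y -> L2sip x y = ip a b.
Proof.
move=> ax bY; apply: ccvg_unique (tends_ccvg y ax) _.
have := ell2_ip_cvg a b; congr ccvg; apply/funext => N.
rewrite ip_suml; apply: eq_bigr => n _; rewrite ipZl; congr (_ * _).
by rewrite ip_conj (trace_coef n bY).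
Qed.

Lemma L2_expo_mul k x : L2circle (fun t => cis t ^+ k * (x t : R[i])).
Proof.
apply/L2circleP; split; first by apply: cmeasurableM; [apply: cmeasurableX; exact: cmeasurable_cis|exact: L2_cmeasurable].
by under [X in rintegrable X]eq_fun do rewrite sqmodM sqmodX sqmod_cis expr1n mul1r; exact: L2_rintegrable.
Qed.
Definition expo_mul k x : L2c := mkL2 (L2_expo_mul k x).

Lemma expo_mulE k x t : expo_mul k x t = cis t ^+ k * (x t : R[i]) :> R[i].
Proof. by []. Qed.

Lemma L2_ext x y : (forall t, x t = y t) -> x = y.
Proof. by move=> h; apply: val_inj; apply/funext. Qed.

Lemma expo_mul_is_linear k : linear (expo_mul k).
Proof.
move=> c x y; apply: L2_ext => t.
rewrite [RHS]L2D [in RHS]L2Z !expo_mulE [in LHS]L2D [in LHS]L2Z.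
by rewrite mulrDr mulrCA.
Qed.
HB.instance Definition _ k := GRing.isLinear.Build _ _ _ _ (expo_mul k) (expo_mul_is_linear k).

Lemma expo_mul_ip k x y : L2sip (expo_mul k x) (expo_mul k y) = L2sip x y.
Proof.
rewrite !L2sipE; apply: eq_circle_int => t _; rewrite !expo_mulE.
rewrite rmorphM rmorphXn /= mulrACA -exprMn mulCJ sqmod_cis expr1n.
by rewrite mul1r.
Qed.

Lemma trace_delay k a x : trace a x -> trace (delay k a) (expo_mul k x).
Proof.
have e N : fourier_sum (k + N) (delay k a) = expo_mul k (fourier_sum N a).
  rewrite /fourier_sum big_split_ord /= big1 ?add0r; last first.
    by move=> i _; rewrite coef_delay ltn_ord scale0r.
  rewrite linear_sum; apply: eq_bigr => i _.
  rewrite coef_delay ltnNge leq_addr /= addKn linearZ /=; congr (_ *: _).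
  by apply: L2_ext => t; rewrite expo_mulE !expoE exprD.
move=> ax eps e0; have [N hN] := ax eps e0; exists (k + N)%N => n nN.
have kn : (k <= n)%N := leq_trans (leq_addr _ _) nN.
rewrite -(subnKC kn) e -linearB /nrm /nsq expo_mul_ip; apply: hN.
by rewrite leq_subRL.
Qed.
(** Zero outside the disc, so that functions that agree on the disc are equal. *)
Definition taylor a : R[i] -> R[i] := fun z =>
  if pselect (sqmod z < 1) is left h then ip a (szego h) else 0.

Lemma taylor_cvg a z : sqmod z < 1 -> ccvg (fun N => \sum_(n < N) (a n : R[i]) * z ^+ n) (taylor a z).
Proof. by move=> z1; rewrite /taylor; case: pselect => // h; exact: ip_szego. Qed.

Lemma taylor_in a z (z1 : sqmod z < 1) : taylor a z = ip a (szego z1).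
Proof. by apply: ccvg_unique (taylor_cvg a z1) _; exact: ip_szego. Qed.

Lemma taylor_out a z : 1 <= sqmod z -> taylor a z = 0.
Proof. by move=> z1; rewrite /taylor; case: pselect => // h; move: z1; rewrite leNgt h. Qed.

Lemma taylor_linear c a b z : taylor (c *: a + b) z = c * taylor a z + taylor b z.
Proof.
have [z1|z1] := ltP (sqmod z) 1; first by rewrite !(taylor_in _ z1) ip_linl.
by rewrite !taylor_out // mulr0 addr0.
Qed.

Lemma taylorD a b z : taylor (a + b) z = taylor a z + taylor b z.
Proof. by have := taylor_linear 1 a b z; rewrite scale1r mul1r. Qed.

Definition dilation a (r : R) t : R[i] := taylor a (r%:C * cis t).

Lemma sqmod_dilation (r t : R) : sqmod (r%:C * cis t) = r ^+ 2.
Proof. by rewrite sqmodM sqmod_real sqmod_cis mulr1. Qed.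

(** A dilation multiplies the coefficients by powers of [r], so it does not
    increase the norm. On the circle of radius [r] the power series converges
    pointwise, and [L2_fatou] carries the bound from partial sums to the limit. *)
Lemma dilation_L2 a r : 0 <= r < 1 ->
  exists H : L2circle (dilation a r), nrm L2sip (mkL2 H) <= nrm ip a.
Proof.
move=> /andP[r0 r1].
have r21 : r ^+ 2 < 1 by rewrite expr_lt1.
pose v N : L2c := \sum_(n < N) ((a n : R[i]) * r%:C ^+ n) *: expo R n.
have vl t : ccvg (fun N => v N t) (dilation a r t).
  have := @taylor_cvg a (r%:C * cis t); rewrite sqmod_dilation => /(_ r21).
  congr ccvg; apply/funext => N; rewrite L2_sum; apply: eq_bigr => n _.
  by rewrite L2Z expoE exprMn mulrA.
have bd N : nsq L2sip (v N) <= nsq ip a.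
  rewrite (nsq_orthonormal _ (fun i j : 'I_N => expo_orthonormal R i j)).
  apply: le_trans (ell2_partial_le a N); apply: ler_sum => n _.
  rewrite sqmodM -[leRHS]mulr1; apply: ler_wpM2l; first exact: sqmod_ge0.
  by rewrite sqmodX sqmod_real exprn_ile1 // ?exprn_ge0 // ltW.
have [|//|H hH] := @L2_fatou _ v (dilation a r) (nsq ip a) _ _ bd.
- by apply: (@cmeasurable_limit _ (fun N => v N : R -> R[i])) => [N|t _]; [exact: L2_cmeasurable|exact: vl].
- by apply: aeW => t _; exact: vl.
by exists H; rewrite /nrm ler_sqrt ?nsq_ge0.
Qed.

Lemma dilation_fourier_sum (N : nat) a r t :  0 <= r < 1 ->
  dilation (trunc N a) r t = (\sum_(n < N) ((a n : R[i]) * r%:C ^+ n) *: expo R n : L2c) t.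
Proof.
move=> /andP[r0 r1]; have r21 : r ^+ 2 < 1 by rewrite expr_lt1.
have := @taylor_cvg (trunc N a) (r%:C * cis t); rewrite sqmod_dilation => /(_ r21) h.
apply: ccvg_unique h _; apply: (@ccvg_near _ (fun=> _) _ _ N) (ccvg_cst _) => M NM.
rewrite L2_sum (big_ord_widen _ (fun n : nat => (((a n : R[i]) * r%:C ^+ n) *: expo R n) t : R[i]) NM).
rewrite big_mkcond; apply: eq_bigr => n _; rewrite coef_trunc.
by case: ifP => _; rewrite ?mul0r // L2Z expoE exprMn mulrA.
Qed.

Lemma near_left1 : \forall r \near (1 : R)^'-, 0 <= r < 1.
Proof.
near=> r; apply/andP; split; near: r; [exact: nbhs_left_ge|exact: nbhs_left_lt].
Unshelve. all: by end_near.
Qed.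

(** Split [a] into a truncation and a tail of small norm. The dilation of the
    tail stays small by [dilation_L2]; for the truncation, a polynomial, the
    convergence as [r] tends to 1 is explicit. *)
Lemma dilation_near a (e : R) : 0 < e -> exists N0, forall N, (N0 <= N)%N ->
  \forall r \near (1 : R)^'-, exists H : L2circle (dilation a r),
    nrm L2sip (mkL2 H - fourier_sum N a) < e.
Proof.
move=> e0; have e20 : 0 < e / 2 by rewrite divr_gt0.
have [N0 hN0] := @trunc_tends _ a _ e20; exists N0 => N N0N.
have tail : nrm ip (a - trunc N a) < e / 2 by rewrite nrmC; exact: hN0.
have cv : (fun r : R => \sum_(n < N) sqmod (a n : R[i]) * (r ^+ n - 1) ^+ 2) @ (1 : R)^'- --> (0 : R).
  apply: cvg_at_left_filter.
  have h n : (fun r : R => r ^+ n - 1) @ (1 : R) --> (0 : R).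
    rewrite -(subrr (1 : R)); apply: cvgB; last exact: cvg_cst.
    by rewrite -{2}(expr1n R n); exact: exprn_continuous.
  have := @cvg_sum_ord R R _ _ N (fun n r => sqmod (a n : R[i]) * (r ^+ n - 1) ^+ 2) (fun=> 0).
  rewrite big1 //; apply => n.
  have h2 : (fun r : R => (r ^+ n - 1) * (r ^+ n - 1)) @ (1 : R) --> (0 * 0 : R).
    by apply: cvgM; exact: h.
  have h3 : (fun r : R => sqmod (a n : R[i]) * ((r ^+ n - 1) * (r ^+ n - 1)))
      @ (1 : R) --> (sqmod (a n : R[i]) * (0 * 0) : R) by exact: cvgMl_tmp.
  by move: h3; rewrite !mulr0.
have e220 : 0 < (e / 2) ^+ 2 by rewrite exprn_gt0.
have small := cvgr_lt _ cv _ e220.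
near=> r.
have r01 : 0 <= r < 1 by near: r; exact: near_left1.
have [H _] := dilation_L2 a r01.
have [H1 h1] := dilation_L2 (a - trunc N a) r01.
exists H.
have -> : mkL2 H - fourier_sum N a = mkL2 H1 +
   ((\sum_(n < N) ((a n : R[i]) * r%:C ^+ n) *: expo R n) - fourier_sum N a).
  rewrite addrA; congr (_ - _); apply: L2_ext => t.
  rewrite [RHS]L2D -dilation_fourier_sum // /dilation !mkL2E /dilation.
  by rewrite -taylorD subrK.
apply: le_lt_trans (nrmD _ _ _) _; rewrite [ltRHS](splitr e).
apply: ler_ltD; first exact: le_trans h1 (ltW tail).
rewrite nrm_lt // -sumrB; under eq_bigr do rewrite -scalerBl.
rewrite (nsq_orthonormal _ (fun i j : 'I_N => expo_orthonormal R i j)).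
have -> : \sum_(n < N) sqmod ((a n : R[i]) * r%:C ^+ n - a n) =
    \sum_(n < N) sqmod (a n : R[i]) * (r ^+ n - 1) ^+ 2.
  apply: eq_bigr => n _; rewrite -[X in _ - X]mulr1 -mulrBr sqmodM.
  by rewrite -rmorphXn -[1]/((1 : R)%:C) -rmorphB sqmod_real.
by near: r; exact: small.
Unshelve. all: by end_near.
Qed.

(** By [dilation_near], near [r = 1] the dilations are close to the Fourier
    partial sums, so both have the same limits. *)
Lemma boundary_trace a (h : R -> R[i]) :
  is_boundary (taylor a) h <-> exists H : L2circle h, trace a (mkL2 H).
Proof.
have p0 := @twopi_gt0 R.
have intE (H : L2circle h) r (Hr : L2circle (dilation a r)) :
    (\int[mu]_(t in D) (sqmod (taylor a (r%:C * cis t) - h t))%:E)%E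
    = (2 * pi * nsq L2sip (mkL2 Hr - mkL2 H))%:E.
  by rewrite -L2_nsq_EFin.
split=> [[H hb]|[H tr]].
  exists H => e e0.
  have e20 : 0 < e / 2 by rewrite divr_gt0.
  have [N0 hN] := dilation_near a e20; exists N0 => N N0N.
  have c0 : 0 < 2 * pi * (e / 2) ^+ 2 by rewrite mulr_gt0 ?exprn_gt0.
  have small : \forall r \near (1 : R)^'-,
     ((\int[mu]_(t in D) (sqmod (taylor a (r%:C * cis t) - h t))%:E) < (2 * pi * (e / 2) ^+ 2)%:E)%E.
    have /fine_cvgP[fin cv] := hb; have lt := cvgr_lt _ cv _ c0.
    by apply: filterS2 fin (lt _) => r /fineK <-; rewrite /= lte_fin.
  have [r [hr [Hr lt]]] := @filter_ex _ _ _ _ (filterI small (hN N N0N)).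
  move: hr; rewrite (intE H r Hr) lte_fin ltr_pM2l // -nrm_lt // => lt2.
  apply: le_lt_trans (nrmB _ _ (mkL2 Hr) _) _; rewrite [ltRHS](splitr e).
  by rewrite [nrm _ (fourier_sum N a - _)]nrmC; exact: ltrD.
split; first exact: H.
have near_int (e : R) : 0 < e -> \forall r \near (1 : R)^'-, exists Hr : L2circle (dilation a r),
    2 * pi * nsq L2sip (mkL2 Hr - mkL2 H) < e.
  move=> e0; have e1 : 0 < e / (2 * pi) by rewrite divr_gt0.
  have e2 : 0 < Num.sqrt (e / (2 * pi)) / 2 by rewrite divr_gt0 // sqrtr_gt0.
  have [N1 h1] := tr _ e2; have [N2 h2] := dilation_near a e2.
  pose N := maxn N1 N2; have := h2 N (leq_maxr _ _); apply: filterS => r [Hr lt].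
  exists Hr; rewrite mulrC -ltr_pdivlMr // -[ltRHS]sqr_sqrtr ?(ltW e1) //.
  rewrite -nrm_lt ?sqrtr_gt0 //; apply: le_lt_trans (nrmB _ _ (fourier_sum N a) _) _.
  by rewrite [ltRHS](splitr); apply: ltrD => //; apply: h1; exact: leq_maxl.
apply/fine_cvgP; split.
  by have := near_int 1 ltr01; apply: filterS => r [Hr _]; rewrite (intE H r Hr).
apply/cvgrPdist_lt => e e0; have := near_int e e0; apply: filterS => r [Hr lt] /=.
by rewrite (intE H r Hr) /= sub0r normrN ger0_norm // mulr_ge0 ?(ltW p0) // nsq_ge0.
Qed.
End Trace.

(** * Uniqueness of Fourier coefficients of integrable functions *)
Section FourierUniqueness.
Variable R : realType.
Local Notation mu := (@lebesgue_measure R).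
Local Notation D := (@angles R).
Local Notation mD := (@measurable_angles R).
Local Notation rint f := (Rintegral mu D f).

Lemma rintegrable_abs (f : R -> R) : rintegrable f -> rintegrable (fun t => `|f t|).
Proof. by move=> h; have := integrable_norm h. Qed.

Lemma cintegrableM_bounded (F g : R -> R[i]) (B : R) : cintegrable F -> cmeasurable g ->
  (forall t, Num.sqrt (sqmod (g t)) <= B) -> cintegrable (fun t => F t * g t).
Proof.
move=> [F1 F2] mg gB.
apply: (@cintegrable_le _ _ (fun t => B * (`|complex.Re (F t)| + `|complex.Im (F t)|))).
- by apply: cmeasurableM => //; split; exact: rintegrable_rmeasurable.
- by apply: rintegrableZ; apply: rintegrableD; exact: rintegrable_abs.
move=> t _; rewrite sqmodM mulrC sqrtrM ?sqmod_ge0 //.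
by apply: ler_pM; rewrite ?sqrtr_ge0 //; exact: mod_le_ReIm.
Qed.

Lemma mod_triangle (z w : R[i]) :
  Num.sqrt (sqmod (z + w)) <= Num.sqrt (sqmod z) + Num.sqrt (sqmod w).
Proof. by have := ler_normD z w; rewrite !normCE -rmorphD /= lecR. Qed.

Section Annihilator.
Variable F : R -> R[i].
Hypothesis iF : cintegrable F.
Hypothesis F0 : forall n, circle_int (fun t => F t * cis t ^+ n) = 0.
Hypothesis F0' : forall n, circle_int (fun t => F t * Num.conj (cis t) ^+ n) = 0.

Definition trig_monomial (n m : nat) (t : R) : R[i] := cis t ^+ n * Num.conj (cis t) ^+ m.

Lemma sqmod_trig_monomial n m t : sqmod (trig_monomial n m t) = 1.
Proof. by rewrite sqmodM !sqmodX sqmodJ sqmod_cis !expr1n mulr1. Qed.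

Lemma cmeasurable_trig_monomial n m : cmeasurable (trig_monomial n m).
Proof. by apply: cmeasurableM; apply: cmeasurableX; [|apply: cmeasurableJ]; exact: cmeasurable_cis. Qed.
(** The bounded multipliers [g] such that all Fourier coefficients of [F * g]
    vanish. They form a vector space containing the constants and stable under
    multiplication by trigonometric polynomials. *)
Definition annihilates (g : R -> R[i]) := [/\ cmeasurable g,
  exists B, forall t, Num.sqrt (sqmod (g t)) <= B &
  forall n m, circle_int (fun t => F t * (trig_monomial n m t * g t)) = 0].

Lemma annihilates1 : annihilates (fun=> 1).
Proof.
split; first exact: cmeasurable_cst.
  by exists 1 => t; rewrite /sqmod /= expr1n expr0n addr0 sqrtr1.
move=> n m; have [nm|/ltnW mn] := leqP m n.
  rewrite -(F0 (n - m)); apply: eq_circle_int => t _; rewrite mulr1 /trig_monomial.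
  by rewrite -{1}(subnK nm) exprD -mulrA -exprMn mulCJ sqmod_cis expr1n mulr1.
rewrite -(F0' (m - n)); apply: eq_circle_int => t _; rewrite mulr1 /trig_monomial.
rewrite -{1}(subnK mn) exprD (mulrCA (cis t ^+ n)) -exprMn mulCJ sqmod_cis expr1n mulr1.
by [].
Qed.

Lemma cintegrable_trig_monomial g n m : annihilates g ->
  cintegrable (fun t => F t * (trig_monomial n m t * g t)).
Proof.
move=> [mg [B hB] _]; apply: (@cintegrableM_bounded _ _ B) => //.
  by apply: cmeasurableM => //; exact: cmeasurable_trig_monomial.
by move=> t; rewrite sqmodM sqmod_trig_monomial mul1r.
Qed.

Lemma annihilates_lin c g h : annihilates g -> annihilates h ->
  annihilates (fun t => c * g t + h t).
Proof.
move=> ag ah; have [mg [B hB] g0] := ag; have [mh [B' hB'] h0] := ah; split.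
- by apply: cmeasurableD => //; apply: cmeasurableM => //; exact: cmeasurable_cst.
- exists (Num.sqrt (sqmod c) * B + B') => t; apply: le_trans (mod_triangle _ _) _.
  apply: lerD => //; rewrite sqmodM sqrtrM ?sqmod_ge0 //.
  by apply: ler_wpM2l => //; exact: sqrtr_ge0.
move=> n m; transitivity (c * circle_int (fun t => F t * (trig_monomial n m t * g t))
     + circle_int (fun t => F t * (trig_monomial n m t * h t))).
  rewrite -circle_intZ -?circle_intD; [|apply: cintegrableZ| |]; try exact: cintegrable_trig_monomial.
  by apply: eq_circle_int => t _; ring.
by rewrite g0 h0 mulr0 addr0.
Qed.

Lemma annihilates_trig_monomial i j g : annihilates g ->
  annihilates (fun t => trig_monomial i j t * g t).
Proof.
move=> [mg [B hB] g0]; split.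
- by apply: cmeasurableM => //; exact: cmeasurable_trig_monomial.
- by exists B => t; rewrite sqmodM sqmod_trig_monomial mul1r.
move=> n m; rewrite -(g0 (n + i)%N (m + j)%N); apply: eq_circle_int => t _.
by rewrite /trig_monomial !exprD; ring.
Qed.
(** A trigonometric polynomial with values between 0 and 1 that, for [b] between 0
    and [2 pi], is less than 1/2 before [b] and more than 1/2 after it, by the
    factorization [sepE]. *)
Definition sep (b t : R) : R := 2^-1 - (cos (t - b / 2) - cos (b / 2)) / 4.

Lemma sepC b t : (sep b t)%:C =
  (2^-1 + cos (b / 2) / 4)%:C * 1
  + (- (8^-1)%:C * Num.conj (cis (b / 2)) * trig_monomial 1 0 t
  + - (8^-1)%:C * cis (b / 2) * trig_monomial 0 1 t).
Proof.
rewrite /trig_monomial !expr0 !expr1 mulr1 mul1r /sep cosB conjE.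
by apply: complex_ext => /=; field.
Qed.

Lemma annihilates_sep b g : annihilates g -> annihilates (fun t => (sep b t)%:C * g t).
Proof.
move=> ag.
have h1 := annihilates_trig_monomial 1 0 ag; have h2 := annihilates_trig_monomial 0 1 ag.
have h0 := annihilates_lin (-1) ag ag.
have := annihilates_lin (2^-1 + cos (b / 2) / 4)%:C ag
  (annihilates_lin (- (8^-1)%:C * Num.conj (cis (b / 2))) h1
  (annihilates_lin (- (8^-1)%:C * cis (b / 2)) h2 h0)).
congr annihilates; apply/funext => t; rewrite sepC; ring.
Qed.

Lemma annihilates_sepX b n g : annihilates g ->
  annihilates (fun t => (sep b t)%:C ^+ n * g t).
Proof.
move=> ag; elim: n => [|n IH].
  by under [X in annihilates X]eq_fun do rewrite expr0 mul1r.
under [X in annihilates X]eq_fun do rewrite exprS -mulrA.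
exact: annihilates_sep.
Qed.

(** A polynomial in [x]. By Bernoulli's inequalities it tends, as [n] grows, to 1
    for [x < 1/2] and to 0 for [x > 1/2]; hence [bump n (sep b)] tends boundedly to
    the indicator of the open interval from 0 to [b]. *)
Definition bump (n : nat) (x : R) : R := (1 - x ^+ n) ^+ (2 ^ n).

Lemma annihilates_bump b n : annihilates (fun t => (bump n (sep b t))%:C).
Proof.
rewrite /bump; elim: (2 ^ n)%N => [|k IH].
  by under [X in annihilates X]eq_fun do rewrite expr0; exact: annihilates1.
have := annihilates_lin (-1) (annihilates_sepX b n IH) IH.
congr annihilates; apply/funext => t; have -> : ((1 - sep b t ^+ n) ^+ k.+1)%:C
    = (1 - (sep b t)%:C ^+ n) * ((1 - sep b t ^+ n) ^+ k)%:C.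
  by rewrite exprS rmorphM /= rmorphB /= rmorphXn.
ring.
Qed.
End Annihilator.

Lemma bump_ge0 n x : 0 <= x <= 1 -> 0 <= bump n x.
Proof. by move=> /andP[x0 x1]; rewrite exprn_ge0 // subr_ge0 exprn_ile1. Qed.

Lemma bump_le1 n x : 0 <= x <= 1 -> bump n x <= 1.
Proof.
move=> /andP[x0 x1]; rewrite exprn_ile1 ?subr_ge0 ?exprn_ile1 //.
by rewrite gerBl exprn_ge0.
Qed.

Lemma bernoulli_le (y : R) k : 0 <= y <= 1 -> 1 - k%:R * y <= (1 - y) ^+ k.
Proof.
move=> /andP[y0 y1]; elim: k => [|k IH]; first by rewrite mul0r subr0 expr0.
rewrite exprS; apply: le_trans (ler_wpM2l _ IH); last by rewrite subr_ge0.
have -> : (1 - y) * (1 - k%:R * y) = 1 - k.+1%:R * y + k%:R * y ^+ 2.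
  by rewrite -natr1; ring.
by rewrite lerDl mulr_ge0 // sqr_ge0.
Qed.

Lemma bernoulli_ge (y : R) k : 0 <= y <= 1 -> (1 - y) ^+ k * (1 + k%:R * y) <= 1.
Proof.
move=> /andP[y0 y1]; elim: k => [|k IH]; first by rewrite mul0r addr0 expr0 mul1r.
apply: le_trans IH; rewrite exprSr -mulrA; apply: ler_wpM2l.
  by rewrite exprn_ge0 // subr_ge0.
have -> : (1 - y) * (1 + k.+1%:R * y) = 1 + k%:R * y - (k.+1%:R * y ^+ 2).
  by rewrite -natr1; ring.
by rewrite gerBl mulr_ge0 // sqr_ge0.
Qed.

Lemma bump_lt_half x : 0 <= x < 2^-1 -> (fun n => bump n x) @ \oo --> (1 : R).
Proof.
move=> /andP[x0 x1].
have x01 : 0 <= x <= 1 by rewrite x0 (le_trans (ltW x1)) // invf_le1 // ler1n.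
have c : (fun n => 1 - (2 * x) ^+ n) @ \oo --> (1 : R).
  rewrite -[X in _ --> X]subr0; apply: cvgB; first exact: cvg_cst.
  by apply: cvg_expr; rewrite ger0_norm ?mulr_ge0 // -ltr_pdivlMl // mulr1.
have c1 : (fun=> 1 : R) @ \oo --> (1 : R) by exact: cvg_cst.
have : \forall n \near \oo, (1 - (2 * x) ^+ n) <= bump n x <= 1; last first.
  by move=> h; apply: (@squeeze_cvgr _ _ _ _ (fun n => 1 - (2 * x) ^+ n) (fun=> 1) _ h).
apply: nearW => n; rewrite bump_le1 // andbT.
rewrite exprMn -natrX; apply: bernoulli_le.
by rewrite exprn_ge0 //= exprn_ile1 //; case/andP: x01.
Qed.

Lemma bump_gt_half x : 2^-1 < x <= 1 -> (fun n => bump n x) @ \oo --> (0 : R).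
Proof.
move=> /andP[x0 x1]; have xp : 0 < x by apply: lt_trans x0; rewrite invr_gt0.
have x01 : 0 <= x <= 1 by rewrite (ltW xp).
have c : (fun n => (2 * x)^-1 ^+ n) @ \oo --> (0 : R).
  apply: cvg_expr; rewrite ger0_norm ?invr_ge0 ?mulr_ge0 ?(ltW xp) //.
  by rewrite invf_lt1 ?mulr_gt0 // -ltr_pdivrMl // mulr1.
have c0 : (fun=> 0 : R) @ \oo --> (0 : R) by exact: cvg_cst.
have : \forall n \near \oo, 0 <= bump n x <= (2 * x)^-1 ^+ n; last first.
  by move=> h; apply: (@squeeze_cvgr _ _ _ _ (fun=> 0) (fun n => (2 * x)^-1 ^+ n) _ h).
apply: nearW => n; rewrite bump_ge0 //=.
have y01 : 0 <= x ^+ n <= 1 by rewrite exprn_ge0 ?(ltW xp) //= exprn_ile1 // ltW.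
have := bernoulli_ge (2 ^ n) y01; rewrite -/(bump n x) natrX -exprMn => h.
rewrite exprVn -[leRHS]mul1r ler_pdivlMr; last by rewrite exprn_gt0 // mulr_gt0.
apply: le_trans h; apply: ler_wpM2l; first exact: bump_ge0.
by rewrite lerDr.
Qed.

Lemma sepE b t : sep b t = 2^-1 - sin (t / 2) * sin ((b - t) / 2) / 2.
Proof.
rewrite /sep; have -> : t - b / 2 = t / 2 - (b - t) / 2 by field.
have -> : b / 2 = t / 2 + (b - t) / 2 by field.
by rewrite cosB cosD; field.
Qed.

Lemma sep01 b t : 0 <= sep b t <= 1.
Proof.
have := cos_le1 (t - b / 2); have := cos_geN1 (t - b / 2).
have := cos_le1 (b / 2); have := cos_geN1 (b / 2).
rewrite /sep; lra.
Qed.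

Lemma sep_lt_half b t : 0 < t < b -> b <= 2 * pi -> sep b t < 2^-1.
Proof.
move=> /andP[t0 tb] b2; rewrite sepE gtrBl divr_gt0 // mulr_gt0 //.
  by apply: sin_gt0_pi; lra.
by apply: sin_gt0_pi; lra.
Qed.

Lemma sep_gt_half b t : 0 <= b -> b < t < 2 * pi -> 2^-1 < sep b t.
Proof.
move=> b0 /andP[bt t2]; rewrite sepE ltrBrDr gtrDl pmulr_llt0 ?invr_gt0 //.
rewrite pmulr_rlt0; last by apply: sin_gt0_pi; lra.
by rewrite -[_ / 2]opprK sinN oppr_lt0; apply: sin_gt0_pi; lra.
Qed.

Section Limit.
Variable f : R -> R.
Hypothesis iff : rintegrable f.
Hypothesis f0 : forall b n, rint (fun t => f t * bump n (sep b t)) = 0.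

Lemma rmeasurable_sep b : rmeasurable (sep b).
Proof.
have h : rmeasurable (fun t => cos (t - b / 2)).
  apply: measurable_funTS; apply: measurableT_comp.
    by apply: continuous_measurable_fun; exact: continuous_cos.
  exact: measurable_funB.
rewrite /sep; apply: measurable_funB => //.
by apply: measurable_funM => //; exact: measurable_funB.
Qed.

Lemma rmeasurable_bump b n : rmeasurable (fun t => bump n (sep b t)).
Proof.
apply: measurable_funX; apply: measurable_funB => //.
by apply: measurable_funX; exact: rmeasurable_sep.
Qed.

(** Dominated convergence along [bump n (sep b)]. *)
Lemma rint_initial b : 0 < b < 2 * pi -> rint (f \_ `]0, b[) = 0.
Proof.
move=> /andP[b0 b2].
pose f_ n t := (f t * bump n (sep b t))%:E.
pose g t := ((f \_ `]0, b[) t)%:E.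
have igf n : rintegrable (fun t => f t * bump n (sep b t)).
  apply: (rintegrable_le _ (rintegrable_abs iff)).
    by apply: measurable_funM; [exact: rintegrable_rmeasurable|exact: rmeasurable_bump].
  move=> t _; rewrite normrM -[leRHS]mulr1; apply: ler_wpM2l => //.
  by rewrite ger0_norm ?bump_ge0 ?bump_le1 // sep01.
have cvF : {ae mu, forall t, D t -> (fun n => f_ n t) @ \oo --> g t}.
  apply: (ae_mono (ae_and (ae_and (ae_neq 0) (ae_neq b)) (ae_neq (2 * pi)))).
  move=> t [[t0 tb] t2] Dt; apply: cvg_EFin; first exact: nearW.
  move: Dt; rewrite /angles /= in_itv /= => /andP[t0' t2'].
  have t0p : 0 < t by rewrite lt_neqAle eq_sym t0.
  have t2p : t < 2 * pi by rewrite lt_neqAle t2.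
  rewrite /g patchE; case: ifPn => [/set_mem|/negP tn].
    rewrite /= in_itv /= => h; rewrite -[f t in X in _ --> X]mulr1.
    apply: cvgMl_tmp; apply: bump_lt_half.
    have /andP[-> _] /= := sep01 b t; apply: sep_lt_half => //; exact: ltW.
  rewrite -[point](mulr0 (f t)).
  apply: cvgMl_tmp; apply: bump_gt_half; have /andP[_ ->] := sep01 b t; rewrite andbT.
  apply: sep_gt_half; first exact: ltW.
  rewrite t2p andbT ltNge le_eqVlt (negbTE tb) /=; apply/negP => tb'.
  by apply: tn; rewrite inE /= in_itv /= t0p.
have [] := @dominated_convergence _ _ _ mu D mD f_ g (fun t => `|f t|%:E).
- by move=> n; apply/measurable_EFinP; exact: rintegrable_rmeasurable.
- apply/measurable_EFinP; apply/measurable_restrict => //; first exact: mD.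
  apply: measurable_funS (rintegrable_rmeasurable iff); first exact: mD.
  by move=> t [].
- exact: cvF.
- by have := rintegrable_abs iff.
- apply: aeW => t n _; rewrite /= lee_fin normrM -[leRHS]mulr1; apply: ler_wpM2l => //.
  by rewrite ger0_norm ?bump_ge0 ?bump_le1 // sep01.
move=> _ _ cv.
have e0 : (\int[mu]_(t in D) g t)%E = 0%E.
  apply: (cvg_unique (@ereal_hausdorff R) cv).
  rewrite (_ : [sequence _]_n = fun=> 0%E); first exact: cvg_cst.
  by apply/funext => n; rewrite /f_ /= rint_EFin // f0.
by rewrite /Rintegral -/(g _) e0.
Qed.

(** The integral of [f] over every initial interval is 0, and by Lebesgue's
    differentiation theorem its derivative is [f] almost everywhere. *)
Theorem vanishing_integrals_ae : {ae mu, forall t, D t -> f t = 0}.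
Proof.
pose g := f \_ D.
have rintegrable' : mu.-integrable setT (EFin \o g).
  have := (@integrable_mkcond _ (measurableTypeR R) R mu D (EFin \o f) mD).1 iff.
  by rewrite restrict_EFin.
pose G x := Rintegral mu `]0, x] g.
have G0 x : 0 < x < 2 * pi -> G x = 0.
  move=> x02; rewrite -(rint_initial x02) /G.
  have sub : D `&` [set` `]0, x[] = [set` `]0, x[].
    apply/setIidPr => t; rewrite /angles /= !in_itv /= => /andP[/ltW -> tx].
    by case/andP: x02 => _ /ltW; exact: le_trans (ltW tx).
  have sub' : [set` `]0, x]] `&` D = [set` `]0, x]].
    apply/setIidPl => t; rewrite /angles /= !in_itv /= => /andP[/ltW -> tx].
    by case/andP: x02 => _ /ltW; exact: le_trans tx.
  rewrite -[RHS]Rintegral_mkcondr sub -[LHS]Rintegral_mkcondr sub'.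
  rewrite [RHS]Rintegral_itv_bndo_bndc //.
  apply: integrableS iff => //; first exact: mD.
  by rewrite -sub; exact: subIsetl.
have igy y : mu.-integrable `]0, y] (EFin \o g).
  by apply: integrableS rintegrable'.
have := @FTC1 _ g (BRight 0) igy (open_integrable_locally openT rintegrable').
move=> h.
apply: (ae_mono (ae_and h (ae_and (ae_neq 0) (ae_neq (2 * pi))))).
move=> x [hx [x0 x2]] Dx; have := Dx; rewrite /angles /= in_itv /= => /andP[x0' x2'].
have x0p : 0 < x by rewrite lt_neqAle eq_sym x0.
have x2p : x < 2 * pi by rewrite lt_neqAle x2.
have [_] := hx x0p.
rewrite /g patchE mem_set // => <-.
rewrite derive1E (@near_eq_derive _ _ _ _ (cst 0)) ?derive_cst //.
have : x \in `]0, 2 * pi[ by rewrite in_itv /= x0p.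
move=> /near_in_itvoo; apply: filterS => t; rewrite in_itv /=; exact: G0.
Qed.
End Limit.

(** [F] is orthogonal to every trigonometric polynomial, in particular to the
    [bump n (sep b)]. *)
Theorem fourier_uniqueness (F : R -> R[i]) : cintegrable F ->
  (forall n, circle_int (fun t => F t * cis t ^+ n) = 0) ->
  (forall n, circle_int (fun t => F t * Num.conj (cis t) ^+ n) = 0) ->
  {ae mu, forall t, D t -> F t = 0}.
Proof.
move=> iF F0 F0'.
have p0 : (2 * pi : R)^-1 != 0 by rewrite invr_eq0 gt_eqF // twopi_gt0.
have key b n : rint (fun t => complex.Re (F t) * bump n (sep b t)) = 0 /\
   rint (fun t => complex.Im (F t) * bump n (sep b t)) = 0.
  have [_ _ /(_ 0%N 0%N)] := annihilates_bump iF F0 F0' b n.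
  rewrite /circle_int => /eqP; rewrite mulf_eq0 => /orP[/eqP[/eqP]|/eqP[h1 h2]].
    by rewrite (negbTE p0).
  split.
    rewrite -[RHS]h1; apply: eq_rint => t _.
    by rewrite /trig_monomial !expr0 !mul1r cReM /= mulr0 subr0.
  rewrite -[RHS]h2; apply: eq_rint => t _.
  by rewrite /trig_monomial !expr0 !mul1r cImM /= mulr0 add0r.
have [i1 i2] := iF.
have h1 := vanishing_integrals_ae i1 (fun b n => (key b n).1).
have h2 := vanishing_integrals_ae i2 (fun b n => (key b n).2).
apply: (ae_mono (ae_and h1 h2)) => t [r i] Dt.
by apply: complex_ext; [exact: r|exact: i].
Qed.
End FourierUniqueness.

(** * The Hardy space in terms of Taylor coefficients *)
Section Interface.
Variable R : realType.
Local Notation mu := (@lebesgue_measure R).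
Local Notation D := (@angles R).
Local Notation mD := (@measurable_angles R).
Local Notation ell2 := (ell2 R).
Local Notation ip := (ell2_ip R).
Local Notation L2sip := (L2sip R).
Implicit Types (a b g : ell2).

Lemma normC_ge1 (z : R[i]) : (1 <= `|z|) = (1 <= sqmod z).
Proof.
by rewrite normCE -[1]/((1 : R)%:C) lecR -{1}(sqrtr1 R) ler_sqrt // sqmod_ge0.
Qed.

Lemma H2P (f : R[i] -> R[i]) : H2 f <-> exists a, f = taylor a.
Proof.
split=> [[f0 [u [su cu]]]|[a ->]].
  have bu N : \sum_(n < N) sqmod (u n) <= limn (series (fun n => sqmod (u n))).
    rewrite -(big_mkord xpredT (fun n => sqmod (u n))).
    apply: (@nondecreasing_cvgn_le _ (series (fun n => sqmod (u n)))) => //.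
    by apply: nondecreasing_series => n _ _; exact: sqmod_ge0.
  have [a ha] := mk_ell2 bu; exists a; apply/funext => z.
  have [z1|z1] := ltP (sqmod z) 1; last by rewrite taylor_out // f0 // normC_ge1.
  have /ccvgP h : (series (fun n => u n * z ^+ n : R[i]^o)) @ \oo --> (f z : R[i]^o).
    by apply: cu; rewrite normC_lt1.
  apply: ccvg_unique h _; have := taylor_cvg a z1; congr ccvg; apply/funext => N.
  by rewrite /series /= big_mkord; apply: eq_bigr => n _; rewrite ha.
split; first by move=> z; rewrite normC_ge1 => z1; exact: taylor_out.
exists a; split; first exact: ell2_summable.
move=> z; rewrite normC_lt1 => z1; apply/ccvgP.
have := taylor_cvg a z1; congr ccvg; apply/funext => N.
by rewrite /series /= big_mkord.
Qed.

Lemma boundary_taylor a : exists H : L2circle (boundary (taylor a)), trace a (mkL2 H).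
Proof.
apply/boundary_trace; have [x ax] := trace_exists a.
have : is_boundary (taylor a) (x : R -> R[i]).
  apply/boundary_trace; exists (L2mem x).
  by rewrite (_ : mkL2 _ = x) //; apply: L2_ext.
by move=> h; exact: (@xgetPex _ (fun=> 0) [set h | is_boundary (taylor a) h] (ex_intro _ _ h)).
Qed.

Lemma H2ip_taylor a b : H2ip (taylor a) (taylor b) = ip a b.
Proof.
have [Ha ta] := boundary_taylor a; have [Hb tb] := boundary_taylor b.
by rewrite -(trace_ip ta tb).
Qed.

Lemma taylor_combination c a b : c \*o taylor a + taylor b = taylor (c *: a + b).
Proof. by apply/funext => z; rewrite taylor_linear. Qed.

Lemma taylor_sub a b : taylor a - taylor b = taylor (a - b).
Proof.
apply/funext => z; rewrite -[LHS]/(taylor a z - taylor b z) -mulN1r addrC -taylor_linear.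
by rewrite scaleN1r addrC.
Qed.

Lemma taylor0 : taylor 0 = 0 :> (R[i] -> R[i]).
Proof. by have := taylor_sub 0 0; rewrite !subrr. Qed.

Lemma taylor_sum (I : finType) (c : I -> R[i]) (e : I -> ell2) :
  \sum_i (c i \*o taylor (e i)) = taylor (\sum_i c i *: e i).
Proof.
elim/big_rec2: _ => [|i x y _ ->]; first by rewrite taylor0.
by rewrite taylor_combination.
Qed.

Lemma taylor_inj : injective (@taylor R).
Proof.
move=> a b e; apply/eqP; rewrite -subr_eq0; apply/eqP.
apply: (@ell2_definite R); rewrite /nsq -H2ip_taylor.
by rewrite -taylor_sub e subrr -taylor0 H2ip_taylor ip0l.
Qed.

Lemma H2norm_sub a b : H2norm (taylor a - taylor b) = nrm ip (a - b).
Proof. by rewrite /H2norm taylor_sub H2ip_taylor. Qed.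

Lemma taylor_delay k a z : taylor (delay k a) z = z ^+ k * taylor a z.
Proof.
have [z1|z1] := ltP (sqmod z) 1; last by rewrite !taylor_out // mulr0.
by rewrite !(taylor_in _ z1) ip_szego_delay.
Qed.
Definition coefset (M : set (R[i] -> R[i])) : set ell2 := [set a | M (taylor a)].

Lemma coefset_linsub M : closed_subspace M -> linsub (coefset M).
Proof.
move=> [_ M0 Mlin _]; split; first by rewrite /coefset /= taylor0.
by move=> c a b Ma Mb; rewrite /coefset /= -taylor_combination; exact: Mlin.
Qed.

Lemma coefset_closed M : closed_subspace M -> closed_in ip (coefset M).
Proof.
move=> [_ _ _ Mcl] a h; apply: Mcl; first by apply/H2P; exists a.
by move=> e /h[b Mb ab]; exists (taylor b) => //; rewrite H2norm_sub.
Qed.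

Definition perp (K : set ell2) : set ell2 := [set a | forall k, K k -> ip a k = 0].

Lemma perp_linsub K : linsub (perp K).
Proof.
split=> [k _|c a b ha hb k Kk]; first exact: ip0l.
by rewrite ip_linl ha // hb // mulr0 addr0.
Qed.

Lemma perp_closed K : closed_in ip (perp K).
Proof.
move=> a h k Kk; apply: small_nrm_ip => e /h[b pb ab].
by exists (a - b) => //; rewrite ipBl pb // subr0.
Qed.

Lemma perp_perp K a : linsub K -> closed_in ip K -> perp (perp K) a -> K a.
Proof.
move=> sK cK h; have [y Ky hy] := projection a (@ell2_complete R) sK cK.
have e : a - y = 0.
  apply: (@ell2_definite R); rewrite /nsq.
  have py : perp K (a - y) by exact: hy.
  rewrite {1}ipBl h // sub0r ip_conj hy // rmorph0 oppr0.
  by [].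
by move/eqP: e; rewrite subr_eq0 => /eqP ->.
Qed.

Lemma coefset_perp M : M `<=` @H2 R ->
  coefset (orthogonal_complement M) = perp (coefset M).
Proof.
move=> MH; apply/seteqP; split => a.
  by move=> [_ h] k Mk; rewrite -H2ip_taylor; exact: h.
move=> h; split; first by apply/H2P; exists a.
move=> g Mg; have /H2P[b gb] := MH _ Mg; rewrite gb H2ip_taylor; apply: h.
by rewrite /coefset /= -gb.
Qed.

(** The projection exists by [projection], and the remainder is in the double
    orthogonal complement, which is the subspace itself. *)
Lemma orth_proj_taylor M (v : ell2) : closed_subspace M ->
  exists w, [/\ orth_proj (orthogonal_complement M) (taylor v) = taylor w,
    perp (coefset M) w & coefset M (v - w)].
Proof.
move=> cM; have [MH _ _ _] := cM.
set K := orthogonal_complement M.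
have [w pw hw] := projection v (@ell2_complete R) (@perp_linsub (coefset M)) (@perp_closed (coefset M)).
have Kw k : perp (coefset M) k <-> K (taylor k).
  by rewrite -(coefset_perp MH).
have ex : [set g | K g /\ forall k, K k -> H2ip (taylor v - g) k = 0] (taylor w).
  split; first exact/Kw.
  move=> k Kk; have /H2P[b kb] := Kk.1; rewrite kb taylor_sub H2ip_taylor; apply: hw.
  by apply/Kw; rewrite -kb.
have [] := @xgetPex _ 0 [set g | K g /\ forall k, K k -> H2ip (taylor v - g) k = 0] (ex_intro _ _ ex).
rewrite -/(orth_proj K (taylor v)) => Kg hg.
have /H2P[w' gw'] := Kg.1; exists w'; split => //.
  by apply/Kw; rewrite -gw'.
apply: (perp_perp (coefset_linsub cM) (coefset_closed cM)) => k pk.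
by rewrite -H2ip_taylor -taylor_sub -gw'; apply: hg; exact/Kw.
Qed.
(** Where the boundary function exceeds [B + 1] it is at distance at least 1 from
    every dilation, whose values are bounded by [B]. The dilations converge to it in
    mean square, so by Chebyshev's inequality this happens on a null set. *)
Lemma boundary_bounded b B (H : L2circle (boundary (taylor b))) :
  trace b (mkL2 H) -> (forall z : R[i], `|z| < 1 -> `|taylor b z| <= B%:C) ->
  {ae mu, forall t, D t -> Num.sqrt (sqmod (boundary (taylor b) t)) <= B + 1}.
Proof.
move=> tr hB; set h := boundary (taylor b).
pose m t := Num.sqrt (sqmod (h t)).
have mm : rmeasurable m.
  have ms : rmeasurable (fun t => sqmod (h t)) by apply: cmeasurable_sqmod; exact: (L2_cmeasurable (mkL2 H)).
  by have := measurableT_comp (continuous_measurable_fun (@sqrt_continuous R)) ms.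
pose E : set (measurableTypeR R) := D `&` [set t | B + 1 < m t].
have mE : measurable E.
  have := mm mD [set` `]B + 1, +oo[] (measurable_itv _).
  by rewrite set_itvE.
have bnd r : 0 <= r < 1 -> exists Hr : L2circle (dilation b r),
    (mu E <= (2 * pi * nsq L2sip (mkL2 Hr - mkL2 H))%:E)%E.
  move=> r01; have [Hr _] := dilation_L2 b r01; exists Hr.
  rewrite -L2_nsq_EFin.
  have -> : mu E = (\int[mu]_(t in D) (\1_E t)%:E)%E.
    rewrite integral_indic //; last exact: mD.
    by rewrite setIidl // => t [].
  apply: ge0_le_integral.
  - exact: mD.
  - by move=> t _; rewrite lee_fin.
  - by apply/measurable_EFinP; exact: measurable_indic.
  - by apply/measurable_EFinP; apply: cmeasurable_sqmod; exact: L2_cmeasurable.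
  move=> t Dt; rewrite lee_fin indicE.
  case: (boolP (t \in E)) => [/set_mem[_ /= mt]|_]; last exact: sqmod_ge0.
  have fB : Num.sqrt (sqmod (dilation b r t)) <= B.
    have := hB (r%:C * cis t); rewrite normC_lt1 sqmod_dilation normCE lecR; apply.
    by case/andP: r01 => r0 r1; rewrite expr_lt1.
  have : m t <= Num.sqrt (sqmod (dilation b r t - h t)) + Num.sqrt (sqmod (dilation b r t)).
    rewrite -[sqmod (_ - h t)]sqmodN opprB /m -{1}(subrK (dilation b r t) (h t)).
    exact: mod_triangle.
  move=> h1; have h2 : 1 < Num.sqrt (sqmod (dilation b r t - h t)) by lra.
  rewrite (_ : sqmod _ = sqmod (dilation b r t - h t)) //.
  rewrite -[X in _ <= X]sqr_sqrtr ?sqmod_ge0 // -(expr1n R 2).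
  by rewrite ler_pXn2r ?nnegrE ?sqrtr_ge0 //; exact: ltW.
have E0 : mu E = 0.
  apply/eqP; rewrite eq_le measure_ge0 andbT; apply/lee_addgt0Pr => e e0.
  rewrite add0e.
  have p0 := @twopi_gt0 R.
  have e1 : 0 < e / (2 * pi) by rewrite divr_gt0.
  have e2 : 0 < Num.sqrt (e / (2 * pi)) / 2 by rewrite divr_gt0 // sqrtr_gt0.
  have [N1 h1] := tr _ e2; have [N2 h2] := dilation_near b e2.
  pose N := maxn N1 N2; have near1 := h2 N (leq_maxr _ _).
  have near2 : \forall r \near (1 : R)^'-, (0 <= r < 1) /\
      exists Hr : L2circle (dilation b r),
        nrm L2sip (mkL2 Hr - fourier_sum N b) < Num.sqrt (e / (2 * pi)) / 2.
    by apply: filterS2 (near_left1 R) near1.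
  have [r [r01 [Hr lt]]] := filter_ex near2.
  have [Hr' le] := bnd r r01; apply: le_trans le _; rewrite lee_fin.
  rewrite mulrC -ler_pdivlMr // -[leRHS]sqr_sqrtr ?(ltW e1) //.
  rewrite -nrm_le ?sqrtr_ge0 // (_ : mkL2 Hr' = mkL2 Hr); last exact: L2_ext.
  apply: le_trans (nrmB _ _ (fourier_sum N b) _) _; rewrite [leRHS]splitr.
  by apply: lerD; apply: ltW => //; apply: h1; exact: leq_maxl.
exists E; split => // t /= /not_implyP[Dt /negP]; rewrite -ltNge => mt.
by split.
Qed.

(** The projection onto the Hardy space keeps the Fourier coefficients of
    nonnegative index, and the [n]-th Fourier coefficient of the product of [g] by
    the conjugate of [b] is [<g, z^n b>]. *)
Lemma toeplitz_taylor b B : (forall z : R[i], `|z| < 1 -> `|taylor b z| <= B%:C) ->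
  forall g, exists c : ell2, (forall n, c n = ip g (delay n b) :> R[i]) /\
    toeplitz (fun t => Num.conj (boundary (taylor b) t)) (taylor g) = taylor c.
Proof.
move=> hB g.
have [Hb tb] := boundary_taylor b; have [Hg tg] := boundary_taylor g.
have bb := boundary_bounded tb hB.
pose h t := Num.conj (boundary (taylor b) t) * boundary (taylor g) t.
have mh : cmeasurable h.
  by apply: cmeasurableM; [apply: cmeasurableJ; exact: (L2_cmeasurable (mkL2 Hb))|exact: (L2_cmeasurable (mkL2 Hg))].
have Hh : L2circle h.
  have [m1 m2] := mh; split => //.
  apply: (@le_lt_trans _ _ (\int[mu]_(t in D) ((B + 1) ^+ 2 * sqmod (boundary (taylor g) t))%:E)%E).
    apply: ae_ge0_le_integral.
    - exact: mD.
    - by move=> t _; rewrite lee_fin sqmod_ge0.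
    - by apply/measurable_EFinP; exact: cmeasurable_sqmod.
    - by move=> t _; rewrite lee_fin mulr_ge0 ?sqr_ge0 ?sqmod_ge0.
    - apply/measurable_EFinP; apply: measurable_funM => //.
      by apply: cmeasurable_sqmod; exact: (L2_cmeasurable (mkL2 Hg)).
    apply: (ae_mono bb) => t hb Dt; rewrite lee_fin sqmodM sqmodJ.
    apply: ler_wpM2r; first exact: sqmod_ge0.
    rewrite -[leLHS]sqr_sqrtr ?sqmod_ge0 // ler_pXn2r ?nnegrE ?sqrtr_ge0 //.
      exact: hb.
    by apply: le_trans (hb Dt); exact: sqrtr_ge0.
  rewrite rint_EFin; first exact: ltry.
  by apply: rintegrableZ; exact: (L2_rintegrable (mkL2 Hg)).
pose x := mkL2 Hh.
have xc n : L2sip x (expo R n) = ip g (delay n b).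
  rewrite -(trace_ip tg (trace_delay n tb)) !L2sipE; apply: eq_circle_int => t _.
  rewrite expoE expo_mulE !mkL2E rmorphM /= /h; ring.
have bc N : \sum_(n < N) sqmod (ip g (delay n b)) <= nsq L2sip x.
  under eq_bigr do rewrite -xc.
  by apply: bessel => i j; rewrite expo_orthonormal.
have [c hc] := @mk_ell2 _ (fun n => ip g (delay n b)) _ bc.
exists c; split=> //.
have orth (f : L2c R) d y : (forall n, L2sip f (expo R n) = 0) -> trace d y -> L2sip f y = 0.
  move=> f0 dy; rewrite ip_conj; apply: (ccvg_unique (ccvgJ (tends_ccvg f dy))).
  suff -> : (fun n => Num.conj (L2sip (fourier_sum n d) f)) = fun=> 0 by exact: ccvg_cst.
  apply/funext => n; rewrite -ip_conj ip_sumr big1 // => i _.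
  by rewrite ipZr f0 mulr0.
pose P := [set g' | H2 g' /\
    forall k, H2 k -> L2ip ((fun t => Num.conj (boundary (taylor b) t)) \* boundary (taylor g)
      - boundary g') (boundary k) = 0].
have Pc : P (taylor c).
  split; first by apply/H2P; exists c.
  move=> k /H2P[d ->]; have [Hc tc] := boundary_taylor c; have [Hd td] := boundary_taylor d.
  have := @orth (x - mkL2 Hc) d (mkL2 Hd) _ td; apply.
  by move=> n; rewrite ipBl xc (trace_coef n tc) hc subrr.
have [Hx Px] : P (toeplitz (fun t => Num.conj (boundary (taylor b) t)) (taylor g)).
  exact: (@xgetPex _ 0 P (ex_intro _ _ Pc)).
have /H2P[c' tE] := Hx; rewrite tE; congr taylor; apply: ell2_ext => n.
have [Hc tc] := boundary_taylor c'; have [He te] := boundary_taylor (delta R n).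
have := Px (taylor (delta R n)); rewrite tE => /(_ _).
move=> /(_ ((H2P _).2 (ex_intro _ _ erefl))) h0.
have {h0} : L2sip (x - mkL2 Hc) (mkL2 He) = 0 by exact: h0.
rewrite ipBl (trace_ip tc te) ip_delta => /eqP; rewrite subr_eq0 => /eqP <-.
have d0 : nrm L2sip (mkL2 He - expo R n) = 0.
  rewrite /nrm nsqB (trace_coef n te) /nsq (trace_ip te te) expo_orthonormal.
  rewrite ip_delta coef_delta eqxx /=.
  by rewrite (_ : 1 + 1 - 2 * 1 = 0 :> R) ?sqrtr0 //; ring.
have := nrm_eq0_ip x d0; rewrite ip_conj => /(congr1 Num.conj).
rewrite !conjE conjcK conjc0 ipBr => /eqP; rewrite subr_eq0 => /eqP ->.
by rewrite xc hc.
Qed.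
End Interface.

(** * Analyticity of power series *)
Section Analyticity.
Variable R : realType.
Local Notation ell2 := (ell2 R).
Local Notation ip := (ell2_ip R).
Implicit Types (a b : ell2).

Lemma back_is_linear : linear (@back R).
Proof. by move=> c a b; apply: ell2_ext => n. Qed.
HB.instance Definition _ := GRing.isLinear.Build _ _ _ _ (@back R) back_is_linear.

Lemma back_nrm a : nrm ip (back a) <= nrm ip a.
Proof.
rewrite /nrm ler_sqrt ?nsq_ge0 // -(delay_nsq 1 (back a)).
rewrite [in leRHS](back_delta0 a) nsqD ipZr ip_delay_delta0 mulr0 mulr0 addr0.
by rewrite lerDl nsq_ge0.
Qed.

Lemma cauchy_geometric (u : nat -> ell2) (s C : R) : 0 <= s < 1 -> 0 <= C ->
  (forall n, nrm ip (u n.+1 - u n) <= s ^+ n * C) -> exists l, tends ip u l.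
Proof.
move=> /andP[s0 s1] C0 hu; apply: (@ell2_complete R) => e e0.
have step n k : nrm ip (u (n + k)%N - u n) <= s ^+ n * (C / (1 - s)).
  have : nrm ip (u (n + k)%N - u n) <= s ^+ n * C * \sum_(i < k) s ^+ i.
    elim: k => [|k IH]; first by rewrite addn0 subrr nrm0 big_ord0 mulr0.
    rewrite addnS big_ord_recr mulrDr; apply: le_trans (nrmB _ _ (u (n + k)%N) _) _.
    rewrite addrC; apply: lerD => //; apply: le_trans (hu _) _.
    by rewrite exprD mulrAC.
  move=> h; apply: le_trans h _; rewrite -mulrA; apply: ler_wpM2l.
    by rewrite exprn_ge0.
  by apply: ler_wpM2l => //; exact: geo_bounded.
have p : 0 < C / (1 - s) + 1.
  by rewrite ltr_wpDl // divr_ge0 // subr_ge0 ltW.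
have [N hN] : exists N, s ^+ N * (C / (1 - s)) < e / 2.
  have : (fun k => s ^+ k) @ \oo --> (0 : R) by apply: cvg_expr; rewrite ger0_norm.
  have e2 : 0 < e / 2 / (C / (1 - s) + 1) by rewrite !divr_gt0.
  move=> /cvgrPdist_lt /(_ _ e2) [N _ /(_ N (leqnn N))].
  rewrite /= sub0r normrN ger0_norm ?exprn_ge0 // ltr_pdivlMr // => h; exists N.
  apply: le_lt_trans h; apply: ler_wpM2l; first exact: exprn_ge0.
  by rewrite lerDl.
have key m : (N <= m)%N -> nrm ip (u m - u N) < e / 2.
  by move=> Nm; rewrite -(subnKC Nm); apply: le_lt_trans (step _ _) hN.
exists N => m n Nm Nn; apply: le_lt_trans (nrmB _ _ (u N) _) _.
by rewrite [ltRHS](splitr e) [nrm _ (u N - _)]nrmC; apply: ltrD; exact: key.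
Qed.
(** The right-hand side is a contraction of ratio [|z|] in [b], because [back] does
    not increase norms; iterate it from 0. *)
Lemma resolvent a (z : R[i]) : sqmod z < 1 -> exists b, b = back (a + z *: b).
Proof.
move=> z1; pose u n := iter n (fun b => back (a + z *: b)) 0.
pose s := Num.sqrt (sqmod z).
have s01 : 0 <= s < 1 by rewrite sqrtr_ge0 -(sqrtr1 R) ltr_sqrt.
have contr b b' : nrm ip (back (a + z *: b) - back (a + z *: b')) <= s * nrm ip (b - b').
  rewrite -linearB /= opprD addrACA subrr add0r -scalerBr.
  by apply: le_trans (back_nrm _) _; rewrite nrmZ.
have [|b ub] := @cauchy_geometric u s (nrm ip (back a)) s01 (nrm_ge0 _ _).
  elim=> [|n IH]; first by rewrite /u /= scaler0 addr0 subr0 mul1r.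
  apply: le_trans (contr _ _) _; rewrite exprS -mulrA.
  by apply: ler_wpM2l => //; case/andP: s01.
exists b; apply/eqP; rewrite -subr_eq0; apply/eqP; apply: (@ell2_definite R).
suff n0 : nrm ip (b - back (a + z *: b)) = 0 by rewrite -sqr_nrm n0 expr0n.
apply/eqP; rewrite eq_le nrm_ge0 andbT; apply/ler_addgt0Pr => e e0; rewrite add0r.
have [N hN] := ub _ (divr_gt0 e0 (ltr0n _ 2)).
apply: le_trans (nrmB _ _ (u N.+1) _) _; rewrite [leRHS]splitr; apply: lerD.
  by rewrite nrmC; apply/ltW/hN.
apply: le_trans (contr _ _) _; apply: le_trans (ltW (hN N (leqnn N))).
by rewrite ler_piMl ?nrm_ge0 //; case/andP: s01 => _ /ltW.
Qed.

Lemma taylor_delta0 z : sqmod z < 1 -> taylor (delta R 0) z = 1.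
Proof.
move=> z1; rewrite (taylor_in _ z1) ip_conj ip_delta.
by rewrite /szego /coef /= /szego_fun expr0 conjE conjc1.
Qed.

(** If [b = back (a + z b)], then [a + z b] and [w b] agree as functions of [w] up
    to a constant, which is the value [a(z)]. *)
Lemma divided_difference a z : sqmod z < 1 -> exists b, forall w, sqmod w < 1 ->
  taylor a w - taylor a z = (w - z) * taylor b w.
Proof.
move=> z1; have [b hb] := resolvent a z1; exists b.
have e w : sqmod w < 1 -> taylor a w + z * taylor b w = w * taylor b w + ((a + z *: b) 0%N : R[i]).
  move=> w1; rewrite addrC -taylor_linear addrC.
  rewrite {1}(back_delta0 (a + z *: b)) -hb taylorD taylor_delay expr1.
  congr (_ + _); have := taylor_linear ((a + z *: b) 0%N) (delta R 0) 0 w.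
  by rewrite addr0 taylor_delta0 // mulr1 taylor0 => ->; rewrite addr0.
move=> w w1; have h1 := e w w1; have h2 := e z z1.
have -> : taylor a z = (a + z *: b) 0%N by apply: (addIr (z * taylor b z)); rewrite h2 addrC.
have -> : taylor a w = w * taylor b w + ((a + z *: b) 0%N : R[i]) - z * taylor b w.
  by rewrite -h1 addrK.
ring.
Qed.

Lemma taylor_locally_bounded b (q : R) : 0 <= q < 1 -> exists C : R, 0 < C /\
  forall w, sqmod w <= q -> Num.sqrt (sqmod (taylor b w)) <= C.
Proof.
move=> /andP[q0 q1].
exists (Num.sqrt (nsq ip b * (1 - q)^-1) + 1); split.
  by rewrite ltr_wpDl // sqrtr_ge0.
move=> w wq; have w1 : sqmod w < 1 by exact: le_lt_trans wq q1.
have iq : 0 < 1 - q by rewrite subr_gt0.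
apply: (@le_trans _ _ (Num.sqrt (nsq ip b * (1 - q)^-1))); last by rewrite lerDl.
rewrite ler_sqrt; last by rewrite mulr_ge0 ?nsq_ge0 // invr_ge0 ltW.
rewrite (taylor_in _ w1); apply: le_trans (cauchy_schwarz _ _ _) _.
apply: ler_wpM2l; first exact: nsq_ge0.
apply: (@le_trans _ _ (1 - sqmod w)^-1).
  apply: ell2_nsq_le => N.
  under eq_bigr do rewrite /szego /coef /= /szego_fun sqmodX sqmodJ.
  exact: geo_bounded (sqmod_ge0 w) w1 N.
by rewrite lef_pV2 ?posrE ?subr_gt0 // lerD2l lerN2.
Qed.

(** Dividing twice: the difference quotient minus [b(z)] is [h] times a function
    bounded near [z]. *)
Lemma taylor_derivable a (z : R[i]) : `|z| < 1 ->
  derivable (taylor a : R[i]^o -> R[i]^o) (z : R[i]^o) 1.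
Proof.
rewrite normC_lt1 => z1.
have [b hb] := divided_difference a z1.
have [b2 hb2] := divided_difference b z1.
pose s := Num.sqrt (sqmod z).
have s1 : s < 1 by rewrite -(sqrtr1 R) ltr_sqrt.
have s0 : 0 <= s := sqrtr_ge0 _.
pose rho := (1 + s) / 2.
have [r0 r1] : 0 <= rho /\ rho < 1 by rewrite /rho; split; lra.
have [C [C0 hC]] := @taylor_locally_bounded b2 (rho ^+ 2) ltac:(by rewrite sqr_ge0 expr_lt1).
apply/cvg_ex; exists (taylor b z : R[i]^o).
apply/cvgrPdist_lt => -[e e'] /=; rewrite ltcE /= => /andP[/eqP -> e0] {e'}.
pose d := Num.min ((1 - s) / 2) (e / C).
have d0 : 0 < d by rewrite lt_min !divr_gt0 ?subr_gt0.
exists d%:C; first by rewrite /= ltcR.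
move=> h /=; rewrite sub0r normrN normCE ltcR => hd hn0.
rewrite -[h *: 1]/(h * 1) mulr1.
have hz : Num.sqrt (sqmod (h + z)) <= rho.
  apply: le_trans (mod_triangle _ _) _.
  have : Num.sqrt (sqmod h) <= (1 - s) / 2 by apply/ltW; move: hd; rewrite lt_min => /andP[].
  rewrite -/s /rho; lra.
have hz2 : sqmod (h + z) <= rho ^+ 2.
  by rewrite -[leLHS]sqr_sqrtr ?sqmod_ge0 // ler_pXn2r ?nnegrE ?sqrtr_ge0.
have hz1 : sqmod (h + z) < 1 by apply: le_lt_trans hz2 _; rewrite expr_lt1.
rewrite -[_ *: _]/(h^-1 * _) hb // addrK mulrA mulVf // mul1r.
rewrite -normrN opprB hb2 // addrK normrM !normCE -rmorphM /=.
rewrite -[X in _ < X]/(e%:C) ltcR.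
apply: (@le_lt_trans _ _ (Num.sqrt (sqmod h) * C)).
  by apply: ler_wpM2l; [exact: sqrtr_ge0|exact: hC].
by rewrite -ltr_pdivlMr //; move: hd; rewrite lt_min => /andP[].
Qed.
End Analyticity.

(** * Inner matrices from delay-orthonormal families *)
Section InnerFamilies.
Variables (R : realType) (q : nat).
Local Notation mu := (@lebesgue_measure R).
Local Notation D := (@angles R).
Local Notation ell2 := (ell2 R).
Local Notation ip := (ell2_ip R).
Local Notation vip := (vec_ip (ell2_ip R) q).
Local Notation L2sip := (L2sip R).

Lemma cintegrable_sum (I : Type) (s : seq I) (F : I -> R -> R[i]) : (forall i, cintegrable (F i)) ->
  cintegrable (fun t => \sum_(i <- s) F i t).
Proof.
move=> cF; elim: s => [|i s IH].
  have := cintegrableZ 0 (cintegrable_expo R 0); congr cintegrable.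
  by apply/funext => t; rewrite big_nil mul0r.
have := cintegrableD (cF i) IH; congr cintegrable.
by apply/funext => t; rewrite big_cons.
Qed.

Lemma circle_int_sum (I : Type) (s : seq I) (F : I -> R -> R[i]) :
  (forall i, cintegrable (F i)) ->
  circle_int (fun t => \sum_(i <- s) F i t) = \sum_(i <- s) circle_int (F i).
Proof.
move=> cF; elim: s => [|i s IH].
  rewrite big_nil -[RHS](mul0r (circle_int (fun t => cis t ^+ 0))) -circle_intZ; last exact: cintegrable_expo.
  by congr circle_int; apply/funext => t; rewrite big_nil mul0r.
rewrite big_cons -IH -circle_intD //; last exact: cintegrable_sum.
by congr circle_int; apply/funext => t; rewrite big_cons.
Qed.

Definition dot (x y : 'I_q -> L2c R) (t : R) : R[i] :=
  \sum_k (x k t : R[i]) * Num.conj (y k t : R[i]).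

Lemma cintegrable_dot x y : cintegrable (dot x y).
Proof. by apply: cintegrable_sum => k; exact: L2_cintegrable. Qed.

Lemma circle_int_dot x y : circle_int (dot x y) = \sum_k L2sip (x k) (y k).
Proof. by rewrite circle_int_sum // => k; exact: L2_cintegrable. Qed.

(** Apply [fourier_uniqueness] to [dot x y - d]: the hypotheses say that its
    Fourier coefficients vanish. *)
Lemma dot_constant x y (d : R[i]) :
  (forall n, \sum_k L2sip (expo_mul n (x k)) (y k) = (n == 0%N)%:R * d) ->
  (forall n, \sum_k L2sip (x k) (expo_mul n (y k)) = (n == 0%N)%:R * d) ->
  {ae mu, forall t, D t -> dot x y t = d}.
Proof.
move=> h1 h2; have cintegrable_cst : cintegrable (fun=> - d : R[i]).
  have := cintegrableZ (- d) (cintegrable_expo R 0); congr cintegrable; apply/funext => t.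
  by rewrite expr0 mulr1.
have : {ae mu, forall t, D t -> dot x y t + - d = 0}.
  apply: fourier_uniqueness => [|n|n]; first exact: cintegrableD (cintegrable_dot x y) cintegrable_cst.
    transitivity (circle_int (fun t => dot (fun k => expo_mul n (x k)) y t
        + - d * (cis t ^+ n))).
      apply: eq_circle_int => t _; rewrite mulrDl /dot mulr_suml; congr (_ + _).
      by apply: eq_bigr => k _; rewrite expo_mulE; ring.
    rewrite circle_intD ?circle_int_dot ?h1; [|exact: cintegrable_dot|by apply: cintegrableZ; exact: cintegrable_expo].
    by rewrite circle_intZ ?circle_int_expo; [ring|exact: cintegrable_expo].
  have cc : cintegrable (fun t => Num.conj (cis t ^+ n : R[i])) by apply: cintegrableJ; exact: cintegrable_expo.
  transitivity (circle_int (fun t => dot x (fun k => expo_mul n (y k)) t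
      + - d * Num.conj (cis t ^+ n : R[i]))).
    apply: eq_circle_int => t _; rewrite mulrDl /dot mulr_suml rmorphXn /=; congr (_ + _).
    by apply: eq_bigr => k _; rewrite expo_mulE rmorphM rmorphXn /=; ring.
  rewrite circle_intD ?circle_int_dot ?h2; [|exact: cintegrable_dot|exact: cintegrableZ].
  rewrite circle_intZ // circle_intJ ?circle_int_expo; last exact: cintegrable_expo.
  by rewrite rmorph_nat; ring.
by move=> h; apply: (ae_mono h) => t ht /ht /eqP; rewrite subr_eq0 => /eqP.
Qed.

Lemma ae_ord n (P : 'I_n -> R -> Prop) : (forall i, {ae mu, forall t, P i t}) ->
  {ae mu, forall t, forall i, P i t}.
Proof.
elim: n P => [|n IH] P h; first by apply: (ae_mono (ae_neq 0)) => t _ [].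
apply: (ae_mono (ae_and (h ord0) (IH (fun i => P (lift ord0 i)) (fun i => h _)))).
move=> t [h0 hS] i.
by have [j ->|->] := unliftP ord0 i.
Qed.

Variables (r : nat) (Psi : 'I_r -> {ffun 'I_q -> ell2}).
Hypothesis oPsi : delay_orthonormal Psi.

Definition symbol (z : R[i]) : 'M[R[i]]_(q, r) := \matrix_(i, j) taylor (Psi j i) z.

Lemma symbol_entry i j : (fun z => symbol z i j) = taylor (Psi j i).
Proof. by apply/funext => z; rewrite mxE. Qed.

(** The Fourier coefficients of each entry of the Gram matrix are the inner products
    of delays of the columns, given by [delay_orthonormal]. *)
Lemma symbol_isometric : {ae mu, forall t, D t ->
  (map_mx Num.conj (boundary_mx symbol t))^T *m boundary_mx symbol t = 1%:M}.
Proof.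
have [X tX] : exists X : 'I_r -> 'I_q -> L2c R, forall j i,
    trace (Psi j i) (X j i) /\ forall t, X j i t = boundary (taylor (Psi j i)) t.
  pose H j i := projT1 (cid (boundary_taylor (Psi j i))).
  exists (fun j i => mkL2 (H j i)) => j i; split=> //.
  exact: (projT2 (cid (boundary_taylor (Psi j i)))).
have tr j i := (tX j i).1.
have gram i j : {ae mu, forall t, D t -> dot (X j) (X i) t = (i == j)%:R}.
  apply: dot_constant => n.
    transitivity (vip (vdelay n (Psi j)) (vdelay 0 (Psi i))).
      apply: eq_bigr => k _; rewrite !ffunE delay0.
      by apply: trace_ip; [exact: trace_delay|].
    by rewrite oPsi -natrM mulnb [j == i]eq_sym.
  transitivity (vip (vdelay 0 (Psi j)) (vdelay n (Psi i))).
    apply: eq_bigr => k _; rewrite !ffunE delay0.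
    by apply: trace_ip => //; exact: trace_delay.
  by rewrite oPsi -natrM mulnb [j == i]eq_sym [0%N == n]eq_sym.
apply: (ae_mono (ae_ord (fun i => ae_ord (fun j => gram i j)))) => t h Dt.
 apply/matrixP => i j; rewrite !mxE -(h i j Dt).
apply: eq_bigr => k _; rewrite !mxE !symbol_entry !(tX _ _).2 mulrC.
by [].
Qed.

(** At some point of the circle the boundary matrix, which has [q] rows, has a left
    inverse, so its [r] columns are independent. *)
Lemma isometric_few : (r <= q)%N.
Proof.
have [t Dt h] : exists2 t, D t &
    (map_mx Num.conj (boundary_mx symbol t))^T *m boundary_mx symbol t = 1%:M.
  apply: contrapT => no; have := symbol_isometric; case=> E [mE E0 sub].
  have : (mu D <= mu E)%E.
    apply: le_measure; rewrite ?inE //; first exact: measurable_angles.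
    by move=> t Dt; apply: sub => /= ht; apply: no; exists t => //; exact: ht.
  by rewrite E0 measure_angles lee_fin leNgt twopi_gt0.
by rewrite -(mxrank1 R[i] r) -h (leq_trans (mxrankM_maxr _ _)) // rank_leq_row.
Qed.

Lemma symbol_inner : inner_mx symbol.
Proof.
split=> [i j|]; last exact: symbol_isometric.
rewrite symbol_entry; split.
- by move=> z; rewrite normC_ge1; exact: taylor_out.
- by move=> z; exact: taylor_derivable.
exists 1 => z; rewrite normC_lt1 => z1.
rewrite (taylor_in _ z1) normCE lecR -(sqrtr1 R) ler_sqrt //.
exact: entry_bound.
Qed.
End InnerFamilies.

(** * Near invariance *)
Section Assembly.
Variable R : realType.
Local Notation ell2 := (ell2 R).
Local Notation ip := (ell2_ip R).
Implicit Types (M : set (R[i] -> R[i])).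

Lemma H2_family n (e : 'I_n -> R[i] -> R[i]) : (forall i, H2 (e i)) ->
  exists a : 'I_n -> ell2, e = fun i => taylor (a i).
Proof.
move=> He; have /choice[a ha] i := (H2P _).1 (He i).
by exists a; apply/funext.
Qed.

Lemma span_taylor n (e : 'I_n -> ell2) a :
  span_family (fun i => taylor (e i)) (taylor a) <-> exists c, a = \sum_i c i *: e i.
Proof.
split=> [[c]|[c ->]]; last by exists c; rewrite taylor_sum.
by rewrite taylor_sum => /taylor_inj; exists c.
Qed.

Lemma span_self n (e : 'I_n -> ell2) j : exists c, e j = \sum_i c i *: e i.
Proof.
exists (fun i => (i == j)%:R); rewrite (bigD1 j) //= eqxx scale1r big1 ?addr0 //.
by move=> i /negbTE ->; rewrite scale0r.
Qed.

(** The hypothesis gives [z g - sum_i <g, u_i> v_i] in [M]. Each [v_i] may be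
    replaced by its component [w_i] orthogonal to [M], the difference being in [M].
    The sum of the [<g, u_i> w_i] is then a combination of the [phi j], which are
    orthogonal to [M]; pairing with [phi j] shows that its coefficients are the
    [<z g, phi j>]. *)
Lemma nearly_invariant m p (u v : 'I_m -> ell2) (phi : 'I_p -> ell2) M :
  closed_subspace M ->
  invariant_under (fun (f : R[i] -> R[i]) (z : R[i]) =>
    Tz f z - \sum_(i < m) rank_one (taylor (v i)) (taylor (u i)) f z) M ->
  (forall i j, ip (phi i) (phi j) = (i == j)%:R) ->
  span_family (fun j => taylor (phi j)) =
  span_family (fun i => orth_proj (orthogonal_complement M) (taylor (v i))) ->
  forall g, coefset M g ->
    coefset M (delay 1 g - \sum_j ip (delay 1 g) (phi j) *: phi j).
Proof.
move=> cM inv ophi spE g Mg.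
have subM := coefset_linsub cM.
have /choice[w hw] i := orth_proj_taylor (v i) cM.
have {}spE a : (exists c, a = \sum_j c j *: phi j) <-> (exists c, a = \sum_i c i *: w i).
  rewrite -!span_taylor spE.
  by rewrite (_ : (fun i => orth_proj _ _) = fun i => taylor (w i)) //; apply/funext => i; case: (hw i).
have perp_phi j : perp (coefset M) (phi j).
  have [c ->] := (spE _).1 (span_self phi j).
  apply: linsub_sum; first exact: perp_linsub.
  by move=> i _; apply: (linsubZ (@perp_linsub _ _)); case: (hw i).
pose x := delay 1 g - \sum_i ip g (u i) *: v i.
have Mx : coefset M x.
  have := inv _ Mg; rewrite /coefset /=; congr M; apply/funext => z.
  rewrite /x -taylor_sub -taylor_sum -[RHS]/(_ - _) taylor_delay expr1 fct_sumE; congr (_ - _).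
  by apply: eq_bigr => i _; rewrite /rank_one H2ip_taylor.
pose y := delay 1 g - \sum_i ip g (u i) *: w i.
have My : coefset M y.
  rewrite (_ : y = x + \sum_i ip g (u i) *: (v i - w i)).
    apply: linsubD => //; apply: linsub_sum => // i _.
    by apply: linsubZ => //; case: (hw i).
  rewrite /y /x -addrA; congr (_ + _).
  rewrite [X in _ = _ + X](_ : _ = \sum_i ip g (u i) *: v i - \sum_i ip g (u i) *: w i).
    by rewrite addKr.
  by rewrite -sumrB; apply: eq_bigr => i _; rewrite scalerBr.
have [b yb] := (spE (\sum_i ip g (u i) *: w i)).2 (ex_intro _ _ erefl).
suff <- : y = delay 1 g - \sum_j ip (delay 1 g) (phi j) *: phi j by [].
rewrite /y yb; congr (_ - _); apply: eq_bigr => j _; congr (_ *: _).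
have : ip y (phi j) = 0 by rewrite ip_conj perp_phi // rmorph0.
rewrite /y yb ipBl ip_suml (bigD1 j) //= big1; last first.
  by move=> i ij; rewrite ipZl ophi (negbTE ij) mulr0.
rewrite ipZl ophi eqxx mulr1 addr0 => /eqP; rewrite subr_eq0 => /eqP ->.
by [].
Qed.
End Assembly.

Theorem theorem1p6 (R : realType) (m p : nat) (u v : 'I_m -> R[i] -> R[i])
    (M : set (R[i] -> R[i])) (phi : 'I_p -> R[i] -> R[i]) :
  (1 <= m)%N ->
  orthonormal_family u ->
  orthonormal_family v ->
  closed_subspace M ->
  invariant_under
    (fun (f : R[i] -> R[i]) (z : R[i]) =>
       Tz f z - \sum_(i < m) rank_one (v i) (u i) f z) M ->
  (forall i, Hinf (phi i)) ->
  orthonormal_basis phi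
    (span_family (fun i => orth_proj (orthogonal_complement M) (v i))) ->
  exists (p' : nat) (Psi : R[i] -> 'M[R[i]]_(p + 1, p')),
    [/\ (p' <= p + 1)%N,
        inner_mx Psi &
        M = [set g | H2 g /\
               mulH2vec Psi
                 (fun z => col_mx
                    (\col_i toeplitz (fun t => Num.conj (boundary (phi i) t)) g z)
                    (g z)%:M)]].
Proof.
move=> _ [/H2_family[u' ->] _] [/H2_family[v' ->] _] cM inv bphi.
move=> [[/H2_family[phi' phiE] ophi] spE]; subst phi.
have {}ophi i j : ell2_ip R (phi' i) (phi' j) = (i == j)%:R by rewrite -H2ip_taylor.
have near := nearly_invariant cM inv ophi spE.
have /choice[B hB] i : exists B : R, forall z : R[i], `|z| < 1 -> `|taylor (phi' i) z| <= B%:C.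
  by case: (bphi i).
have [T hT] : exists T : 'I_p -> ell2 R -> ell2 R, forall j g,
    (forall k, T j g k = ell2_ip R g (delay k (phi' j)) :> R[i]) /\
    toeplitz (fun t => Num.conj (boundary (taylor (phi' j)) t)) (taylor g) = taylor (T j g).
  exists (fun j => projT1 (choice (toeplitz_taylor (hB j)))) => j.
  exact: (projT2 (choice (toeplitz_taylor (hB j)))).
have TE j g k : T j g k = ell2_ip R g (delay k (phi' j)) :> R[i] by case: (hT j g).
have subM := coefset_linsub cM; have clM := coefset_closed cM.
have := beurling_lax (adherent_linsub (vec_ip (ell2_ip R) (p + 1)) (linsub_orbit_span TE subM))
  (@adherent_closed _ _ (vec_ip (ell2_ip R) (p + 1)) _)
  (model_delay TE subM) (fun r Psi o => isometric_few o).
move=> [r [Psi [rq oPsi model]]].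
(* The column of the theorem is [Wmap T g]. *)
have stackE g (X : {ffun 'I_(p + 1) -> ell2 R}) : X = Wmap T g <->
    (fun z => \col_i taylor (X i) z) = (fun z => col_mx
      (\col_i toeplitz (fun t => Num.conj (boundary (taylor (phi' i)) t)) (taylor g) z)
      (taylor g z)%:M).
  split=> [->|e].
    apply/funext => z; apply/colP => i; rewrite !mxE.
    case: splitP => j ij.
      by rewrite mxE (hT j g).2 (_ : i = lshift 1 j) ?stack_l //; exact: val_inj.
    by rewrite mxE ord1 eqxx (_ : i = rshift p j) ?stack_r //; exact: val_inj.
  apply/ffunP => i; apply: taylor_inj; apply/funext => z.
  move/(congr1 (fun F : R[i] -> 'cV_(p + 1) => F z i 0)): e; rewrite !mxE => ->; rewrite ffunE.
  case: splitP => j ij; first by rewrite mxE (hT j g).2.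
  by rewrite mxE ord1 eqxx.
(* Multiplication by [symbol Psi] is the limit of [synth Psi]. *)
have prodE (c : 'I_r -> ell2 R) X : tends (vec_ip (ell2_ip R) (p + 1)) (synth Psi c) X ->
    (fun z => \col_i taylor (X i) z) = (fun z => symbol Psi z *m \col_j taylor (c j) z).
  move=> lim; apply/funext => z; apply/colP => i; rewrite !mxE.
  under eq_bigr do rewrite !mxE.
  have [z1|z1] := ltP (sqmod z) 1.
    rewrite (taylor_in _ z1) (synth_eval z1 i lim).
    by apply: eq_bigr => j _; rewrite !(taylor_in _ z1).
  by rewrite taylor_out // big1 // => j _; rewrite taylor_out // mul0r.
exists r, (symbol Psi); split=> //; first exact: symbol_inner.
apply/seteqP; split=> f.
  move=> Mf; have [MH _ _ _] := cM; split; first exact: MH.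
  have /H2P[g gE] := MH _ Mf; subst f.
  have /(model_mem ophi TE subM clM near)/model[c lim] : coefset M g by [].
  exists (fun z => \col_j taylor (c j) z).
    move=> j; rewrite (_ : (fun z => _) = taylor (c j)); first by apply/H2P; exists (c j).
    by apply/funext => z; rewrite mxE.
  by rewrite -(prodE _ _ lim); symmetry; apply/stackE.
move=> [/H2P[g ->] [G HG eG]].
have /H2_family[c cE] := HG.
have {cE} GE : G = fun z => \col_j taylor (c j) z.
  apply/funext => z; apply/colP => j; rewrite mxE.
  by have := congr1 (fun F => F j z) cE.
have [X lim] := synth_cauchy oPsi c.
have XE : X = Wmap T g by apply/stackE; rewrite eG (prodE _ _ lim) GE.
by apply/(model_mem ophi TE subM clM near)/model; exists c; rewrite -XE.
Qed.
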